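(* Suppose we are given $p=\tilde O(1)$ (i.e. polylogarithmic in $n$) pairs of boolean arrays $(a_1,b_1),\dots,(a_p,b_p)$, each array of length $n$ indexed by $\{0,\dots,n-1\}$, and let $c_i$ be the boolean convolution of $a_i$ and $b_i$, $c_i[j]=\bigvee_{k+\ell=j}(a_i[k]\wedge b_i[\ell])$. Then deterministically in $\tilde O(n)$ time one can compute a permutation $\sigma$ of $\{0,\dots,n-1\}$ together with, for every $i\in[1,p]$ and every index $j$ with $c_i[j]=1$, the minimum witness of $c_i[j]$ with respect to $\sigma$, i.e. the element $k$ of $\{k\mid a_i[k]=b_i[j-k]=1\}$ that appears earliest in $\sigma$.
   Context: $\tilde O$ hides polylogarithmic factors in $n$. *)

(* Defs.v *)
From mathcomp Require Import all_boot all_fingroup.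

Set Implicit Arguments.
Unset Strict Implicit.
Unset Printing Implicit Defensive.

(* Running times are measured on a unit-cost word RAM with words of w bits,
   programmed in a structured imperative language.  The machine has scalar
   registers and random-access memory banks, both named by numerals occurring
   in the program text, so that a program uses finitely many of each; there is
   no source of randomness.  Every word operation costs one step.  An operation
   whose result does not fit in w bits has no value, and blocks the run: no
   run can gain anything from large numbers.  Bitwise operations are left out;
   they are simulated in O(w) steps, a polylogarithmic factor for w = O(log n). *)

Inductive binop := Add | Sub | Mul | Div | Mod | Eq | Lt.

Inductive expr :=
  | Lit of nat
  | Var of nat
  | Get of nat & expr        (* Get A e is the cell of address e in bank A *)
  | Bin of binop & expr & expr.

Inductive cmd :=
  | Skip
  | Assign of nat & expr
  | Store of nat & expr & expr    (* Store A e f writes f at address e of A *)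
  | Seq of cmd & cmd
  | If of expr & cmd & cmd
  | While of expr & cmd.

Record state := State { reg : nat -> nat; bank : nat -> nat -> nat }.

Definition set_reg (s : state) (x v : nat) : state :=
  State (fun y => if y == x then v else reg s y) (bank s).

Definition set_cell (s : state) (A i v : nat) : state :=
  State (reg s)
    (fun B j => if (B == A) && (j == i) then v else bank s B j).

(* Sub is truncated at 0, and x %/ 0 = 0, x %% 0 = x. *)
Definition binop_fun (o : binop) : nat -> nat -> nat :=
  match o with
  | Add => addn
  | Sub => subn
  | Mul => muln
  | Div => divn
  | Mod => modn
  | Eq => fun x y => x == y
  | Lt => fun x y => x < y
  end.

Definition word (w v : nat) : option nat := if v < 2 ^ w then Some v else None.

Fixpoint eval (w : nat) (s : state) (e : expr) : option nat :=
  match e with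
  | Lit v => word w v
  | Var x => word w (reg s x)
  | Get A f => if eval w s f is Some i then word w (bank s A i) else None
  | Bin o f g =>
      if eval w s f is Some x then
        if eval w s g is Some y then word w (binop_fun o x y) else None
      else None
  end.

Fixpoint cost (e : expr) : nat :=
  match e with
  | Lit _ | Var _ => 1
  | Get _ f => (cost f).+1
  | Bin _ f g => (cost f + cost g).+1
  end.

(* exec w c s t s' : with w-bit words, c run from s halts in s' after t steps,
   without any overflow.  Nonzero means true in conditions. *)
Inductive exec (w : nat) : cmd -> state -> nat -> state -> Prop :=
  | ExecSkip s :
      exec w Skip s 1 s
  | ExecAssign x e s v :
      eval w s e = Some v ->
      exec w (Assign x e) s (cost e).+1 (set_reg s x v)
  | ExecStore A e f s i v :
      eval w s e = Some i -> eval w s f = Some v ->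
      exec w (Store A e f) s (cost e + cost f).+1 (set_cell s A i v)
  | ExecSeq c1 c2 s1 s2 s3 t1 t2 :
      exec w c1 s1 t1 s2 -> exec w c2 s2 t2 s3 ->
      exec w (Seq c1 c2) s1 (t1 + t2) s3
  | ExecIf e c1 c2 s s' v t :
      eval w s e = Some v -> exec w (if v != 0 then c1 else c2) s t s' ->
      exec w (If e c1 c2) s ((cost e).+1 + t) s'
  | ExecWhileEnd e c s :
      eval w s e = Some 0 ->
      exec w (While e c) s (cost e).+1 s
  | ExecWhileLoop e c s1 s2 s3 v t1 t2 :
      eval w s1 e = Some v -> v != 0 ->
      exec w c s1 t1 s2 -> exec w (While e c) s2 t2 s3 ->
      exec w (While e c) s1 ((cost e).+1 + t1 + t2) s3.

Lemma exec_det w c s t s' t' s'' :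
  exec w c s t s' -> exec w c s t' s'' -> t = t' /\ s' = s''.
Proof.
move=> H; elim: H t' s'' => {c s t s'}.
- by move=> s t' s'' H; inversion H.
- move=> x e s v He t' s'' H; inversion H; subst.
  by split=> //; congruence.
- move=> A e f s i v He Hf t' s'' H; inversion H; subst.
  by split=> //; congruence.
- move=> c1 c2 s1 s2 s3 t1 t2 _ IH1 _ IH2 t' s'' H; inversion H; subst.
  have [? ?] := IH1 _ _ ltac:(eassumption); subst.
  by have [? ?] := IH2 _ _ ltac:(eassumption); subst.
- move=> e c1 c2 s s' v t He _ IH t' s'' H; inversion H; subst.
  have ? : v = v0 by congruence.
  subst; by have [? ?] := IH _ _ ltac:(eassumption); subst.
- move=> e c s He t' s'' H; inversion H; subst => //.
  have ? : v = 0 by congruence.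
  by subst.
- move=> e c s1 s2 s3 v t1 t2 He v0 _ IH1 _ IH2 t' s'' H; inversion H; subst.
    have ? : v = 0 by congruence.
    by subst.
  have [? ?] := IH1 _ _ ltac:(eassumption); subst.
  by have [? ?] := IH2 _ _ ltac:(eassumption); subst.
Qed.

(* The logarithm, kept positive so that powers of it also bound constants
   at n = 1. *)
Definition log2 (n : nat) : nat := (trunc_log 2 n).+1.

Definition conv (n : nat) (a b : n.-tuple bool) (j : nat) : bool :=
  [exists k : 'I_n, exists l : 'I_n, (k + l == j) && (tnth a k && tnth b l)].

(* Subtraction is truncated, hence the guard k <= j; cells of b outside of
   its range are read as false. *)
Definition witness (n : nat) (a b : n.-tuple bool) (j : nat) (k : 'I_n) : bool :=
  [&& tnth a k, k <= j & nth false b (j - k)].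

(* s is read as the sequence s 0, s 1, ..., s n.-1: the element k appears at
   position s^-1 k. *)
Definition min_witness (n : nat) (s : {perm 'I_n}) (a b : n.-tuple bool)
    (j : nat) (k : 'I_n) : Prop :=
  witness a b j k /\
  forall k' : 'I_n, witness a b j k' -> (s^-1)%g k <= (s^-1)%g k'.

Definition rows (p n : nat) (a : 'I_p -> n.-tuple bool) (x : nat) : nat :=
  if insub (x %/ n) is Some i then nth false (a i) (x %% n) else 0.

(* Registers 0 and 1 hold n and p, bank 0 holds the a i and bank 1 the b i, in
   row-major order; everything else is 0. *)
Definition input (p n : nat) (a b : 'I_p -> n.-tuple bool) : state :=
  State (nth 0 [:: n; p])
    (fun A => match A with 0 => rows a | 1 => rows b | _ => fun=> 0 end).

(* Bank 2 holds the sequence s; bank 3 holds the minimum witnesses, in rows of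
   length 2n - 1, the number of indices of a convolution.  Cells of bank 3 with
   conv (a i) (b i) j = false are unconstrained. *)
Definition output (p n : nat) (a b : 'I_p -> n.-tuple bool) (st : state)
    (s : {perm 'I_n}) : Prop :=
  (forall m : 'I_n, bank st 2 m = s m) /\
  (forall (i : 'I_p) (j : 'I_(n.*2.-1)), conv (a i) (b i) j ->
     exists2 k : 'I_n, bank st 3 (i * n.*2.-1 + j) = k &
       min_witness s (a i) (b i) j k).

(* Main.v *)
Require Import Defs.
From mathcomp Require Import all_boot all_fingroup.
From mathcomp Require Import all_algebra qpoly zify ring.

(* The number of witnesses of an output inside a subset P of the indices is an
   entry of a convolution, computed modulo 2n + 1 by Nussbaumer's recursive
   Fourier transform: in Z/(2n+1)[z]/(z^N + 1) the powers of z are the roots of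
   unity, so that no suitable prime has to be found.

   The permutation comes from prefixes [n] = P_0, P_1, P_2, ..., each at most half
   of the previous one.  The ranks in P_l are hashed by evaluating their base-q
   digits as a polynomial at al, for a prime q polylogarithmic in n: two ranks
   collide for few al, and the classes are balanced.  P_(l+1) is a union of hash
   classes, chosen greedily until every output with more than K witnesses in P_l
   has one in P_(l+1).  So an output with no witness in P_(l+1) has at most K in
   P_l; each of them is alone in its class for some al, and is then read off the
   convolution weighted by the indices.  The answer is the least one with respect
   to the final order, in which P_(l+1) precedes the rest of P_l. *)

Set Implicit Arguments.
Unset Strict Implicit.
Unset Printing Implicit Defensive.

Import GRing.Theory.

(** * A cost-aware program logic for the RAM *)

(** Determinism is the obstacle: random subsets would both hit every output with many witnesses and
    isolate the witnesses of the others. Hash classes play both roles, and there are only q^2 of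
    them, so all can be tried with polylogarithmically many convolutions. The constants fit together
    as follows. Choose G with 2^G above the number of outputs, and K = 16 G. By averaging, some
    class hits a fraction K / (2q) = 8G / q of the outputs still active, so that q / 4 rounds leave
    none. A class contains at most m / q + 1 of the first m ranks, so that these rounds mark at most
    m / 2 of them when q <= m. Ranks are hashed rather than indices because balance holds on initial
    segments of the numbers, and a prefix is one in terms of ranks. The modulus 2n + 1 exceeds every
    count and every index, so that reduction does not change the values that matter; being odd, it
    makes 2 invertible, as the inverse transform requires. *)

(** Expressions are evaluated over unbounded numbers, so that correctness is proved without
    mentioning words; overflow is excluded once and for all in [eval_ev]. *)
Fixpoint ev (s : state) (e : expr) : nat :=
  match e with
  | Lit v => v
  | Var x => reg s x
  | Get A f => bank s A (ev s f)
  | Bin o f g => binop_fun o (ev s f) (ev s g)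
  end.

Fixpoint max_lit (e : expr) : nat :=
  match e with
  | Lit v => v
  | Var _ => 0
  | Get _ f => max_lit f
  | Bin _ f g => maxn (max_lit f) (max_lit g)
  end.

(* PFor k x l e a runs a for x = 0, ..., e - 1, keeping the bound in register l;
   k distinguishes the loops of nearly linear length from those of polylogarithmic
   length. *)
Inductive prog :=
  | PSkip
  | PAssign of nat & expr
  | PStore of nat & expr & expr
  | PSeq of prog & prog
  | PIf of expr & prog & prog
  | PFor of bool & nat & nat & expr & prog.

Fixpoint compile (a : prog) : cmd :=
  match a with
  | PSkip => Skip
  | PAssign x e => Assign x e
  | PStore A e f => Store A e f
  | PSeq a b => Seq (compile a) (compile b)
  | PIf e a b => If e (compile a) (compile b)
  | PFor _ x l e a =>
      Seq (Assign l e) (Seq (Assign x (Lit 0))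
        (While (Bin Lt (Var x) (Var l))
           (Seq (compile a) (Assign x (Bin Add (Var x) (Lit 1))))))
  end.

Fixpoint mregs (a : prog) : seq nat :=
  match a with
  | PSkip | PStore _ _ _ => [::]
  | PAssign x _ => [:: x]
  | PSeq a b | PIf _ a b => mregs a ++ mregs b
  | PFor _ x l _ a => x :: l :: mregs a
  end.

Fixpoint mbanks (a : prog) : seq nat :=
  match a with
  | PSkip | PAssign _ _ => [::]
  | PStore A _ _ => [:: A]
  | PSeq a b | PIf _ a b => mbanks a ++ mbanks b
  | PFor _ _ _ _ a => mbanks a
  end.

(** A loop body may touch neither the counter nor the stored bound, so that the compiled [While]
    makes exactly the announced number of iterations. *)
Fixpoint wf (a : prog) : bool :=
  match a with
  | PSkip | PAssign _ _ | PStore _ _ _ => true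
  | PSeq a b | PIf _ a b => wf a && wf b
  | PFor _ x l _ a => [&& x != l, x \notin mregs a, l \notin mregs a & wf a]
  end.

(** An expression of cost c has value below [V ^ c], so this maximum decides how many words of size
    [V] a machine word must hold. The 3 in a loop is the cost of its compiled test and increment. *)
Fixpoint max_cost (a : prog) : nat :=
  match a with
  | PSkip => 0
  | PAssign _ e => cost e
  | PStore _ e f => maxn (cost e) (cost f)
  | PSeq a b => maxn (max_cost a) (max_cost b)
  | PIf e a b => maxn (cost e) (maxn (max_cost a) (max_cost b))
  | PFor _ _ _ e a => maxn (cost e) (maxn 3 (max_cost a))
  end.

Fixpoint prog_lit (a : prog) : nat :=
  match a with
  | PSkip => 0
  | PAssign _ e => max_lit e
  | PStore _ e f => maxn (max_lit e) (max_lit f)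
  | PSeq a b => maxn (prog_lit a) (prog_lit b)
  | PIf e a b => maxn (max_lit e) (maxn (prog_lit a) (prog_lit b))
  | PFor _ _ _ e a => maxn (max_lit e) (prog_lit a)
  end.

Definition frame (a : prog) (s s' : state) : Prop :=
  (forall x, x \notin mregs a -> reg s' x = reg s x) /\
  (forall A i, A \notin mbanks a -> bank s' A i = bank s A i).

Lemma frame_refl a s : frame a s s. Proof. by []. Qed.

(* V bounds the values stored, Y the number of iterations of the short loops,
   Z that of the long ones. *)
Section Wp.
Variables (V Y Z : nat).

Definition iters (long : bool) : nat := if long then Z else Y.

(** In a loop, 2 pays for resetting the counter, the two inner 4s for the test and the increment of
    each iteration, and the last 4 for the failing test. Adding both branches of a conditional loses
    only a constant factor. *)
Fixpoint time (a : prog) : nat :=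
  match a with
  | PSkip => 1
  | PAssign _ e => (cost e).+1
  | PStore _ e f => (cost e + cost f).+1
  | PSeq a b => time a + time b
  | PIf e a b => (cost e).+1 + (time a + time b)
  | PFor k _ _ e a => (cost e).+1 + (2 + (iters k * (4 + time a + 4) + 4))
  end.

Fixpoint wp_loop (x : nat) (body : state -> (state -> Prop) -> Prop)
    (k i : nat) (s : state) (Q : state -> Prop) : Prop :=
  if k is k'.+1 then
    body s (fun s' => wp_loop x body k' i.+1 (set_reg s' x i.+1) Q)
  else Q s.

Fixpoint wp (a : prog) (s : state) (Q : state -> Prop) : Prop :=
  match a with
  | PSkip => Q s
  | PAssign x e => ev s e < V /\ Q (set_reg s x (ev s e))
  | PStore A e f => ev s f < V /\ Q (set_cell s A (ev s e) (ev s f))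
  | PSeq a b => wp a s (fun s' => wp b s' Q)
  | PIf e a b => if ev s e != 0 then wp a s Q else wp b s Q
  | PFor k x l e a =>
      [/\ ev s e < V, ev s e <= iters k &
        wp_loop x (wp a) (ev s e) 0 (set_reg (set_reg s l (ev s e)) x 0) Q]
  end.

Lemma wp_loop_mono x (body : state -> (state -> Prop) -> Prop) (R : state -> state -> Prop) :
  (forall s (P Q : state -> Prop), (forall s', R s s' -> P s' -> Q s') ->
     body s P -> body s Q) ->
  (forall s, R s s) ->
  (forall s1 s2 s3, R s1 s2 -> R s2 s3 -> R s1 s3) ->
  (forall s v, R s (set_reg s x v)) ->
  forall k i s (P Q : state -> Prop), (forall s', R s s' -> P s' -> Q s') ->
    wp_loop x body k i s P -> wp_loop x body k i s Q.
Proof.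
move=> Hb Rr Rt Rx; elim=> [|k IH] i s P Q PQ /=; first exact: PQ.
apply: Hb => s' Rs; apply: IH => s'' Rs'; apply: PQ.
exact: Rt Rs (Rt _ _ _ (Rx _ _) Rs').
Qed.

Lemma frame_trans a s1 s2 s3 : frame a s1 s2 -> frame a s2 s3 -> frame a s1 s3.
Proof.
by move=> [r1 b1] [r2 b2]; split=> [x xa|A i Aa]; rewrite ?r2 ?r1 ?b2 ?b1.
Qed.

(** The frame comes for free in the second premise: no invariant below has to mention the registers
    and banks that a program leaves alone. *)
Lemma wp_conseq a s (P Q : state -> Prop) :
  wp a s P -> (forall s', frame a s s' -> P s' -> Q s') -> wp a s Q.
Proof.
move=> H PQ; move: H; elim: a s P Q PQ => [|x e|A e f|a IHa b IHb|e a IHa b IHb|k x l e a IHa]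
  s P Q PQ /=.
- exact: PQ.
- case=> ? H; split=> //; apply: PQ H; split=> //= y; rewrite inE.
  by move/negbTE->.
- case=> ? H; split=> //; apply: PQ H; split=> //= y i; rewrite inE.
  by move/negbTE->.
- apply: IHa => s' [r1 b1]; apply: IHb => s'' [r2 b2]; apply: PQ.
  split=> [x|A i] /=; rewrite mem_cat negb_or => /andP[ha hb].
    by rewrite r2 // r1.
  by rewrite b2 // b1.
- case: ifP => _; [apply: IHa|apply: IHb] => s' [r1 b1]; apply: PQ;
  by split=> [x|A i] /=; rewrite mem_cat negb_or => /andP[ha hb]; rewrite ?r1 ?b1.
- case=> eV eB H; split=> //.
  apply: (@wp_loop_mono _ _ (frame (PFor k x l e a)) _ _ _ _ _ _ _ P) H.
  + move=> s1 P1 Q1 PQ1; apply: IHa => s2 [r2 b2]; apply: PQ1; split=> //= y.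
    by rewrite !inE !negb_or => /and3P[_ _ ha]; rewrite r2.
  + exact: frame_refl.
  + exact: frame_trans.
  + by move=> s1 v; split=> //= y; rewrite !inE !negb_or => /and3P[/negbTE-> _ _].
  + move=> s' [r2 b2] H; apply: PQ => //; split=> //= y hy; rewrite r2 //=.
    by move: hy; rewrite !inE !negb_or => /and3P[/negbTE-> /negbTE->].
Qed.

Lemma wp_for k x l e a s N (I : nat -> state -> Prop) (Q : state -> Prop) :
  ev s e = N -> N < V -> N <= iters k ->
  I 0 (set_reg (set_reg s l N) x 0) ->
  (forall i s', i < N -> reg s' x = i -> frame (PFor k x l e a) s s' -> I i s' ->
     wp a s' (fun s'' => I i.+1 (set_reg s'' x i.+1))) ->
  (forall s', frame (PFor k x l e a) s s' -> I N s' -> Q s') ->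
  wp (PFor k x l e a) s Q.
Proof.
move=> eN NV NB I0 IS IQ /=; rewrite eN; split=> //.
set s0 := set_reg _ x 0 in I0 *.
have F0 : frame (PFor k x l e a) s s0.
  by split=> //= y; rewrite !inE !negb_or => /and3P[/negbTE-> /negbTE->].
have {}IQ : forall i s', N <= i -> frame (PFor k x l e a) s s' -> i <= N -> I i s' -> Q s'.
  move=> i s' Ni F iN; have -> : i = N by lia.
  exact: IQ.
have x0 : reg s0 x = 0 by rewrite /= eqxx.
have: 0 + N = N by []. clearbody s0.
move: {1 3}N 0 s0 x0 I0 F0.
elim=> [|j IH] i s0 xi Ii F ij /=; first by apply: (IQ i) => //; lia.
apply: wp_conseq (IS i s0 _ xi F Ii) _; first by lia.
move=> s1 [r1 b1] I1; apply: IH => //; rewrite /= ?eqxx //; last by lia.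
apply: frame_trans F _; split=> //= y.
by rewrite !inE !negb_or => /and3P[/negbTE-> _ /r1].
Qed.

(** The body may rely on the cells already written and on those still untouched. Tables defined by
    recursion need the former, updates in place the latter. *)
Lemma wp_scatter k x l A e f g s N (adr val : nat -> nat) (Q : state -> Prop) :
  x != l ->
  ev s e = N -> N < V -> N <= iters k ->
  {in [pred i | i < N] &, injective adr} ->
  (forall i s', i < N -> reg s' x = i -> frame (PFor k x l e (PStore A f g)) s s' ->
     (forall j, j < i -> bank s' A (adr j) = val j) ->
     (forall c, (forall j, j < i -> adr j <> c) -> bank s' A c = bank s A c) ->
     [/\ ev s' f = adr i, ev s' g = val i & val i < V]) ->
  (forall s', frame (PFor k x l e (PStore A f g)) s s' ->
     (forall j, j < N -> bank s' A (adr j) = val j) ->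
     (forall c, (forall j, j < N -> adr j <> c) -> bank s' A c = bank s A c) ->
     Q s') ->
  wp (PFor k x l e (PStore A f g)) s Q.
Proof.
move=> xl eN NV NB inj body post.
apply: (wp_for (N := N) (I := fun i s' => [/\ i <= N,
     forall j, j < i -> bank s' A (adr j) = val j &
     forall c, (forall j, j < i -> adr j <> c) -> bank s' A c = bank s A c])) => //.
- move=> i s' iN xi F [_ H1 H2] /=.
  have [-> -> vV] := body i s' iN xi F H1 H2; split=> //; split=> //= [j|c] H; rewrite eqxx /=.
    case: eqP => [E|/eqP ne]; first by congr val; apply: inj => //; rewrite inE //; lia.
    by apply: H1; case: (ltngtP j i) ne => [//| |->]; [lia|rewrite eqxx].
  by case: eqP => [E|_]; [case: (H i (leqnn _))|apply: H2 => j ji; apply: H; lia].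
- by move=> s' F [_ H1 H2]; apply: post.
Qed.

Lemma wp_fill k x l A e g s N (val : nat -> nat) (Q : state -> Prop) :
  x != l ->
  ev s e = N -> N < V -> N <= iters k ->
  (forall i s', i < N -> reg s' x = i -> frame (PFor k x l e (PStore A (Var x) g)) s s' ->
     (forall j, j < i -> bank s' A j = val j) ->
     (forall j, i <= j -> bank s' A j = bank s A j) ->
     ev s' g = val i /\ val i < V) ->
  (forall s', frame (PFor k x l e (PStore A (Var x) g)) s s' ->
     (forall j, j < N -> bank s' A j = val j) ->
     (forall j, N <= j -> bank s' A j = bank s A j) ->
     Q s') ->
  wp (PFor k x l e (PStore A (Var x) g)) s Q.
Proof.
move=> xl eN NV NB body post.
apply: (wp_scatter (N := N) (adr := id) (val := val)) => //.
- move=> i s' iN xi F H1 H2; rewrite /= xi.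
  have [] := body i s' iN xi F H1 => // j ij; apply: H2 => c; lia.
- by move=> s' F H1 H2; apply: post => // j Nj; apply: H2 => c; lia.
Qed.

Definition bounded (s : state) : Prop :=
  (forall x, reg s x < V) /\ (forall A i, bank s A i < V).

(** Products add exponents, and the unit of cost of the operation itself supplies a factor [V >= 2]
    that absorbs sums. *)
Lemma ev_bound s e : 1 < V -> bounded s -> max_lit e < V -> ev s e < V ^ cost e.
Proof.
move=> V1 [br bb].
have V0 : 0 < V by lia.
have pV k : 0 < k -> V <= V ^ k by move=> k0; rewrite -{1}(expn1 V) leq_pexp2l.
elim: e => [v|x|A f _|o f IHf g IHg] /=; rewrite ?expn1 //.
  by move=> _; apply: leq_trans (bb _ _) (pV _ _).
rewrite gtn_max => /andP[/IHf Hf /IHg Hg].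
have := pV _ (ltn0Sn (cost f + cost g)).
set a := V ^ cost f in Hf; set b := V ^ cost g in Hg.
have E : V ^ (cost f + cost g).+1 = V * (a * b) by rewrite expnS expnD.
rewrite E => VV.
have a1 : 0 < a by rewrite expn_gt0 V0.
have b1 : 0 < b by rewrite expn_gt0 V0.
move: (ev s f) (ev s g) Hf Hg => u v Hu Hv.
have ab : 2 * (a * b) <= V * (a * b) by rewrite leq_mul2r V1 orbT.
have aab : a <= a * b by rewrite leq_pmulr.
have bab : b <= a * b by rewrite leq_pmull.
have := leq_div u v; have := leq_mod u v.
have : u * v <= a * b by apply: leq_mul; apply: ltnW.
case: o => /=; try lia.
Qed.

Lemma eval_ev w s e : 1 < V -> bounded s -> max_lit e < V -> V ^ cost e <= 2 ^ w ->
  eval w s e = Some (ev s e).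
Proof.
move=> V1 bs le ew.
suff H : forall e, max_lit e < V -> V ^ cost e <= 2 ^ w -> word w (ev s e) = Some (ev s e) by
  elim: e le ew => [v|x|A f IHf|o f IHf g IHg] le ew;
  [exact: (H (Lit v))|exact: (H (Var x))| |];
  [rewrite /= IHf //;
     [exact: (H (Get A f))|apply: leq_trans ew; rewrite leq_pexp2l //=; lia]|
   have [lf lg] : max_lit f < V /\ max_lit g < V by move: le => /=; lia];
  rewrite /= IHf ?IHg //; [exact: (H (Bin o f g))| |];
  by apply: leq_trans ew; rewrite leq_pexp2l //=; lia.
move=> {}e {}le {}ew; rewrite /word ifT //.
exact: leq_trans (ev_bound V1 bs le) ew.
Qed.

Lemma bounded_reg s x v : bounded s -> v < V -> bounded (set_reg s x v).
Proof. by move=> [r b] vV; split=> //= y; case: ifP. Qed.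

Lemma bounded_cell s A i v : bounded s -> v < V -> bounded (set_cell s A i v).
Proof. by move=> [r b] vV; split=> //= B j; case: ifP. Qed.

Lemma wp_reg_preserved a s x (Q : state -> Prop) : x \notin mregs a ->
  wp a s Q -> wp a s (fun s' => reg s' x = reg s x /\ Q s').
Proof. by move=> xa H; apply: wp_conseq H _ => s' [r _]; split=> //; apply: r. Qed.

Theorem wp_exec w a s (Q : state -> Prop) :
  1 < V -> wf a -> prog_lit a < V -> V ^ max_cost a <= 2 ^ w ->
  bounded s -> wp a s Q ->
  exists t s', [/\ exec w (compile a) s t s', t <= time a, bounded s' & Q s'].
Proof.
move=> V1; have V0 : 0 < V by lia.
have le_pow i j : i <= j -> V ^ j <= 2 ^ w -> V ^ i <= 2 ^ w.
  by move=> ij; apply: leq_trans; rewrite leq_pexp2l.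
elim: a s Q => [|x e|A e f|a IHa b IHb|e a IHa b IHb|k x l e a IHa] s Q /= wfa la ma bs.
- by move=> H; exists 1, s; split=> //; constructor.
- move=> [eV H]; exists (cost e).+1, (set_reg s x (ev s e)); split=> //.
    by constructor; apply: eval_ev.
  exact: bounded_reg.
- move=> [fV H]; exists (cost e + cost f).+1, (set_cell s A (ev s e) (ev s f)); split=> //.
    by constructor; apply: eval_ev => //; try lia; apply: le_pow ma; lia.
  exact: bounded_cell.
- move=> H; case/andP: wfa => wa wb.
  have [||t1 [s1 [X1 T1 B1 W1]]] := IHa _ _ wa _ _ bs H; [lia|by apply: le_pow ma; lia|].
  have [||t2 [s2 [X2 T2 B2 W2]]] := IHb _ _ wb _ _ B1 W1; [lia|by apply: le_pow ma; lia|].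
  exists (t1 + t2), s2; split=> //; [exact: ExecSeq X1 X2|lia].
- case/andP: wfa => wa wb.
  have Ee : eval w s e = Some (ev s e).
    by apply: eval_ev => //; [lia|apply: le_pow ma; lia].
  case: ifP => ee H.
    have [||t1 [s1 [X1 T1 B1 W1]]] := IHa _ _ wa _ _ bs H; [lia|by apply: le_pow ma; lia|].
    exists ((cost e).+1 + t1), s1; split=> //; last by lia.
    by apply: (ExecIf (v := ev s e)) => //; rewrite ee.
  have [||t1 [s1 [X1 T1 B1 W1]]] := IHb _ _ wb _ _ bs H; [lia|by apply: le_pow ma; lia|].
  exists ((cost e).+1 + t1), s1; split=> //; last by lia.
  by apply: (ExecIf (v := ev s e)) => //; rewrite ee.
- case/and4P: wfa => xl xa lxa wa [eV eB].
  have Ee : eval w s e = Some (ev s e).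
    by apply: eval_ev => //; [lia|apply: le_pow ma; lia].
  set N := ev s e in eV eB Ee *.
  set s0 := set_reg _ x 0 => H.
  have b0 : bounded s0 by do 2! apply: bounded_reg => //.
  have x0 : reg s0 x = 0 by rewrite /= eqxx.
  have l0 : reg s0 l = N by rewrite /= eqxx eq_sym (negbTE xl).
  suff [t [s' [X T B HQ]]] : exists t s',
    [/\ exec w (While (Bin Lt (Var x) (Var l))
         (Seq (compile a) (Assign x (Bin Add (Var x) (Lit 1))))) s0 t s',
        t <= N * (4 + time a + 4) + 4, bounded s' & Q s'].
    exists ((cost e).+1 + (2 + t)), s'; split=> //.
      apply: ExecSeq; first by constructor; exact: Ee.
      apply: ExecSeq; last exact: X.
      by rewrite /s0; constructor; rewrite /= /word expn_gt0.
    have : N * (4 + time a + 4) <= iters k * (4 + time a + 4) by rewrite leq_mul2r eB orbT.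
    lia.
  have w3 : V ^ 3 <= 2 ^ w by apply: le_pow ma; lia.
  have : 0 + N = N by [].
  clearbody s0; move: {2 3 5}N {1 2 3}0 s0 b0 x0 l0 H.
  elim=> [|j IH] i s0 b0 xi li /= H ij.
    exists 4, s0; split=> //.
    apply: (@ExecWhileEnd w (Bin Lt (Var x) (Var l))).
    by rewrite (eval_ev V1 b0) //= xi li; case: ltnP => //; lia.
  have {}H := wp_reg_preserved lxa (wp_reg_preserved xa H).
  have [||t1 [s1 [X1 T1 B1 [l1 [x1 W1]]]]] := IHa _ _ wa _ _ b0 H; [lia|by apply: le_pow ma; lia|].
  have bi : bounded (set_reg s1 x i.+1) by apply: bounded_reg => //; lia.
  have [|||t2 [s2 [X2 T2 B2 HQ]]] := IH i.+1 _ bi _ _ W1.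
  + by rewrite /= eqxx.
  + by rewrite /= eq_sym (negbTE xl) l1 li.
  + lia.
  exists (4 + (t1 + 4) + t2), s2; split=> //; last by rewrite mulSn; lia.
  apply: (@ExecWhileLoop w (Bin Lt (Var x) (Var l)) _ _ (set_reg s1 x i.+1) _ 1) => //.
    by rewrite (eval_ev V1 b0) //= xi li ?(ltn_addr, leqnn) //; case: ltnP => //; lia.
  apply: ExecSeq X1 _; rewrite -[i.+1]addn1 -xi -x1.
  apply: (@ExecAssign w x (Bin Add (Var x) (Lit 1))).
  exact: (eval_ev V1 B1).
Qed.

End Wp.

Arguments wp : simpl never.

(** The degree of the running time in the near-linear parameter [Z]. The time bound is nearly linear
    because this number is 1 for the whole program. *)
Fixpoint long_depth (a : prog) : nat :=
  match a with
  | PSeq a b | PIf _ a b => maxn (long_depth a) (long_depth b)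
  | PFor k _ _ _ a => k + long_depth a
  | _ => 0
  end.

Fixpoint short_depth (a : prog) : nat :=
  match a with
  | PSeq a b | PIf _ a b => maxn (short_depth a) (short_depth b)
  | PFor k _ _ _ a => ~~ k + short_depth a
  | _ => 0
  end.

Lemma time_poly a : exists C, forall Y Z, 0 < Y -> 0 < Z ->
  time Y Z a <= C * Z ^ long_depth a * Y ^ short_depth a.
Proof.
have mono Y Z C i j i' j' : 0 < Y -> 0 < Z -> i <= i' -> j <= j' ->
    C * Z ^ i * Y ^ j <= C * Z ^ i' * Y ^ j'.
  by move=> Y0 Z0 ii jj; rewrite !leq_mul // leq_pexp2l.
have pos Y Z i j : 0 < Y -> 0 < Z -> 0 < Z ^ i * Y ^ j.
  by move=> Y0 Z0; rewrite muln_gt0 !expn_gt0 Y0 Z0.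
elim: a => [|x e|A e f|a [C1 IH1] b [C2 IH2]|e a [C1 IH1] b [C2 IH2]|k x l e a [C IH]] /=.
- by exists 1.
- by exists (cost e).+1 => *; rewrite !muln1.
- by exists (cost e + cost f).+1 => *; rewrite !muln1.
- exists (C1 + C2) => Y Z Y0 Z0; rewrite !mulnDl leq_add //.
    by apply: leq_trans (IH1 _ _ Y0 Z0) _; apply: mono => //; lia.
  by apply: leq_trans (IH2 _ _ Y0 Z0) _; apply: mono => //; lia.
- exists ((cost e).+1 + (C1 + C2)) => Y Z Y0 Z0.
  rewrite !mulnDl leq_add //; last rewrite leq_add //.
  + by rewrite -mulnA leq_pmulr // pos.
  + by apply: leq_trans (IH1 _ _ Y0 Z0) _; apply: mono => //; lia.
  + by apply: leq_trans (IH2 _ _ Y0 Z0) _; apply: mono => //; lia.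
- exists ((cost e).+1 + 6 + 8 + C) => Y Z Y0 Z0.
  have {IH} := IH _ _ Y0 Z0; have := pos Y Z (long_depth a) (short_depth a) Y0 Z0.
  rewrite !expnD -!mulnA; set P := Z ^ _; set R := Y ^ _ => PR IH.
  have -> : Z ^ k * (P * (Y ^ (~~ k) * R)) = iters Y Z k * (P * R).
    by rewrite /iters; case: k; rewrite /= ?expn1 ?expn0; nia.
  have i0 : 0 < iters Y Z k by rewrite /iters; case: ifP.
  nia.
Qed.

(** * The negacyclic Fourier transform *)

Lemma big_ord_mul (V : nmodType) m r (F : nat -> V) :
  (\sum_(x < m * r) F x = \sum_(i < m) \sum_(j < r) F (i * r + j)%N)%R.
Proof.
elim: m => [|m IH]; first by rewrite !big_ord0.
rewrite big_ord_recr /= -IH -(big_mkord xpredT F) -(big_mkord xpredT F).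
rewrite mulSn addnC (big_cat_nat (n := m * r)) ?leq_addr //=; congr (_ + _)%R.
rewrite -{1}[(m * r)%N]add0n big_addn addnC addnK big_mkord.
by apply: eq_bigr => i _; rewrite addnC.
Qed.

Lemma sum_window (V : nmodType) m (g : nat -> V) c :
  (forall i, g (i + m) = g i) ->
  (\sum_(i < m) g (i + c)%N = \sum_(i < m) g i)%R.
Proof.
move=> gm; elim: c => [|c IH]; first by apply: eq_bigr => i _; rewrite addn0.
rewrite -IH; case: m gm {IH} => [|m] gm; first by rewrite !big_ord0.
rewrite big_ord_recr [RHS]big_ord_recl /= addrC; congr (_ + _)%R.
  by rewrite -(gm (0 + c)) //; congr g; lia.
by apply: eq_bigr => i _; congr g; rewrite /bump /=; lia.
Qed.

(* One layer of the Fourier transform of length 2r, stored in blocks of 2r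
   elements of m coefficients: with h = r / sp, the element at t * h + i is mu
   times the sum of the element at (t mod sp) * 2h + i and of y ^ (t * (m / sp))
   times the one h places further, where y ^ m = -1 acts on coefficients by a
   negacyclic shift. *)
Definition layer (M mu m r sp : nat) (f : nat -> nat) (idx : nat) : nat :=
  let i1 := idx %% m in
  let pos := (idx %/ m) %% (2 * r) in
  let h := r %/ sp in
  let src := (idx %/ m) %/ (2 * r) * (2 * r) + (pos %/ h) %% sp * (2 * h) + pos %% h in
  let e := (i1 + 2 * m - pos %/ h * (m %/ sp)) %% (2 * m) in
  let x2 := f ((src + h) * m + e %% m) in
  (mu * (f (src * m + i1) + ((e < m) * x2 + (1 - (e < m)) * (M - x2 %% M)))) %% M.

(** A polynomial F with m r coefficients is written as the sum of [z ^ u] times F_u([z ^ r]) for u <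
    r. Each F_u becomes an element of m coefficients; r zero elements are appended so that the
    product of length 2r does not wrap around. *)
Definition expand (M m r : nat) (f : nat -> nat) (idx : nat) : nat :=
  let i0 := (idx %/ m) %% (2 * r) in
  ((i0 < r) * f ((idx %/ m) %/ (2 * r) * (m * r) + idx %% m * r + i0)) %% M.

(* The inverse transform leaves the k-th coefficient at index -k mod 2r. *)
Definition fold (M m r : nat) (f : nat -> nat) (idx : nat) : nat :=
  let j := idx %% (m * r) in
  let blk := idx %/ (m * r) in
  let i0 := j %% r in
  let i1 := j %/ r in
  let x := f ((blk * (2 * r) + (2 * r - (i0 + r)) %% (2 * r)) * m + (i1 + m - 1) %% m) in
  (f ((blk * (2 * r) + (2 * r - i0) %% (2 * r)) * m + i1) +
   ((0 < i1) * x + (1 - (0 < i1)) * (M - x %% M))) %% M.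

(** The bottom of the recursion: multiplication of pairs modulo [z ^ 2 + 1]. *)
Definition pmul (M : nat) (f g : nat -> nat) (idx : nat) : nat :=
  let b := idx %/ 2 * 2 in
  let j := idx %% 2 in
  let x := f (b + 1) * g (b + (1 - j)) in
  (f b * g (b + j) + ((0 < j) * x + (1 - (0 < j)) * (M - x %% M))) %% M.

(** * Transform identities over a commutative ring *)

Section Ring.
Variable S : comNzRingType.
Implicit Types (x y z w : S).
Local Open Scope ring_scope.

(** The geometric series formula would divide by [w ^+ d - 1], which may be a zero divisor. Instead
    the sum is cut in halves: the second is [(-1) ^+ d] times the first, so they cancel for odd d,
    and for even d they agree and induction applies to [w ^+ 2] and d / 2. *)
Lemma root_sum0 c w d : w ^+ (2 ^ c) = -1 -> (0 < d < 2 ^ c.+1)%N ->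
  \sum_(u < 2 ^ c.+1) w ^+ (d * u)%N = 0.
Proof.
elim: c w d => [|c IH] w d wc /andP[d0 dc].
  have -> : d = 1%N by lia.
  have -> : w = -1 by rewrite -[w]expr1 -wc.
  by rewrite expn1 !big_ord_recl big_ord0 /= mul1n expr0 expr1 addr0 subrr.
rewrite (expnS 2 c.+1) (big_ord_mul 2 _ (fun u => w ^+ (d * u)%N)).
rewrite !big_ord_recl big_ord0 addr0 /= -big_split /=.
have half i : w ^+ (d * (1 * 2 ^ c.+1 + i)) = (-1) ^+ odd d * w ^+ (d * i)%N.
  by rewrite mul1n mulnDr exprD (mulnC d (2 ^ _)%N) exprM wc signr_odd.
under eq_bigr => i _ do rewrite mul0n add0n half.
have [dodd|deven] := boolP (odd d).
  by apply: big1 => i _; rewrite expr1 mulN1r subrr.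
have w2 : (w ^+ 2) ^+ (2 ^ c) = -1 by rewrite -exprM -expnS.
have dE : d = (2 * d./2)%N by have := odd_double_half d; lia.
have pair i : w ^+ (d * i) + (-1) ^+ false * w ^+ (d * i) = (w ^+ 2) ^+ (d./2 * i) *+ 2.
  by rewrite expr0 mul1r -exprM mulnA -dE -mulr2n.
under eq_bigr => i _ do rewrite pair.
rewrite sumrMnl IH ?mul0rn //.
by move: dc; rewrite (expnS 2 c.+1); lia.
Qed.

Lemma root_sum c w e : w ^+ (2 ^ c) = -1 ->
  \sum_(t < 2 ^ c.+1) w ^+ (t * e)%N = if (e %% 2 ^ c.+1 == 0)%N then (2 ^ c.+1)%:R else 0.
Proof.
move=> wc; have w1 : w ^+ (2 ^ c.+1) = 1 by rewrite expnS mulnC exprM wc sqrrN expr1n.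
have E t : w ^+ (t * e) = w ^+ (e %% 2 ^ c.+1 * t).
  by rewrite [in LHS](divn_eq e (2 ^ c.+1)) mulnDr exprD mulnA mulnC exprM w1 expr1n mul1r mulnC.
under eq_bigr => t _ do rewrite E.
case: eqP => [->|/eqP e0].
  by under eq_bigr do rewrite mul0n expr0; rewrite sumr_const card_ord.
by rewrite (root_sum0 wc) // lt0n e0 ltn_pmod // expn_gt0.
Qed.

(** Orthogonality of the powers of [w] leaves only the terms with k = u + v, as u + v < L. The index
    [(L - k) %% L] lets the forward transform serve as the inverse one, and [hf ^+ c.+1] is 1 /
    L. *)
Lemma conv_dft c z w hf (A B : nat -> S) : w ^+ (2 ^ c) = -1 -> 2%:R * hf = 1 ->
  let L := (2 ^ c.+1)%N in
  \sum_(k < L) z ^+ k * (hf ^+ c.+1 * \sum_(t < L) w ^+ ((L - k) %% L * t)%N *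
     ((\sum_(u < 2 ^ c) w ^+ (t * u)%N * A u) * (\sum_(u < 2 ^ c) w ^+ (t * u)%N * B u))) =
  (\sum_(u < 2 ^ c) z ^+ u * A u) * (\sum_(u < 2 ^ c) z ^+ u * B u).
Proof.
move=> wc hf2 L.
have LE : L = (2 * 2 ^ c)%N by rewrite /L expnS.
have hL : hf ^+ c.+1 * L%:R = 1 by rewrite natrX -exprMn mulrC hf2 expr1n.
transitivity (\sum_(k < L) \sum_(u < 2 ^ c) \sum_(v < 2 ^ c)
    (if (k == u + v :> nat)%N then z ^+ (u + v) * (A u * B v) else 0)).
  apply: eq_bigr => k _.
  under eq_bigr => t _ do rewrite big_distrlr /= mulr_sumr.
  rewrite exchange_big !mulr_sumr /=; apply: eq_bigr => u _.
  under eq_bigr => t _ do rewrite mulr_sumr.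
  rewrite exchange_big !mulr_sumr /=; apply: eq_bigr => v _.
  pose e := ((L - k) %% L + u + v)%N.
  have -> : \sum_(t < L) w ^+ ((L - k) %% L * t)%N * (w ^+ (t * u)%N * A u * (w ^+ (t * v)%N * B v))
     = (\sum_(t < L) w ^+ (t * e)%N) * (A u * B v).
    rewrite mulr_suml; apply: eq_bigr => t _.
    by rewrite /e !mulnDr !exprD (mulnC (_ %% _)%N); ring.
  rewrite (root_sum _ wc) -/L.
  have kL := ltn_ord k; have ur := ltn_ord u; have vr := ltn_ord v.
  have -> : (e %% L == 0)%N = (k == u + v :> nat)%N.
    rewrite /e -addnA modnDml.
    have [k0|k0] := posnP k.
      by rewrite k0 subn0 modnDl modn_small ?(eq_sym 0%N) //; lia.
    apply/eqP/eqP => [h|->]; last by rewrite subnK ?modnn //; lia.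
    have [le|gt] := leqP k (u + v)%N.
      have E : (L - k + (u + v) = (u + v - k) + L)%N by lia.
      by move: h; rewrite E modnDr modn_small; lia.
    by move: h; rewrite modn_small; lia.
  case: eqP => [->|_]; last by rewrite mul0r !mulr0.
  by rewrite !mulrA -(mulrA (z ^+ _)) hL mulr1.
rewrite exchange_big big_distrlr /=; apply: eq_bigr => u _.
rewrite exchange_big /=; apply: eq_bigr => v _.
have ur := ltn_ord u; have vr := ltn_ord v.
have uvL : (u + v < L)%N by lia.
rewrite (bigD1 (Ordinal uvL)) //= eqxx big1 ?addr0; last first.
  by move=> k; rewrite -val_eqE /= => /negbTE->.
by rewrite exprD; ring.
Qed.

(** The Cooley-Tukey split by the parity of u; t may be reduced modulo [sp] because
    [(w ^+ 2) ^+ sp = 1]. *)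
Lemma fft_step w sp h (g : nat -> S) t : w ^+ (2 * sp) = 1 ->
  \sum_(u < sp) (w ^+ 2) ^+ (t %% sp * u)%N * g (u * (2 * h))%N
   + w ^+ t * \sum_(u < sp) (w ^+ 2) ^+ (t %% sp * u)%N * g (u * (2 * h) + h)%N
  = \sum_(u < 2 * sp) w ^+ (t * u)%N * g (u * h)%N.
Proof.
move=> w1.
have E u : (w ^+ 2) ^+ (t %% sp * u) = w ^+ (t * (u * 2)).
  rewrite -exprM [in RHS](divn_eq t sp).
  have -> : ((t %/ sp * sp + t %% sp) * (u * 2) = 2 * sp * (t %/ sp * u) + 2 * (t %% sp * u))%N.
    lia.
  by rewrite exprD (exprM w (2 * sp)%N) w1 expr1n mul1r.
rewrite [in RHS]mulnC (big_ord_mul sp 2 (fun u => w ^+ (t * u) * g (u * h)%N)).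
rewrite mulr_sumr -big_split /=; apply: eq_bigr => u _.
rewrite !big_ord_recl big_ord0 addr0 /= !E addn0 -mulnA; congr (_ + _).
rewrite mulrA -exprD /bump /=; congr (w ^+ _ * g _); lia.
Qed.

Section Char.
Variable M : nat.
Hypotheses (M_gt0 : (0 < M)%N) (M0 : M%:R = 0 :> S).

Lemma modR n : (n %% M)%:R = n%:R :> S.
Proof. by rewrite {2}(divn_eq n M) natrD natrM M0 mulr0 add0r. Qed.

Lemma negR n : (M - n %% M)%:R = - n%:R :> S.
Proof. by rewrite natrB 1?ltnW ?ltn_pmod // M0 modR sub0r. Qed.

Lemma ifR (b : bool) n : (b * n + (1 - b) * (M - n %% M))%:R = (if b then n%:R else - n%:R) :> S.
Proof.
case: b; first by rewrite mul1n subnn mul0n addn0.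
by rewrite mul0n subn0 mul1n add0n negR.
Qed.

(** Extend v to W with [W (e + m) = - W e]. Then [W e * y ^+ e] has period m, since both factors
    change sign, and its sum over any window of length m is the same. *)
Lemma rotate y m (v : nat -> S) c : y ^+ m = -1 -> (0 < m)%N -> (c <= 2 * m)%N ->
  \sum_(i < m) (let e := ((i + 2 * m - c) %% (2 * m))%N in
                if (e < m)%N then v (e %% m)%N else - v (e %% m)%N) * y ^+ i =
  y ^+ c * \sum_(i < m) v i * y ^+ i.
Proof.
move=> ym m0 cm.
pose W e := let e' := (e %% (2 * m))%N in if (e' < m)%N then v (e' %% m)%N else - v (e' %% m)%N.
have Wm e : W (e + m)%N = - W e.
  rewrite /W; set e' := (e %% _)%N.
  have e'm : (e' < 2 * m)%N by rewrite ltn_pmod // muln_gt0.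
  have -> : ((e + m) %% (2 * m) = if (e' < m) then e' + m else e' - m)%N.
    rewrite -modnDml -/e'; case: ltnP => h; first by rewrite modn_small //; lia.
    have -> : (e' + m = e' - m + 2 * m)%N by lia.
    by rewrite modnDr modn_small //; lia.
  case: (ltnP e' m) => h.
    by rewrite ifF ?modnDr //; lia.
  rewrite ifT ?opprK; last by lia.
  by rewrite -{2}[e'](subnK h) modnDr.
pose g e := W e * y ^+ e.
have gm e : g (e + m)%N = g e by rewrite /g Wm exprD ym mulrN1 mulrNN.
have y2m : y ^+ (2 * m) = 1 by rewrite mulnC exprM ym sqrrN expr1n.
have -> : \sum_(i < m) v i * y ^+ i = \sum_(i < m) g i.
  apply: eq_bigr => i _; have im := ltn_ord i.
  have Ei : (i %% (2 * m) = i)%N by rewrite modn_small //; lia.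
  by rewrite /g /W Ei im modn_small.
rewrite -(sum_window (2 * m - c) gm) mulr_sumr; apply: eq_bigr => i _.
rewrite /g mulrCA -exprD /=; congr (_ * _); first by rewrite addnBA.
have -> : (c + (i + (2 * m - c)) = i + 2 * m)%N by lia.
by rewrite exprD y2m mulr1.
Qed.

Definition el z m (f : nat -> nat) b : S := \sum_(i < m) (f (b * m + i)%N)%:R * z ^+ i.

Lemma el_layer y mu h c sp (f f' : nat -> nat) b t i :
  y ^+ (sp * c) = -1 -> (0 < h)%N -> (0 < c)%N -> (t < 2 * sp)%N -> (i < h)%N ->
  let m := (sp * c)%N in let r := (sp * h)%N in
  let src := (b * (2 * r) + (t %% sp * (2 * h) + i))%N in
  let q := (b * (2 * r) + (t * h + i))%N in
  (forall j, (j < m)%N -> f' (q * m + j)%N = layer M mu m r sp f (q * m + j)) ->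
  el y m f' q = mu%:R * (el y m f src + y ^+ (t * c) * el y m f (src + h)).
Proof.
move=> ym h0 c0 tsp ih m r src q f'E.
have sp0 : (0 < sp)%N by lia.
have m0 : (0 < m)%N by rewrite muln_gt0 sp0.
have posr : (t * h + i < 2 * r)%N.
  by have : (t.+1 * h <= 2 * sp * h)%N; [rewrite leq_mul2r tsp orbT|rewrite /r mulSn -mulnA; lia].
have tc : (t * c <= 2 * m)%N by rewrite /m mulnA leq_mul2r ltnW ?orbT.
rewrite {3}/el -(rotate (fun j => (f ((src + h) * m + j)%N)%:R) ym m0 tc).
rewrite /el -big_split mulr_sumr /=; apply: eq_bigr => j _.
rewrite f'E // -mulrDl mulrA; congr (_ * _).
have jm := ltn_ord j.
have E1 : ((q * m + j) %% m = j)%N by rewrite modnMDl modn_small.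
have E2 : ((q * m + j) %/ m = q)%N by rewrite divnMDl // divn_small // addn0.
have E3 : (q %% (2 * r) = t * h + i)%N by rewrite modnMDl modn_small.
have E4 : (q %/ (2 * r) = b)%N by rewrite divnMDl ?divn_small ?addn0 //; lia.
have E5 : (r %/ sp = h)%N by rewrite mulKn.
have E6 : (m %/ sp = c)%N by rewrite mulKn.
have E7 : ((t * h + i) %/ h = t)%N by rewrite divnMDl // divn_small // addn0.
have E8 : ((t * h + i) %% h = i)%N by rewrite modnMDl modn_small.
rewrite /layer E1 E2 E3 E4 E5 E6 E7 E8 modR natrM natrD ifR -addnA.
by rewrite -/src.
Qed.

Lemma el_expand y m r (f f' : nat -> nat) b u : (0 < m)%N -> (u < 2 * r)%N ->
  let q := (b * (2 * r) + u)%N in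
  (forall j, (j < m)%N -> f' (q * m + j)%N = expand M m r f (q * m + j)) ->
  el y m f' q = if (u < r)%N then \sum_(j < m) (f (b * (m * r) + j * r + u)%N)%:R * y ^+ j else 0.
Proof.
move=> m0 ur q f'E; rewrite /el.
have E j : (j < m)%N -> f' (q * m + j)%N = (((u < r) * f (b * (m * r) + j * r + u)) %% M)%N.
  move=> jm.
  have E1 : ((q * m + j) %% m = j)%N by rewrite modnMDl modn_small.
  have E2 : ((q * m + j) %/ m = q)%N by rewrite divnMDl // divn_small // addn0.
  have E3 : (q %% (2 * r) = u)%N by rewrite modnMDl modn_small.
  have E4 : (q %/ (2 * r) = b)%N by rewrite divnMDl ?divn_small ?addn0 //; lia.
  by rewrite f'E // /expand E1 E2 E3 E4.
case: ltnP E => _ E; first by apply: eq_bigr => j _; rewrite E // mul1n modR.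
by apply: big1 => j _; rewrite E // mul0n mod0n mul0r.
Qed.

Lemma el_parts z m r f b :
  el z (m * r) f b =
  \sum_(u < r) z ^+ u * \sum_(j < m) (f (b * (m * r) + j * r + u)%N)%:R * (z ^+ r) ^+ j.
Proof.
rewrite /el (big_ord_mul m r (fun i => (f (b * (m * r) + i)%N)%:R * z ^+ i)) exchange_big /=.
apply: eq_bigr => u _; rewrite mulr_sumr; apply: eq_bigr => j _.
by rewrite -exprM mulrCA -exprD addnA; congr (_ * z ^+ _); lia.
Qed.

(** Elements u and u + r both contribute to [z ^+ u], the latter with the factor [z ^+ r]. On its
    coefficients that factor is a negacyclic shift by one place, whose wrapped coefficient, at j =
    0, gets the minus sign. *)
Lemma el_fold z m r (f f' : nat -> nat) b : (0 < m)%N -> (0 < r)%N ->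
  z ^+ (m * r) = -1 ->
  (forall j, (j < m * r)%N -> f' (b * (m * r) + j)%N = fold M m r f (b * (m * r) + j)) ->
  el z (m * r) f' b = \sum_(k < 2 * r) z ^+ k *
    el (z ^+ r) m f (b * (2 * r) + (2 * r - k) %% (2 * r))%N.
Proof.
move=> m0 r0 zm f'E.
rewrite el_parts (big_ord_mul 2 r (fun k => z ^+ k *
    el (z ^+ r) m f (b * (2 * r) + (2 * r - k) %% (2 * r))%N)).
rewrite !big_ord_recl big_ord0 addr0 /= -big_split /=; apply: eq_bigr => u _.
rewrite mul0n add0n mul1n (addnC r) exprD -mulrA -mulrDr; congr (_ * _).
have ur := ltn_ord u.
set y := z ^+ r; have ym : y ^+ m = -1 by rewrite -exprM mulnC.
pose v k j : S := (f ((b * (2 * r) + (2 * r - k) %% (2 * r)) * m + j)%N)%:R.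
have := rotate (v (u + r)%N) (c := 1) ym m0; rewrite expr1 => <-; last by lia.
rewrite /el -big_split /=; apply: eq_bigr => j _; rewrite -mulrDl; congr (_ * _).
have jm := ltn_ord j.
have jur : (j * r + u < m * r)%N.
  by have : (j.+1 * r <= m * r)%N; [rewrite leq_mul2r jm orbT|rewrite mulSn; lia].
have E1 : ((b * (m * r) + (j * r + u)) %% (m * r) = j * r + u)%N by rewrite modnMDl modn_small.
have E2 : ((b * (m * r) + (j * r + u)) %/ (m * r) = b)%N.
  by rewrite divnMDl ?divn_small ?addn0 // muln_gt0 m0.
have E3 : ((j * r + u) %% r = u)%N by rewrite modnMDl modn_small.
have E4 : ((j * r + u) %/ r = j)%N by rewrite divnMDl // divn_small // addn0.
rewrite -addnA f'E // /fold E1 E2 E3 E4 modR natrD ifR; congr (_ + _).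
case: (posnP j) => [->|j0].
  rewrite add0n; have -> : ((0 + 2 * m - 1) %% (2 * m) = 2 * m - 1)%N by rewrite modn_small; lia.
  rewrite ifF; last by lia.
  have -> : ((2 * m - 1) %% m = m - 1)%N.
    have -> : (2 * m - 1 = m - 1 + m)%N by lia.
    by rewrite modnDr modn_small //; lia.
  by rewrite /v [in LHS](@modn_small (m - 1)) //; lia.
have -> : ((j + 2 * m - 1) %% (2 * m) = j - 1)%N.
  have -> : (j + 2 * m - 1 = j - 1 + 2 * m)%N by lia.
  by rewrite modnDr modn_small; lia.
rewrite ifT; last by lia.
have -> : (j + m - 1 = j - 1 + m)%N by lia.
by rewrite modnDr.
Qed.

(* State of the Fourier transform after s layers, with m = 2 ^ a coefficients
   per element and 2r = 2 ^ c.+1 elements per block. *)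
Definition fft_state y mu a c (G : nat -> S) nb s (f : nat -> nat) : Prop :=
  forall b t i, (b < nb)%N -> (t < 2 ^ s)%N -> (i < 2 ^ (c.+1 - s))%N ->
  el y (2 ^ a) f (b * 2 ^ c.+1 + (t * 2 ^ (c.+1 - s) + i))%N =
  mu ^+ s * \sum_(u < 2 ^ s) (y ^+ (2 ^ (a.+1 - s))) ^+ (t * u)%N *
    G (b * 2 ^ c.+1 + (u * 2 ^ (c.+1 - s) + i))%N.

Lemma fft_start y mu a c nb f : fft_state y mu a c (el y (2 ^ a) f) nb 0 f.
Proof.
move=> b t i bn; rewrite expn0 ltnS leqn0 => /eqP-> ic.
by rewrite big_ord_recl big_ord0 addr0 !expr0 !mul1r.
Qed.

Lemma fft_layer y mu a c G nb s f f' :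
  (s <= c)%N -> (c <= a)%N -> y ^+ (2 ^ a) = -1 ->
  fft_state y mu%:R a c G nb s f ->
  (forall j, (j < nb * 2 ^ c.+1 * 2 ^ a)%N -> f' j = layer M mu (2 ^ a) (2 ^ c) (2 ^ s) f j) ->
  fft_state y mu%:R a c G nb s.+1 f'.
Proof.
move=> sc ca ya Hf Hf' b t i bn ts ic.
rewrite subSS in ic *.
have sp0 : (0 < 2 ^ s)%N by rewrite expn_gt0.
have h0 : (0 < 2 ^ (c - s))%N by rewrite expn_gt0.
have c0 : (0 < 2 ^ (a - s))%N by rewrite expn_gt0.
have Ea : (2 ^ a = 2 ^ s * 2 ^ (a - s))%N by rewrite -expnD subnKC //; lia.
have Ec : (2 ^ c = 2 ^ s * 2 ^ (c - s))%N by rewrite -expnD subnKC.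
have Ec1 : (2 ^ c.+1 = 2 * (2 ^ s * 2 ^ (c - s)))%N by rewrite expnS Ec.
have Eh : (2 ^ (c.+1 - s) = 2 * 2 ^ (c - s))%N by rewrite subSn // expnS.
have EW : (2 ^ (a.+1 - s) = 2 * 2 ^ (a - s))%N by rewrite subSn ?expnS //; lia.
have ts' : (t %% 2 ^ s < 2 ^ s)%N by rewrite ltn_pmod.
set sp := (2 ^ s)%N in sp0 Ea Ec Ec1 ts' Hf *.
set h := (2 ^ (c - s))%N in h0 Ec Ec1 Eh ic *.
set w := (2 ^ (a - s))%N in c0 Ea EW *.
have tsp : (t < 2 * sp)%N by rewrite -expnS.
have hq : (t * h + i < 2 * (sp * h))%N.
  by have : (t.+1 * h <= 2 * sp * h)%N; [rewrite leq_mul2r tsp orbT|rewrite mulSn -mulnA; lia].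
have lt : (b * 2 ^ c.+1 + (t * h + i) < nb * 2 ^ c.+1)%N.
  have : (b.+1 * 2 ^ c.+1 <= nb * 2 ^ c.+1)%N by rewrite leq_mul2r bn orbT.
  by rewrite mulSn [in X in (X + _ <= _)%N]Ec1; lia.
have := el_layer (y := y) (mu := mu) (h := h) (c := w) (sp := sp) (f := f) (f' := f') (b := b) (t := t) (i := i).
rewrite /= -!Ea -!Ec -!(expnS 2 c) => ->//; last first.
  move=> j jm; apply: Hf'.
  have : ((b * 2 ^ c.+1 + (t * h + i)).+1 * 2 ^ a <= nb * 2 ^ c.+1 * 2 ^ a)%N by rewrite leq_mul2r lt orbT.
  by rewrite mulSn; lia.
have H1 := Hf b (t %% sp)%N i bn ts'.
have H2 := Hf b (t %% sp)%N (i + h)%N bn ts'.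
rewrite Eh in H1 H2; rewrite H1; last by lia.
rewrite -!addnA H2; last by lia.
rewrite exprS -mulrA; congr (_ * _).
rewrite mulrCA -mulrDr; congr (_ * _).
have w1 : (y ^+ w) ^+ (2 * sp) = 1.
  have E : (w * (2 * sp) = 2 ^ a * 2)%N by rewrite Ea; lia.
  by rewrite -exprM E exprM ya sqrrN expr1n.
have -> : y ^+ (t * w) = (y ^+ w) ^+ t by rewrite mulnC exprM.
have -> : y ^+ (2 ^ (a.+1 - s)) = (y ^+ w) ^+ 2 by rewrite EW mulnC exprM.
have -> : (2 ^ s.+1 = 2 * sp)%N by rewrite expnS.
rewrite ?subSS -?/w -(fft_step h (fun j => G (b * 2 ^ c.+1 + (j + i))%N) t w1).
congr (_ + _ * _); apply: eq_bigr => u _; congr (_ * G _).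
by rewrite -!addnA (addnC i).
Qed.

Lemma fft_end y mu a c G nb f : (c <= a)%N -> fft_state y mu a c G nb c.+1 f ->
  forall b t, (b < nb)%N -> (t < 2 ^ c.+1)%N ->
  el y (2 ^ a) f (b * 2 ^ c.+1 + t)%N = mu ^+ c.+1 *
    \sum_(u < 2 ^ c.+1) (y ^+ (2 ^ (a - c))) ^+ (t * u)%N * G (b * 2 ^ c.+1 + u)%N.
Proof.
move=> ca H b t bn tc; have := H b t 0%N bn tc.
rewrite subnn expn0 muln1 addn0 => -> //; rewrite subSS; congr (_ * _).
by apply: eq_bigr => u _; rewrite muln1 addn0.
Qed.

Definition parts z a c (f : nat -> nat) b u : S :=
  \sum_(j < 2 ^ a) (f (b * (2 ^ a * 2 ^ c) + j * 2 ^ c + u)%N)%:R * (z ^+ (2 ^ c)) ^+ j.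

(** The root is a power of [y = z ^+ (2 ^ c)]. When [z ^+ (2 ^ (a + c)) = -1] and [c <= a], its
    [2 ^ c]-th power is -1, as a transform of length [2 ^ c.+1] requires. *)
Definition spectrum z a c (P : nat -> nat -> S) b t : S :=
  \sum_(u < 2 ^ c) ((z ^+ (2 ^ c)) ^+ (2 ^ (a - c))) ^+ (t * u)%N * P b u.

Lemma level_forward z a c nb f f0 f1 : (c <= a)%N ->
  (forall j, (j < nb * 2 ^ c.+1 * 2 ^ a)%N -> f0 j = expand M (2 ^ a) (2 ^ c) f j) ->
  fft_state (z ^+ (2 ^ c)) 1 a c (el (z ^+ (2 ^ c)) (2 ^ a) f0) nb c.+1 f1 ->
  forall b t, (b < nb)%N -> (t < 2 ^ c.+1)%N ->
  el (z ^+ (2 ^ c)) (2 ^ a) f1 (b * 2 ^ c.+1 + t)%N = spectrum z a c (parts z a c f) b t.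
Proof.
move=> ca f0E /(fft_end ca) H b t bn tc; rewrite H // expr1n mul1r.
have E u : (u < 2 ^ c.+1)%N -> el (z ^+ (2 ^ c)) (2 ^ a) f0 (b * 2 ^ c.+1 + u)%N =
    if (u < 2 ^ c)%N then parts z a c f b u else 0.
  move=> uc; have := @el_expand (z ^+ (2 ^ c)) (2 ^ a) (2 ^ c) f f0 b u.
  rewrite /= -!(expnS 2 c) => -> //; first by rewrite expn_gt0.
  move=> j ja; apply: f0E.
  have : ((b * 2 ^ c.+1 + u).+1 * 2 ^ a <= nb * 2 ^ c.+1 * 2 ^ a)%N.
    rewrite leq_mul2r; apply/orP; right.
    by have : (b.+1 * 2 ^ c.+1 <= nb * 2 ^ c.+1)%N; [rewrite leq_mul2r bn orbT|rewrite mulSn; lia].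
  by rewrite mulSn; lia.
under eq_bigr => u _ do rewrite E //.
rewrite (expnS 2 c) (big_ord_mul 2 (2 ^ c) (fun u => ((z ^+ (2 ^ c)) ^+ (2 ^ (a - c))) ^+ (t * u) *
   (if (u < 2 ^ c)%N then parts z a c f b u else 0))).
rewrite !big_ord_recl big_ord0 addr0 /= [X in _ + X]big1 ?addr0; last first.
  by move=> u _; rewrite ifF ?mulr0 // /bump /=; lia.
by apply: eq_bigr => u _; rewrite mul0n add0n ltn_ord.
Qed.

Lemma el_parts_sum z a c f b :
  el z (2 ^ (a + c)) f b = \sum_(u < 2 ^ c) z ^+ u * parts z a c f b u.
Proof. by rewrite expnD el_parts. Qed.

Lemma level_backward z hf a c nb (P Q : nat -> nat -> S) f0 f1 f :
  (c <= a)%N -> z ^+ (2 ^ (a + c)) = -1 -> 2%:R * hf = 1 ->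
  (forall b t, (b < nb)%N -> (t < 2 ^ c.+1)%N ->
    el (z ^+ (2 ^ c)) (2 ^ a) f0 (b * 2 ^ c.+1 + t)%N = spectrum z a c P b t * spectrum z a c Q b t) ->
  fft_state (z ^+ (2 ^ c)) hf a c (el (z ^+ (2 ^ c)) (2 ^ a) f0) nb c.+1 f1 ->
  (forall j, (j < nb * (2 ^ a * 2 ^ c))%N -> f j = fold M (2 ^ a) (2 ^ c) f1 j) ->
  forall b, (b < nb)%N ->
  el z (2 ^ (a + c)) f b =
    (\sum_(u < 2 ^ c) z ^+ u * P b u) * (\sum_(u < 2 ^ c) z ^+ u * Q b u).
Proof.
move=> ca zN hf2 f0E /(fft_end ca) H fE b bn.
set w := (z ^+ (2 ^ c)) ^+ (2 ^ (a - c)).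
have wc : w ^+ (2 ^ c) = -1 by rewrite /w -!exprM -!expnD subnK // addnC.
rewrite -(conv_dft z (P b) (Q b) wc hf2) expnD (@el_fold _ _ _ f1) ?expn_gt0 //; first last.
- move=> j jac; apply: fE.
  have : (b.+1 * (2 ^ a * 2 ^ c) <= nb * (2 ^ a * 2 ^ c))%N by rewrite leq_mul2r bn orbT.
  by rewrite mulSn; lia.
- by rewrite -expnD.
rewrite -(expnS 2 c); apply: eq_bigr => k _; congr (_ * _).
rewrite H // ?ltn_pmod ?expn_gt0 //; congr (_ * _).
by apply: eq_bigr => t _; rewrite f0E.
Qed.

Lemma el_pmul z (f g h : nat -> nat) b : z ^+ 2 = -1 ->
  (forall j, (j < 2)%N -> h (b * 2 + j)%N = pmul M f g (b * 2 + j)) ->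
  el z 2 h b = el z 2 f b * el z 2 g b.
Proof.
move=> z2 hE.
have pE j : (j < 2)%N -> (h (b * 2 + j)%N)%:R = (f (b * 2)%N)%:R * (g (b * 2 + j)%N)%:R +
    (if (0 < j)%N then (f (b * 2 + 1)%N * g (b * 2 + (1 - j)))%N%:R
     else - (f (b * 2 + 1)%N * g (b * 2 + (1 - j)))%N%:R) :> S.
  move=> j2; rewrite hE // /pmul modnMDl divnMDl // (divn_small j2) (modn_small j2) addn0.
  by rewrite modR natrD ifR natrM.
rewrite /el !big_ord_recl !big_ord0 /= /bump /= !pE // !addn0 !addr0 !expr1 expr0 !mulr1 /=.
rewrite !natrM; set f0 := (f (b * 2)%N)%:R; set g0 := (g (b * 2)%N)%:R.
set f1 := (f _)%:R; set g1 := (g _)%:R.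
have -> : (f0 + f1 * z) * (g0 + g1 * z) = f0 * g0 + f1 * g1 * z ^+ 2 + (f0 * g1 + f1 * g0) * z.
  by ring.
by rewrite z2; ring.
Qed.

End Char.
End Ring.

(** The ring is Z/M[z] modulo [z ^ (2 ^ k) + 1]. It lives in the proof only; the program sees arrays
    of numbers. Factors with at most n nonzero leading cells and [2 * n <= 2 ^ k] have a product of
    degree below [2 ^ k], so the quotient map loses nothing and the entries are those of the plain
    product. *)
Lemma negacyclic_ring k M : 1 < M -> exists (S : comNzRingType) (z : S),
  [/\ (M%:R = 0 :> S)%R, (z ^+ (2 ^ k) = -1)%R &
   forall n (X Y C : nat -> nat), 2 * n <= 2 ^ k -> 0 < n ->
  (forall i, n <= i < 2 ^ k -> X i = 0) ->
  (forall i, n <= i < 2 ^ k -> Y i = 0) ->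
  (el z (2 ^ k) C 0 = el z (2 ^ k) X 0 * el z (2 ^ k) Y 0)%R ->
  (forall j, j < 2 ^ k -> C j < M) ->
  forall j, j < 2 ^ k -> C j = (\sum_(i < j.+1) X i * Y (j - i)) %% M].
Proof.
move=> M1.
have N1 : (0 < 2 ^ k)%N by rewrite expn_gt0.
set N := (2 ^ k)%N in N1 *.
Local Open Scope ring_scope.
pose R := 'Z_M.
have RM : M%:R = 0 :> R by apply: char_Zp.
pose h : {poly R} := 'X^N + 1.
have sh : size h = N.+1.
  by rewrite /h size_polyDl ?size_polyXn // size_poly1 ltnS; lia.
have mh : h \is monic.
  by rewrite monicE /h lead_coefDl ?size_polyXn ?size_poly1 ?lead_coefXn.
have mk : mk_monic h = h by rewrite /mk_monic sh mh ltnS N1.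
pose z : {poly %/ h} := in_qpoly h 'X.
have pE (F : nat -> nat) : el z N F 0 = in_qpoly h (\poly_(i < N) (F i)%:R).
  rewrite poly_def raddf_sum /=; apply: eq_bigr => i _.
  by rewrite mul0n add0n in_qpolyZ rmorphXn /= -/z scaler_nat mulr_natl.
have zN : z ^+ N = -1.
  have h0 : in_qpoly h h = 0 by apply: val_inj; rewrite /= mk Pdiv.RingMonic.rmodpp.
  by apply/eqP; rewrite -subr_eq0 opprK /z -rmorphXn -(in_qpoly1 h) -rmorphD /= h0.
have zM : M%:R = 0 :> {poly %/ h}.
  by apply: val_inj; rewrite /= qpolyC_natr -polyC_natr RM.
exists {poly %/ h}, z; split=> // n X Y C nk n0 X0 Y0.
rewrite !pE -rmorphM /= => /(congr1 val) /= H CM j jk; move: H.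
set PX := \poly_(i < N) (X i)%:R; set PY := \poly_(i < N) (Y i)%:R.
have tail (F : nat -> nat) : (forall i, (n <= i < N)%N -> F i = 0%N) ->
    (size (\poly_(i < N) (F i)%:R : {poly R}) <= n)%N.
  move=> F0; apply/leq_sizeP => i ni; rewrite coef_poly.
  by case: ltnP => // iN; rewrite F0 // ni.
have sXY : (size (PX * PY)%R <= N)%N.
  apply: leq_trans (size_polyMleq _ _) _.
  apply: leq_trans (leq_pred _) (leq_trans (leq_add (tail _ X0) (tail _ Y0)) _).
  by rewrite addnn -mul2n.
rewrite !Pdiv.Ring.rmodp_small ?mk ?sh ?ltnS ?size_poly //.
move=> /(congr1 (fun p : {poly R} => p`_j)); rewrite coef_poly jk coefM => E.
have : ((C j)%:R : R) = (\sum_(i < j.+1) X i * Y (j - i))%N%:R.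
  rewrite E natr_sum; apply: eq_bigr => i _; have ij := ltn_ord i.
  by rewrite !coef_poly !ifT ?natrM //; lia.
move=> /(congr1 (fun x : R => x : nat)); rewrite !val_Zp_nat //.
by rewrite (modn_small (CM _ jk)).
Qed.

Local Close Scope ring_scope.

(* Sizes along the recursion: k bits of coefficient index become uphalf k, and each
   block of 2 ^ k coefficients is replaced by 2 ^ (k./2 + 1) blocks. *)
Definition level_bits (k0 l : nat) : nat := iter l uphalf k0.
Definition level_blocks (k0 l : nat) : nat := 2 ^ (k0 + l - level_bits k0 l).

(** * The recursion through all levels of the transform *)

Section Levels.
Variable k0 : nat.
Notation kk := (level_bits k0).
Notation nb := (level_blocks k0).

Lemma level_bitsS l : kk l.+1 = uphalf (kk l). Proof. by []. Qed.

Lemma level_bitsE l : kk l = uphalf (kk l) + (kk l)./2.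
Proof. by rewrite uphalf_half; have := odd_double_half (kk l); lia. Qed.

Lemma level_bits_le l : kk l <= k0.
Proof. by elim: l => // l IH; rewrite level_bitsS; have := level_bitsE l; lia. Qed.

Lemma level_size l : nb l * 2 ^ kk l = 2 ^ (k0 + l).
Proof. by rewrite -expnD subnK // (leq_trans (level_bits_le l)) // leq_addr. Qed.

Lemma level_blocksS l : nb l.+1 = nb l * 2 ^ (kk l)./2.+1.
Proof.
rewrite -expnD; congr (2 ^ _); rewrite level_bitsS.
by have := level_bits_le l; have := level_bitsE l; lia.
Qed.

(** As [uphalf] fixes 1, the depth may be any d with [k0 <= 2 ^ d], and blocks never shrink below
    two coefficients. *)
Lemma level_bits_end d : 0 < k0 -> k0 <= 2 ^ d -> kk d = 1.
Proof.
move=> k1 kd; apply/eqP; rewrite eqn_leq; apply/andP; split.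
  suff H l : l <= d -> kk l <= 2 ^ (d - l) by have := H _ (leqnn d); rewrite subnn.
  elim: l => [|l IH] ld; first by rewrite subn0.
  have E : d - l = (d - l.+1).+1 by lia.
  have := IH (ltnW ld); rewrite level_bitsS E expnS uphalf_half.
  by have := odd_double_half (kk l); lia.
elim: d {kd} => // d IH; rewrite level_bitsS uphalf_half.
by have := odd_double_half (kk d); lia.
Qed.

Section Chain.
Variables (S : comNzRingType) (M : nat) (z : S).
Hypotheses (M_gt0 : 0 < M) (M0 : (M%:R = 0 :> S)%R) (zN : (z ^+ (2 ^ k0) = -1)%R).

Definition lroot l : S := (z ^+ (2 ^ (k0 - kk l)))%R.

Lemma root_N l : (lroot l ^+ (2 ^ kk l) = -1)%R.
Proof. by rewrite -exprM -expnD subnK ?level_bits_le. Qed.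

Lemma rootS l : lroot l.+1 = (lroot l ^+ (2 ^ (kk l)./2))%R.
Proof.
rewrite -exprM -expnD; congr (_ ^+ (2 ^ _))%R; rewrite level_bitsS.
by have := level_bits_le l; have := level_bitsE l; lia.
Qed.

(* E j lists the ring elements stored in the blocks at level j, P j their
   coefficients before the Fourier transform; g is the array at level l. *)
Definition chain (E : nat -> nat -> S) (P : nat -> nat -> nat -> S) (l : nat)
    (f g : nat -> nat) : Prop :=
  [/\ E 0 0 = el z (2 ^ k0) f 0,
   forall b, b < nb l -> el (lroot l) (2 ^ kk l) g b = E l b,
   forall j b, j < l -> b < nb j -> E j b = (\sum_(u < 2 ^ (kk j)./2) lroot j ^+ u * P j b u)%R &
   forall j b t, j < l -> b < nb j -> t < 2 ^ (kk j)./2.+1 ->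
     E j.+1 (b * 2 ^ (kk j)./2.+1 + t) = spectrum (lroot j) (uphalf (kk j)) (kk j)./2 (P j) b t].

Lemma chain0 f : chain (fun _ b => el z (2 ^ k0) f b) (fun _ _ _ => 0%R) 0 f f.
Proof. by split=> // b _; rewrite /lroot subnn expr1. Qed.

Lemma el_ext (y : S) m g g' b : g =1 g' -> el y m g b = el y m g' b.
Proof. by move=> gg; apply: eq_bigr => i _; rewrite gg. Qed.

Lemma chain_ext E P l f g g' : g =1 g' -> chain E P l f g -> chain E P l f g'.
Proof.
by move=> gg [E0 El EP ES]; split=> // b bn; rewrite -El //; apply: el_ext => i; rewrite gg.
Qed.

Lemma half_le_uphalf k : k./2 <= uphalf k.
Proof. by rewrite uphalf_half leq_addl. Qed.

Lemma chainS E P l f g g0 g1 : chain E P l f g ->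
  (forall j, j < 2 ^ (k0 + l.+1) -> g0 j = expand M (2 ^ uphalf (kk l)) (2 ^ (kk l)./2) g j) ->
  fft_state (lroot l.+1) 1%R (uphalf (kk l)) (kk l)./2 (el (lroot l.+1) (2 ^ uphalf (kk l)) g0)
    (nb l) (kk l)./2.+1 g1 ->
  exists E' P', chain E' P' l.+1 f g1.
Proof.
move=> [E0 El EP ES] gE; rewrite rootS => F0.
have sz : nb l * 2 ^ (kk l)./2.+1 * 2 ^ uphalf (kk l) = 2 ^ (k0 + l.+1).
  by rewrite -level_blocksS -level_size.
have F : forall b t, b < nb l -> t < 2 ^ (kk l)./2.+1 ->
    el (lroot l ^+ (2 ^ (kk l)./2))%R (2 ^ uphalf (kk l)) g1 (b * 2 ^ (kk l)./2.+1 + t) =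
    spectrum (lroot l) (uphalf (kk l)) (kk l)./2 (parts (lroot l) (uphalf (kk l)) (kk l)./2 g) b t.
  by move=> b t; apply: (level_forward M_gt0 M0 (half_le_uphalf _) _ F0) => i; rewrite sz; apply: gE.
pose E' j b := if j <= l then E j b else el (lroot l.+1) (2 ^ kk l.+1) g1 b.
pose P' j := if j < l then P j else parts (lroot l) (uphalf (kk l)) (kk l)./2 g.
exists E', P'; split=> //.
- by move=> b _; rewrite /E' ltnn.
- move=> j b; rewrite ltnS /E' /P' => jl; rewrite jl => bn.
  case: ltnP => lj; first exact: EP.
  have jl' : j = l by lia.
  by rewrite {}jl' in bn *; rewrite -El // -(el_parts_sum M_gt0) -level_bitsE.
- move=> j b t; rewrite ltnS /E' /P' => jl bn tc.
  case: ltnP => lj; first exact: ES.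
  have jl' : j = l by lia.
  by rewrite {}jl' in bn tc *; rewrite rootS; apply: F.
Qed.

Lemma chain_backward EA PA EB PB D f g f' g' l h h0 h1 (hf : S) :
  chain EA PA D f f' -> chain EB PB D g g' -> l < D -> (2%:R * hf = 1)%R ->
  (forall b, b < nb l.+1 -> el (lroot l.+1) (2 ^ kk l.+1) h b = (EA l.+1 b * EB l.+1 b)%R) ->
  fft_state (lroot l.+1) hf (uphalf (kk l)) (kk l)./2 (el (lroot l.+1) (2 ^ uphalf (kk l)) h)
    (nb l) (kk l)./2.+1 h0 ->
  (forall j, j < 2 ^ (k0 + l) -> h1 j = fold M (2 ^ uphalf (kk l)) (2 ^ (kk l)./2) h0 j) ->
  forall b, b < nb l -> el (lroot l) (2 ^ kk l) h1 b = (EA l b * EB l b)%R.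
Proof.
move=> [_ _ EPA ESA] [_ _ EPB ESB] lD hf2 hE; rewrite rootS => F h1E b bn.
rewrite EPA // EPB //; have -> : 2 ^ kk l = 2 ^ (uphalf (kk l) + (kk l)./2) by rewrite -level_bitsE.
apply: (level_backward M_gt0 M0 (half_le_uphalf _) _ hf2 _ F _ bn).
- by rewrite -level_bitsE root_N.
- move=> b' t bn' tc; rewrite -ESA // -ESB // -rootS -hE //.
  rewrite level_blocksS.
  have : (b'.+1 * 2 ^ (kk l)./2.+1 <= nb l * 2 ^ (kk l)./2.+1)%N by rewrite leq_mul2r bn' orbT.
  by rewrite mulSn; lia.
- by move=> j; rewrite -expnD -level_bitsE level_size; apply: h1E.
Qed.

End Chain.
End Levels.

(** * Hashing and greedy covers *)

(** By Legendre's formula the exponent is the sum over k of the differences of 2n / p^k and twice n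
    / p^k, rounded down. Each is at most 1, and it vanishes when p^k > 2n. *)
Lemma logn_central_bin p n : prime p -> 0 < n -> p ^ logn p 'C(2 * n, n) <= 2 * n.
Proof.
move=> pp n0; have p1 := prime_gt1 pp.
have b0 : 0 < 'C(2 * n, n) by rewrite bin_gt0; lia.
have E : logn p (2 * n)`! = logn p 'C(2 * n, n) + 2 * logn p n`!.
  rewrite -(@bin_fact (2 * n) n); last by lia.
  have -> : 2 * n - n = n by lia.
  by rewrite !lognM ?muln_gt0 ?fact_gt0 //; lia.
have F : logn p n`! = \sum_(1 <= k < (2 * n).+1) n %/ p ^ k.
  rewrite logn_fact // [RHS](big_cat_nat (n := n.+1)) //=; last by lia.
  rewrite [X in _ = _ + X]big_nat_cond [X in _ = _ + X]big1 ?addn0 // => k /andP[/andP[nk _] _].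
  apply: divn_small; apply: leq_trans (ltn_expl k p1); lia.
have D k : (2 * n) %/ p ^ k <= 2 * (n %/ p ^ k) + (p ^ k <= 2 * n).
  have pk : 0 < p ^ k by rewrite expn_gt0; lia.
  have [h|h] := leqP (p ^ k) (2 * n); last by rewrite divn_small.
  have := divn_eq n (p ^ k); have := ltn_pmod n pk; move: (n %/ _) (n %% _) => a b bk ->.
  have -> : 2 * (a * p ^ k + b) = 2 * a * p ^ k + 2 * b by lia.
  rewrite divnMDl // leq_add2l.
  by rewrite -ltnS ltn_divLR //; lia.
have L : logn p 'C(2 * n, n) <= \sum_(1 <= k < (2 * n).+1) (p ^ k <= 2 * n).
  rewrite -(leq_add2r (2 * logn p n`!)) -E F logn_fact // big_distrr /= addnC -big_split /=.
  by apply: leq_sum => k _.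
have T : \sum_(1 <= k < (2 * n).+1) (p ^ k <= 2 * n) <= trunc_log p (2 * n).
  have tl : trunc_log p (2 * n) < (2 * n).+1.
    by rewrite ltnS ltnW // (leq_trans (ltn_expl _ p1)) // trunc_logP //; lia.
  rewrite (big_cat_nat (n := (trunc_log p (2 * n)).+1)) //=.
  rewrite [X in _ + X]big_nat_cond [X in _ + X]big1 ?addn0; last first.
    move=> k /andP[/andP[tk _] _]; apply/eqP; rewrite eqb0 -ltnNge.
    exact: leq_trans (trunc_log_ltn _ p1) (leq_pexp2l (ltnW p1) tk).
  apply: leq_trans (_ : \sum_(1 <= k < (trunc_log p (2 * n)).+1) 1 <= _).
    by apply: leq_sum => k _; apply: leq_b1.
  by rewrite sum_nat_const_nat muln1 subn1.
apply: leq_trans (trunc_logP p1 (_ : 0 < 2 * n)); last by lia.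
by rewrite leq_pexp2l ?prime_gt0 // (leq_trans L T).
Qed.

Lemma central_bin_ge n : 2 ^ n <= 'C(2 * n, n).
Proof.
elim: n => [|n IH]; first by rewrite bin0.
have -> : 2 * n.+1 = (2 * n).+2 by lia.
rewrite expnS binS; have -> : 'C((2 * n).+1, n.+1) = 'C((2 * n).+1, n).
  by rewrite -bin_sub; [congr 'C(_, _); lia|lia].
rewrite addnn -mul2n leq_mul2l /=; apply: leq_trans IH (leq_bin2l _ _); lia.
Qed.

Lemma two_square_lt_exp x : 7 <= x -> 2 * x ^ 2 < 2 ^ x.
Proof.
elim: x => // x IH; rewrite leq_eqVlt => /orP[/eqP <- //|x7].
by have := IH x7; rewrite (expnS 2 x) !expnS !expn0; nia.
Qed.

(* Chebyshev: a central binomial coefficient has no large prime power factor. *)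
Lemma prime_between x : 7 <= x -> exists2 q, prime q & x < q <= 2 * x ^ 2.
Proof.
(* If no prime divisor exceeded x, the binomial would be a product of at most x prime powers, each
   at most 2n. With n = x^2 this gives (2^x)^x <= (2 x^2)^x, which is false from x = 7 on. *)
move=> x7; pose n := x ^ 2.
have n0 : 0 < n by rewrite expn_gt0; lia.
have b0 : 0 < 'C(2 * n, n) by rewrite bin_gt0; lia.
have small q : q \in primes 'C(2 * n, n) -> prime q /\ q <= 2 * n.
  move=> qC; have := qC; rewrite mem_primes => /and3P[pq _ _]; split=> //.
  apply: leq_trans (logn_central_bin pq n0); rewrite -{1}(expn1 q) leq_pexp2l ?(prime_gt0 pq) //.
  by rewrite logn_gt0.
case: (boolP (has (fun q => x < q) (primes 'C(2 * n, n)))) => [/hasP[q /small[pq q2] xq]|/hasPn H].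
  by exists q; rewrite // xq.
have sz : size (primes 'C(2 * n, n)) <= x.
  rewrite -(size_iota 1 x); apply: uniq_leq_size (primes_uniq _) _ => q qC.
  by have := H _ qC; have [/prime_gt1] := small _ qC; rewrite mem_iota; lia.
have up : 'C(2 * n, n) <= (2 * n) ^ x.
  rewrite (prod_prime_decomp b0) prime_decompE big_map /=.
  apply: leq_trans (_ : \prod_(p <- primes 'C(2 * n, n)) (2 * n) <= _).
    rewrite big_seq [X in _ <= X]big_seq; apply: leq_prod => q qC.
    by apply: logn_central_bin => //; case: (small _ qC).
  by rewrite big_const_seq count_predT iter_muln_1 leq_pexp2l //; lia.
have := leq_trans (central_bin_ge n) up.
rewrite /n {1}[x ^ 2]expnS expn1 expnM leq_exp2r; last by lia.
by have := two_square_lt_exp x7; lia.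
Qed.

(* The base-q digits of x, read as a polynomial over F_q and evaluated at al. *)
Definition hash (q al x : nat) : nat := (\sum_(i < x) (x %/ q ^ i) %% q * al ^ i) %% q.

Lemma hashE q al x d : 1 < q -> x < q ^ d ->
  hash q al x = (\sum_(i < d) (x %/ q ^ i) %% q * al ^ i) %% q.
Proof.
move=> q1 xd; rewrite /hash; congr (_ %% _).
have aux (a b : nat) : a <= b -> x < q ^ a ->
   \sum_(i < b) (x %/ q ^ i) %% q * al ^ i = \sum_(i < a) (x %/ q ^ i) %% q * al ^ i.
  move=> ab xa; rewrite -!(big_mkord xpredT (fun i => (x %/ q ^ i) %% q * al ^ i)).
  rewrite (big_cat_nat (n := a)) //= [X in _ + X]big_nat_cond [X in _ + X]big1 ?addn0 //.
  move=> i /andP[/andP[ai _] _].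
  by rewrite divn_small ?mod0n // (leq_trans xa) // leq_pexp2l //; lia.
have xx : x < q ^ x := ltn_expl x q1.
by case: (leqP x d) => h; [rewrite (aux x d)|rewrite (aux d x) // ltnW].
Qed.

Lemma hash0 q al : hash q al 0 = 0.
Proof. by rewrite /hash big_ord0 mod0n. Qed.

(** Horner's rule. As [x %/ q < x], all hash values of one [al] are tabulated in a single pass. *)
Lemma hashS q al x : 1 < q -> 0 < x ->
  hash q al x = (x %% q + al * hash q al (x %/ q)) %% q.
Proof.
move=> q1 x0; have xx : x < q ^ x.-1.+1 by rewrite prednK // ltn_expl.
have xq : x %/ q < q ^ x.-1 by rewrite ltn_divLR ?(ltnW q1) // -expnSr.
rewrite (hashE _ q1 xx) (hashE _ q1 xq) big_ord_recl /= !expn0 divn1 muln1.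
rewrite -modnDmr -[in RHS]modnDmr modnMmr; congr ((_ + _ %% _) %% _).
rewrite big_distrr /=; apply: eq_bigr => i _; rewrite /bump /= add1n.
by rewrite -divnMA -expnS (expnS al) mulnCA.
Qed.

Lemma hash_lt q al x : 0 < q -> hash q al x < q.
Proof. by move=> q0; rewrite ltn_pmod. Qed.

(* Distinct x and y give distinct digit polynomials, which agree at fewer than
   d points. *)
Lemma hash_collisions q d x y : prime q -> x < q ^ d -> y < q ^ d -> x <> y ->
  #|[set al : 'I_q | hash q al x == hash q al y]| <= d.
Proof.
move=> pq xd yd xy; have q1 := prime_gt1 pq.
pose dg (x i : nat) := (x %/ q ^ i) %% q.
pose P : {poly 'F_q} := (\poly_(i < d) ((dg x i)%:R - (dg y i)%:R))%R.
have Feq a b : a < q -> b < q -> (a%:R = b%:R :> 'F_q)%R -> a = b.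
  move=> aq bq /(congr1 (fun z : 'F_q => z : nat)).
  by rewrite !val_Fp_nat // !modn_small.
have P0 : P != 0%R.
  apply/eqP => P0; apply: xy.
  have dgE i : i < d -> dg x i = dg y i.
    move=> id; apply: Feq; rewrite ?ltn_pmod ?(ltnW q1) //.
    have := congr1 (fun p : {poly 'F_q} => (p`_i)%R) P0.
    by rewrite coef_poly id coef0 => /eqP; rewrite subr_eq0 => /eqP.
  have rec k z : z %% q ^ k.+1 = z %% q ^ k + dg z k * q ^ k.
    rewrite /dg expnSr {1}(divn_eq z (q ^ k)) {1}(divn_eq (z %/ q ^ k) q).
    have -> : (z %/ q ^ k %/ q * q + (z %/ q ^ k) %% q) * q ^ k + z %% q ^ k =
      z %/ q ^ k %/ q * (q ^ k * q) + (z %% q ^ k + (z %/ q ^ k) %% q * q ^ k) by lia.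
    rewrite modnMDl modn_small //.
    have h1 : z %% q ^ k < q ^ k by rewrite ltn_pmod // expn_gt0 (ltnW q1).
    have h2 : (z %/ q ^ k) %% q < q by rewrite ltn_pmod // ltnW.
    by have : ((z %/ q ^ k) %% q).+1 * q ^ k <= q * q ^ k; [rewrite leq_mul2r h2 orbT|rewrite mulSn mulnC; lia].
  have E k : k <= d -> x %% q ^ k = y %% q ^ k.
    elim: k => [|k IH] kd; first by rewrite !modn1.
    by rewrite !rec IH ?dgE //; lia.
  by have := E d (leqnn _); rewrite !modn_small.
pose rs := [seq ((nat_of_ord al)%:R : 'F_q)%R | al in [set al : 'I_q | hash q al x == hash q al y]].
have -> : #|[set al : 'I_q | hash q al x == hash q al y]| = size rs by rewrite size_map -cardE.
have : size rs < size P.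
  apply: max_poly_roots => //; last first.
    rewrite map_inj_uniq ?enum_uniq // => a b /Feq E.
    by apply: val_inj; apply: E.
  apply/allP => z /mapP[al]; rewrite mem_enum inE => /eqP E ->.
  rewrite rootE /P poly_def horner_sum; apply/eqP.
  under eq_bigr => i _ do rewrite hornerZ hornerXn mulrBl.
  rewrite sumrB; apply/eqP; rewrite subr_eq0; apply/eqP.
  have hE z' : z' < q ^ d -> ((hash q al z')%:R)%R =
      (\sum_(i < d) (dg z' i)%:R * (nat_of_ord al)%:R ^+ i)%R :> 'F_q.
    move=> zd; rewrite (hashE _ q1 zd); apply/eqP.
    have -> : forall k, ((k %% q)%:R = k%:R :> 'F_q)%R.
      by move=> k; rewrite [in RHS](divn_eq k q) natrD natrM pchar_Fp_0 // mulr0 add0r.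
    by rewrite natr_sum; apply/eqP; apply: eq_bigr => i _; rewrite natrM natrX.
  by rewrite -!hE // E.
by have : size P <= d := size_poly _ _; lia.
Qed.

(** Once the higher digits [x %/ q] are fixed, the last digit shifts the hash bijectively, so a
    class has at most one element for each quotient. *)
Lemma hash_class_card q al u m : 0 < q ->
  \sum_(x < m) (hash q al x == u) <= m %/ q + 1.
Proof.
move=> q0; have [q1|q1] := leqP q 1.
  have -> : q = 1 by lia.
  rewrite divn1; apply: leq_trans (_ : \sum_(x < m) 1 <= _).
    by apply: leq_sum => x _; apply: leq_b1.
  by rewrite sum_nat_const muln1 card_ord addn1.
have lt (x : 'I_m) : x %/ q < m %/ q + 1.
  by rewrite addn1 ltnS leq_div2r // ltnW.
rewrite -big_mkcond /= sum1dep_card.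
pose f (x : 'I_m) := Ordinal (lt x).
set A := [set x : 'I_m | _].
have inj : {in A &, injective f}.
  move=> x y; rewrite !inE => hx hy /(congr1 val) /= E.
  have hS z : hash q al z = (z %% q + al * hash q al (z %/ q)) %% q.
    case: (posnP z) => [->|z0]; last exact: hashS.
    by rewrite div0n hash0 muln0 addn0 !mod0n.
  have : x %% q == y %% q %[mod q].
    rewrite -(eqn_modDr (al * hash q al (x %/ q))) {2}E -!hS.
    by rewrite (eqP hx) (eqP hy).
  rewrite !modn_mod => /eqP E2; apply: val_inj => /=.
  by rewrite (divn_eq x q) (divn_eq y q) E E2.
rewrite -(card_in_image inj); apply: leq_trans (max_card _) _.
by rewrite card_ord.
Qed.

(** * Averaging over the hash classes *)

Section Greedy.
Variables (q d n : nat) (rank : nat -> nat).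
Hypotheses (pq : prime q) (rank_lt : forall k, k < n -> rank k < q ^ d)
  (rank_inj : {in [pred k | k < n] &, injective rank}).

Definition isolated (al : nat) (W : {set 'I_n}) (x : 'I_n) : bool :=
  [forall x' in W, (hash q al (rank x') == hash q al (rank x)) ==> (x' == x)].

(** A union bound: each other element of W spoils at most d values of [al], hence at most half of
    them are spoilt. *)
Lemma isolated_many (W : {set 'I_n}) (x : 'I_n) : 2 * (#|W| * d) <= q ->
  q <= 2 * #|[set al : 'I_q | isolated al W x]|.
Proof.
move=> Wq.
pose B (x' : 'I_n) := [set al : 'I_q | hash q al (rank x') == hash q al (rank x)].
have sub : ~: [set al : 'I_q | isolated al W x] \subset \bigcup_(x' in W :\ x) B x'.
  apply/subsetP => al; rewrite !inE negb_forall => /existsP[x'].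
  rewrite !negb_imply => /and3P[xW h xx].
  by apply/bigcupP; exists x'; rewrite !inE ?xx.
have := subset_leq_card sub; rewrite cardsCs setCK card_ord.
suff : #|\bigcup_(x' in W :\ x) B x'| <= #|W| * d by lia.
apply: leq_trans (_ : \sum_(x' in W :\ x) #|B x'| <= _).
  elim/big_rec2: _ => [|i s C _ IH]; first by rewrite cards0.
  by apply: leq_trans (leq_card_setU _ _) _; rewrite leq_add2l.
apply: leq_trans (_ : \sum_(x' in W :\ x) d <= _).
  apply: leq_sum => x'; rewrite !inE => /andP[xx _].
  apply: hash_collisions => //; [exact: rank_lt|exact: rank_lt|].
  by move/(rank_inj (ltn_ord x') (ltn_ord x))/val_inj/eqP; rewrite (negbTE xx).
by rewrite sum_nat_const leq_mul2r subset_leq_card ?orbT ?subD1set.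
Qed.

Definition hit (W : {set 'I_n}) (al u : nat) : bool :=
  [exists x in W, hash q al (rank x) == u].

(** For a fixed [al] the isolated elements of W lie in distinct classes, so they number at most the
    classes hit; now count the pairs of an element and an [al] isolating it. *)
Lemma hit_many (W : {set 'I_n}) : 2 * (#|W| * d) <= q ->
  q * #|W| <= 2 * \sum_(al < q) \sum_(u < q) hit W al u.
Proof.
move=> Wq; have q0 := prime_gt0 pq.
apply: leq_trans (_ : \sum_(x in W) 2 * #|[set al : 'I_q | isolated al W x]| <= _).
  by rewrite mulnC -sum_nat_const; apply: leq_sum => x _; apply: isolated_many.
rewrite -big_distrr leq_mul2l /=.
under eq_bigr => x _ do rewrite -sum1dep_card big_mkcond.
rewrite exchange_big /=; apply: leq_sum => al _.
rewrite -big_mkcondr /= sum1dep_card.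
have -> : \sum_(u < q) hit W al u = #|[set u : 'I_q | hit W al u]|.
  by rewrite -sum1dep_card [RHS]big_mkcond; apply: eq_bigr => u _; case: hit.
pose f (x : 'I_n) := Ordinal (hash_lt al (rank x) q0).
set A := [set x | _]; have inj : {in A &, injective f}.
  move=> x y; rewrite !inE => /andP[xW _] /andP[yW /forallP/(_ x)].
  by rewrite xW /= => /implyP H /(congr1 val) /= E; apply/eqP/H/eqP.
rewrite -(card_in_imset inj) subset_leq_card //; apply/subsetP => u /imsetP[x].
rewrite !inE => /andP[xW _] -> /=; apply/existsP; exists x; by rewrite xW /=.
Qed.

Lemma hit_subset (W W' : {set 'I_n}) al u : W \subset W' -> hit W al u -> hit W' al u.
Proof. by move=> /subsetP s /existsP[x /andP[/s xW h]]; apply/existsP; exists x; rewrite xW. Qed.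

(** Each active output is hit by at least q K / 2 of the q^2 classes, so the best class hits at
    least a fraction K / (2q) of them. *)
Lemma greedy_class (O : finType) (act : pred O) (W : O -> {set 'I_n}) K :
  (forall o, act o -> K <= #|W o|) -> 2 * (K * d) <= q ->
  exists al u : 'I_q, K * #|act| <= 2 * q * \sum_(o | act o) hit (W o) al u.
Proof.
move=> KW Kq; have q0 := prime_gt0 pq.
suff /existsP[al /existsP[u h]] : [exists al : 'I_q, exists u : 'I_q,
    K * #|act| <= 2 * q * \sum_(o | act o) hit (W o) al u] by exists al, u.
apply: contraT; rewrite negb_exists => /forallP H.
have {}H (al u : 'I_q) : 2 * q * \sum_(o | act o) hit (W o) al u < K * #|act|.
  by have := H al; rewrite negb_exists => /forallP/(_ u); rewrite -ltnNge.
have : q * (q * (K * #|act|)) <= \sum_(al < q) \sum_(u < q) 2 * q * \sum_(o | act o) hit (W o) al u.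
  under eq_bigr => al _ do rewrite -big_distrr.
  rewrite -big_distrr /=; under eq_bigr => al _ do rewrite exchange_big.
  rewrite exchange_big /= (mulnC 2) -[in X in _ <= X]mulnA leq_pmul2l // big_distrr /=.
  rewrite mulnA -sum1_card big_distrr /=; apply: leq_sum => o ao; rewrite muln1.
  (* A large W is replaced by K of its elements, for isolation is available only in sets that are
     small compared with q; a class that hits the subset hits W. *)
  have /(@card_geqP _ (mem (W o)) K) [s [us ss sW]] := KW o ao.
  have cs : #|[set x in s]| = K by rewrite cardsE -ss; apply/card_uniqP.
  have sub : [set x in s] \subset W o by apply/subsetP => x; rewrite inE => /sW.
  have := @hit_many [set x in s]; rewrite cs => /(_ Kq) /leq_trans -> //.
  rewrite leq_mul2l /=; apply: leq_sum => al _; apply: leq_sum => u _.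
  by have := @hit_subset _ _ al u sub; case: hit => // ->.
have lt : q * (q * (K * #|act|)) > \sum_(al < q) \sum_(u < q) 2 * q * \sum_(o | act o) hit (W o) al u.
  have sm (F : 'I_q -> nat) c : (forall i, F i < c) -> \sum_(i < q) F i < q * c.
    move=> Fc; have : \sum_(i < q) (F i + 1) <= \sum_(i < q) c.
      by apply: leq_sum => i _; rewrite addn1 Fc.
    by rewrite big_split !sum_nat_const card_ord /=; lia.
  by apply: (sm) => al; apply: (sm) => u; apply: H.
by rewrite leqNgt lt.
Qed.

End Greedy.

(** Each round loses at least a fraction 8G / q, so about q / (8G) rounds halve U. The G halvings
    needed take at most q / 8 + G <= 3q / 16 rounds, which fits into [q %/ 4]. *)
Lemma greedy_decay (U : nat -> nat) q G : 16 * G <= q -> 0 < G -> 64 <= q ->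
  (forall t, t < q %/ 4 -> 16 * G * U t <= 2 * q * (U t - U t.+1) /\ U t.+1 <= U t) ->
  U 0 < 2 ^ G -> U (q %/ 4) = 0.
Proof.
move=> Gq G0 q64 H U0; set R := q %/ 4 in H *.
have mono i j : i <= j -> j <= R -> U j <= U i.
  move=> ij jR; rewrite -(subnKC ij) in jR *; elim: (j - i) jR => [|k IH] kR; first by rewrite addn0.
  rewrite addnS; apply: leq_trans (IH _); last by lia.
  by case: (H (i + k)); lia.
(* A linear form of the decay: since U decreases, each of the j rounds loses at least the loss
   guaranteed for the last value. At j = X the factor on the left is at least 4q, and U has
   halved. *)
have step t j : t + j <= R -> U (t + j) * (2 * q + 16 * G * j) <= U t * (2 * q).
  elim: j => [|j IH] tj; first by rewrite muln0 !addn0.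
  have {}IH := IH (ltnW (_ : _ < _)); rewrite -addnS in IH; have {}IH := IH tj.
  rewrite addnS in tj *; have [h1 h2] := H _ tj.
  apply: leq_trans IH; move: (U (t + j)) (U (t + j).+1) h1 h2 => a b h1 h2.
  rewrite -(subnKC h2) in h1 *; move: (a - b) h1 => c; rewrite addKn mulnDr => h1.
  have -> : b * (2 * q + 16 * G * j.+1) = b * (2 * q + 16 * G * j) + 16 * G * b by lia.
  rewrite mulnDl leq_add2l; apply: leq_trans (leq_addr _ _) _; apply: leq_trans h1 _.
  by rewrite mulnC leq_mul2l leq_addr orbT.
pose X := q %/ (8 * G) + 1.
have XG : q <= 8 * G * X.
  have h : q %% (8 * G) < 8 * G by rewrite ltn_pmod //; lia.
  have := divn_eq q (8 * G); rewrite /X; move: (q %/ (8 * G)) (q %% (8 * G)) h => a b h E.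
  by rewrite mulnDr muln1 (mulnC _ a); lia.
have GX : G * X <= R.
  rewrite /X /R; have : q %/ (8 * G) * (8 * G) <= q := leq_trunc_div _ _.
  have := divn_eq q 4; have : q %% 4 < 4 by rewrite ltn_pmod.
  by move: (q %/ (8 * G)) (q %/ 4) => a b; nia.
have halve g : g <= G -> U (g * X) * 2 ^ g <= U 0.
  elim: g => [|g IH] gG; first by rewrite mul0n muln1.
  apply: leq_trans (IH (ltnW gG)); rewrite expnS mulnA leq_mul2r; apply/orP; right.
  have gX : g * X + X <= R by apply: leq_trans GX; rewrite -mulSnr leq_mul2r gG orbT.
  have := step _ _ gX; rewrite -mulSnr.
  move: (U (g.+1 * X)) (U (g * X)) => a b; nia.
have := halve G (leqnn _); have := mono _ _ GX (leqnn R).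
case: (posnP (U R)) => // UR UG h.
by have : 2 ^ G <= U (G * X) * 2 ^ G; [rewrite leq_pmull //; lia|lia].
Qed.

(* Stable partition of the first m ranks, marked ones first. *)
Definition marked (mark : nat -> nat) (x : nat) : nat := \sum_(y < x) mark y.

Definition new_rank (mark : nat -> nat) (m x : nat) : nat :=
  if x < m then if mark x != 0 then marked mark x else marked mark m + (x - marked mark x)
  else x.

Section NewRank.
Variables (mark : nat -> nat) (m : nat).
Hypothesis mark1 : forall x, x < m -> mark x <= 1.
Notation cn := (marked mark).

Lemma markedS x : cn x.+1 = cn x + mark x.
Proof. by rewrite /marked big_ord_recr. Qed.

Lemma marked_mono x y : x <= y -> cn x <= cn y.
Proof. by move=> /subnKC <-; elim: (y - x) => [|k IH]; rewrite ?addn0 // addnS markedS; lia. Qed.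

Lemma marked_gap x y : x <= y -> y <= m -> cn y + x <= cn x + y.
Proof.
move=> xy; rewrite -(subnKC xy); elim: (y - x) => [|k IH] xm; first by rewrite addn0.
by rewrite addnS markedS; have := mark1 (x := x + k); have := IH; lia.
Qed.

Lemma marked_le x : x <= m -> cn x <= x.
Proof. by move=> xm; have := marked_gap (leq0n x) xm; rewrite /marked big_ord0; lia. Qed.

Lemma new_rank_marked x : (new_rank mark m x < cn m) = (x < m) && (mark x != 0).
Proof.
rewrite /new_rank; case: (ltnP x m) => xm /=; last first.
  by have := marked_le (leqnn m); lia.
case: ifP => mx; last by lia.
by have := marked_mono xm; rewrite markedS; lia.
Qed.

Lemma new_rank_lt x : (new_rank mark m x < m) = (x < m).
Proof.
rewrite /new_rank; case: (ltnP x m) => xm; last by lia.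
have := marked_mono xm; have := marked_gap xm (leqnn m); have := marked_le (leqnn m).
have := marked_le (ltnW xm); have := mark1 xm; rewrite markedS.
by case: eqP => /=; lia.
Qed.

Lemma new_rank_inj : injective (new_rank mark m).
Proof.
suff H x y : x < y -> new_rank mark m x <> new_rank mark m y.
  move=> x y E; case: (ltngtP x y) => // /H; first by rewrite E.
  by rewrite E.
move=> xy; case: (ltnP y m) => ym; last first.
  rewrite {2}/new_rank ltnNge ym /=; case: (ltnP x m) => xm.
    by have := new_rank_lt x; rewrite xm; lia.
  by rewrite /new_rank ltnNge xm /=; lia.
have xm : x < m by lia.
have := new_rank_marked x; have := new_rank_marked y; rewrite /new_rank xm ym /=.
have := marked_mono xy; have := marked_gap xy (ltnW ym); rewrite markedS.
have := marked_le (ltnW ym); have := marked_le (ltnW xm); have := mark1 xm.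
by case: ifP => mx; case: ifP => my /=; lia.
Qed.

End NewRank.

(** * The convolution program *)

Declare Scope ex_scope.
Delimit Scope ex_scope with X.
Notation "'r[' x ]" := (Var x) (at level 0, x constr, format "'r[' x ]").
Notation "'b[' A , e ]" := (Get A e%X) (at level 0, A constr, e constr).
Notation "# k" := (Lit k) (at level 0, k at level 0, format "# k").
Notation "e + f" := (Bin Add e f) : ex_scope.
Notation "e - f" := (Bin Defs.Sub e f) : ex_scope.
Notation "e * f" := (Bin Mul e f) : ex_scope.
Notation "e %/ f" := (Bin Div e f) : ex_scope.
Notation "e %% f" := (Bin Mod e f) : ex_scope.
Notation "e == f" := (Bin Eq e f) : ex_scope.
Notation "e < f" := (Bin Lt e f) : ex_scope.
Notation "x <~ e" := (PAssign x e%X) (at level 80).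
Notation "A [ e ] <~ f" := (PStore A e%X f%X) (at level 80, e at level 70, format "A [ e ]  <~  f").
Notation "a ;; c" := (PSeq a c) (at level 90, right associativity).

(* Registers: 0 n, 1 p, 2 k0 with 2n <= 2 ^ k0, 3 2 ^ k0, 4 the modulus 2n + 1,
   5 n + 1 (the inverse of 2), 6 depth of the recursion, 10 the row length 2n - 1,
   12 the threshold K, 14 the prime q, 15 the size of the current prefix, 16 and
   17 the class (al, u), 18 the row, 19 whether to weight by the indices, 20 to 26
   the current level of the transform.
   Banks: 10 and 11 the factors (10 then holds the product), 12 scratch, 13 stack
   of level sizes, 14 powers of 2, 15 ranks (with n at n, as a sentinel), 16 hash
   values, 17 active outputs, 18 marks, 19 prefix counts of marks. *)
Definition fill (A : nat) (N g : expr) : prog := PFor true 40 41 N (PStore A r[40] g).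
Definition copy (A B : nat) (N : expr) : prog := fill A N b[B, r[40]].
(** The expression reads scattered cells of the bank being replaced, so the new contents are first
    collected in scratch. *)
Definition refill (A : nat) (g : expr) : prog := fill 12 r[20] g ;; copy A 12 r[20].

Definition e_layer (A : nat) : expr :=
  let pos := ((r[40] %/ r[22]) %% (#2 * r[23]))%X in
  let h := (r[23] %/ r[24])%X in
  let src := ((r[40] %/ r[22]) %/ (#2 * r[23]) * (#2 * r[23]) +
     (pos %/ h) %% r[24] * (#2 * h) + pos %% h)%X in
  let e := ((r[40] %% r[22] + #2 * r[22] - pos %/ h * (r[22] %/ r[24])) %% (#2 * r[22]))%X in
  let x2 := b[A, (src + h) * r[22] + e %% r[22]] in
  ((r[25] * (b[A, src * r[22] + r[40] %% r[22]] +
     ((e < r[22]) * x2 + (#1 - (e < r[22])) * (r[4] - x2 %% r[4])))) %% r[4])%X.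

Definition e_expand (A : nat) : expr :=
  let i0 := ((r[40] %/ r[22]) %% (#2 * r[23]))%X in
  (((i0 < r[23]) * b[A, (r[40] %/ r[22]) %/ (#2 * r[23]) * (r[22] * r[23]) +
      r[40] %% r[22] * r[23] + i0]) %% r[4])%X.

Definition e_fold : expr :=
  let j := (r[40] %% (r[22] * r[23]))%X in
  let blk := (r[40] %/ (r[22] * r[23]))%X in
  let i0 := (j %% r[23])%X in
  let i1 := (j %/ r[23])%X in
  let x := b[10, (blk * (#2 * r[23]) + (#2 * r[23] - (i0 + r[23])) %% (#2 * r[23])) * r[22]
      + (i1 + r[22] - #1) %% r[22]] in
  ((b[10, (blk * (#2 * r[23]) + (#2 * r[23] - i0) %% (#2 * r[23])) * r[22] + i1] +
   ((#0 < i1) * x + (#1 - (#0 < i1)) * (r[4] - x %% r[4]))) %% r[4])%X.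

Definition e_pmul : expr :=
  let bl := (r[40] %/ #2 * #2)%X in
  let j := (r[40] %% #2)%X in
  let x := (b[10, bl + #1] * b[11, bl + (#1 - j)])%X in
  ((b[10, bl] * b[11, bl + j] + ((#0 < j) * x + (#1 - (#0 < j)) * (r[4] - x %% r[4]))) %% r[4])%X.

Definition fft (A : nat) (mu : expr) : prog :=
  25 <~ mu ;;
  PFor false 42 43 r[26] (24 <~ b[14, r[42]] ;; refill A (e_layer A)).

Definition forward (A : nat) : prog := refill A (e_expand A) ;; fft A #1.

Definition set_level : prog :=
  26 <~ r[21] %/ #2 + #1 ;;
  22 <~ b[14, r[21] - r[21] %/ #2] ;;
  23 <~ b[14, r[21] %/ #2].

Definition down_level : prog :=
  13[ r[44] ] <~ r[21] ;; set_level ;;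
  20 <~ #2 * r[20] ;;
  forward 10 ;; forward 11 ;;
  21 <~ r[21] - r[21] %/ #2.

Definition up_level : prog :=
  21 <~ b[13, r[6] - #1 - r[44]] ;; set_level ;;
  fft 10 r[5] ;;
  20 <~ r[20] %/ #2 ;;
  refill 10 e_fold.

(** Zero padding doubles the arrays at each level. The depth is only about the logarithm of k0,
    hence the final size [2 ^ (k0 + D)] is within a factor O(log n) of n. *)
Definition nussbaumer : prog :=
  20 <~ r[3] ;; 21 <~ r[2] ;;
  PFor false 44 45 r[6] down_level ;;
  refill 10 e_pmul ;;
  PFor false 44 45 r[6] up_level.

Definition avoids (s t : seq nat) : bool := all (fun x => x \notin t) s.

Section Convolution.
Variables (V Y Z : nat).
Notation wp := (wp V Y Z).

Lemma wp_seq a c s (P Q : state -> Prop) :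
  wp a s P -> (forall s1, frame a s s1 -> P s1 -> wp c s1 Q) -> wp (a ;; c) s Q.
Proof. exact: wp_conseq. Qed.

Lemma wp_set x e c s (Q : state -> Prop) :
  ev s e < V -> wp c (set_reg s x (ev s e)) Q -> wp (x <~ e ;; c) s Q.
Proof. by []. Qed.

Lemma wp_refill A g s T (F : nat -> nat) :
  A != 12 -> reg s 20 = T -> T < V -> T <= Z ->
  (forall i s', i < T -> reg s' 40 = i ->
     (forall x, x \notin [:: 40; 41] -> reg s' x = reg s x) ->
     (forall B j, B != 12 -> bank s' B j = bank s B j) ->
     ev s' g = F i /\ F i < V) ->
  wp (refill A g) s (fun s' => forall j, j < T -> bank s' A j = F j).
Proof.
move=> A12 rT TV TZ H.
apply: (wp_seq (P := fun s1 => forall j, j < T -> bank s1 12 j = F j)).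
  apply: (wp_fill (N := T) (val := F)) => //= i s' iT xi [fr fb] _ _.
  by apply: H => // B j B12; apply: fb; rewrite /= inE.
move=> s1 [fr1 fb1] E1.
apply: (wp_fill (N := T) (val := F)) => //=; first by rewrite fr1.
move=> i s' iT xi [fr fb] _ _.
rewrite xi fb /= ?inE 1?eq_sym // E1 //; split=> //.
have [] // := H i (set_reg (set_reg s 41 0) 40 i).
move=> x; rewrite !inE negb_or => /andP[x0 x1].
by rewrite /= (negbTE x0) (negbTE x1).
Qed.

Variables (n k0 : nat).
Notation M := (2 * n + 1).
Notation D := (up_log 2 k0).
Hypotheses (n_gt0 : 0 < n) (k0_gt0 : 0 < k0).
Hypotheses (MV : M < V) (TV : 2 ^ (k0 + D) < V) (TZ : 2 ^ (k0 + D) <= Z) (kV : k0 + 2 < V)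
  (kY : k0 + 2 <= Y).

Lemma depth_le : D <= k0.
Proof. by apply: up_log_min => //; rewrite ltnW // ltn_expl. Qed.

Definition conv_ctx (s : state) : Prop :=
  [/\ reg s 2 = k0, reg s 3 = 2 ^ k0, reg s 4 = M, reg s 5 = n.+1 & reg s 6 = D] /\
  (forall i, i <= k0 -> bank s 14 i = 2 ^ i).

Lemma conv_ctx_frame a s s' : frame a s s' -> avoids [:: 2; 3; 4; 5; 6] (mregs a) ->
  14 \notin mbanks a -> conv_ctx s -> conv_ctx s'.
Proof.
move=> [fr fb] /allP d b14 [[h2 h3 h4 h5 h6] h14].
split; last by move=> i ik; rewrite fb ?h14.
by rewrite !fr ?h2 ?h3 ?h4 ?h5 ?h6 //; apply: d.
Qed.

Section FixRing.
Variables (S : comNzRingType) (z : S).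
Hypotheses (M0 : (M%:R = 0 :> S)%R) (zN : (z ^+ (2 ^ k0) = -1)%R).
Notation kk := (level_bits k0).
Notation nb := (level_blocks k0).

Definition at_level (l : nat) (s : state) : Prop :=
  [/\ reg s 26 = (kk l)./2.+1, reg s 22 = 2 ^ uphalf (kk l) & reg s 23 = 2 ^ (kk l)./2].

Lemma wp_fft A mu s l : (A == 10) || (A == 11) -> conv_ctx s -> at_level l s -> l < D ->
  reg s 20 = 2 ^ (k0 + l.+1) -> ev s mu < V ->
  wp (fft A mu) s (fun s' =>
    fft_state (lroot k0 z l.+1) ((ev s mu)%:R)%R (uphalf (kk l)) (kk l)./2
      (el (lroot k0 z l.+1) (2 ^ uphalf (kk l)) (bank s A)) (nb l) (kk l)./2.+1 (bank s' A)).
Proof.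
move=> hA cs [h26 h22 h23] lD h20 muV.
have M_gt0 : 0 < M by lia.
apply: wp_set => //; set s1 := set_reg _ _ _.
set a := uphalf _; set c := _./2; set y := lroot _ _ _; set mv := ev s mu.
have cs1 : conv_ctx s1 by [].
have Ta : 2 ^ (k0 + l.+1) = nb l * 2 ^ c.+1 * 2 ^ a by rewrite -level_blocksS -level_size.
have TV' : 2 ^ (k0 + l.+1) < V by apply: leq_ltn_trans TV; rewrite leq_pexp2l //; lia.
have TZ' : 2 ^ (k0 + l.+1) <= Z by apply: leq_trans TZ; rewrite leq_pexp2l //; lia.
have ck : c <= k0 by have := level_bits_le k0 l; rewrite /c; have := odd_double_half (kk l); lia.
have ya : (y ^+ (2 ^ a) = -1)%R by rewrite /y /a -level_bitsS root_N.
apply: (wp_for (N := c.+1) (I := fun i s' => fft_state y (mv%:R)%R a c (el y (2 ^ a) (bank s1 A)) (nb l) i (bank s' A))) => //=.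
- lia.
- lia.
- exact: fft_start.
- move=> i s2 ic xi fr I2.
  have cs2 : conv_ctx s2 by case/orP: hA fr => /eqP-> fr; apply: conv_ctx_frame fr _ _ cs1.
  have [fr2 fb2] := fr.
  have h24 : bank s2 14 i = 2 ^ i by case: cs2 => _ ->; lia.
  apply: wp_set => /=; rewrite ?xi h24.
    by apply: leq_ltn_trans TV; rewrite leq_pexp2l //; lia.
  set s3 := set_reg _ _ _.
  have r3 x : x \notin [:: 24; 25; 40; 41; 42; 43] -> reg s3 x = reg s x.
    move=> hx; rewrite /s3 /=; rewrite !inE !negb_or in hx; case/and5P: hx => x1 x2 x3 x4 x5.
    rewrite (negbTE x1) fr2 /s1 /=; first by rewrite (negbTE x2).
    by case/andP: x5 => x5 x6; rewrite !inE !negb_or x1 x3 x4 x5 x6.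
  apply: wp_conseq (wp_refill (T := 2 ^ (k0 + l.+1))
    (F := layer M mv (2 ^ a) (2 ^ c) (2 ^ i) (bank s2 A)) _ _ _ _ _) _ => //.
  + by case/orP: hA => /eqP->.
  + by rewrite r3.
  + move=> j s4 jT xj fr4 fb4; split; last by apply: leq_ltn_trans MV; apply: ltnW; rewrite ltn_pmod.
    have e4 : reg s4 4 = M by rewrite fr4 // r3 //; case: cs => [[]].
    have e22 : reg s4 22 = 2 ^ a by rewrite fr4 // r3.
    have e23 : reg s4 23 = 2 ^ c by rewrite fr4 // r3.
    have e24 : reg s4 24 = 2 ^ i by rewrite fr4.
    have e25 : reg s4 25 = mv by rewrite fr4 // /s3 /= fr2.
    rewrite /e_layer /= xj e4 e22 e23 e24 e25 !fb4 //.
    by case/orP: hA => /eqP->.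
    by case/orP: hA => /eqP->.
  + move=> s5 fr5 E5; apply: (fft_layer M_gt0 M0 _ _ _ I2) => //; first exact: half_le_uphalf.
    by move=> j jT; apply: E5; rewrite Ta.
Qed.

Lemma wp_set_level s l : conv_ctx s -> reg s 21 = kk l -> wp set_level s (at_level l).
Proof.
move=> [_ h14] h21; have := level_bits_le k0 l; have kE := level_bitsE k0 l => kl.
have pV i : i <= k0 -> 2 ^ i < V by move=> ik; apply: leq_ltn_trans TV; rewrite leq_pexp2l //; lia.
have h22 : bank s 14 (kk l - kk l %/ 2) = 2 ^ uphalf (kk l).
  by rewrite h14 divn2; [congr (2 ^ _); lia|lia].
have h23 : bank s 14 (kk l %/ 2) = 2 ^ (kk l)./2 by rewrite h14 divn2 //; lia.
apply: wp_set => /=; rewrite h21; first by rewrite divn2; lia.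
apply: wp_set => /=; rewrite h21 h22; first by apply: pV; lia.
split=> /=; rewrite h21 h23; first by apply: pV; lia.
by split; rewrite //= divn2 addn1.
Qed.

Lemma wp_forward A s l : (A == 10) || (A == 11) -> conv_ctx s -> at_level l s -> l < D ->
  reg s 20 = 2 ^ (k0 + l.+1) ->
  wp (forward A) s (fun s' => exists2 g0,
    (forall j, j < 2 ^ (k0 + l.+1) -> g0 j = expand M (2 ^ uphalf (kk l)) (2 ^ (kk l)./2) (bank s A) j) &
    fft_state (lroot k0 z l.+1) 1%R (uphalf (kk l)) (kk l)./2
      (el (lroot k0 z l.+1) (2 ^ uphalf (kk l)) g0) (nb l) (kk l)./2.+1 (bank s' A)).
Proof.
move=> hA cs ls lD h20; have M_gt0 : 0 < M by lia.
have TV' : 2 ^ (k0 + l.+1) < V by apply: leq_ltn_trans TV; rewrite leq_pexp2l //; lia.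
have TZ' : 2 ^ (k0 + l.+1) <= Z by apply: leq_trans TZ; rewrite leq_pexp2l //; lia.
have [h26 h22 h23] := ls.
apply: wp_seq.
  apply: (wp_refill (T := 2 ^ (k0 + l.+1))
    (F := expand M (2 ^ uphalf (kk l)) (2 ^ (kk l)./2) (bank s A))) => //.
    by case/orP: hA => /eqP->.
  move=> j s4 jT xj fr4 fb4; split; last by apply: leq_ltn_trans MV; apply: ltnW; rewrite ltn_pmod.
  have e4 : reg s4 4 = M by rewrite fr4 //; case: cs => [[]].
  rewrite /e_expand /= xj e4 !fr4 // h22 h23 fb4 //.
  by case/orP: hA => /eqP->.
move=> s1 fr1 E1.
have cs1 : conv_ctx s1 by case/orP: hA fr1 => /eqP-> fr1; apply: conv_ctx_frame fr1 _ _ cs.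
apply: wp_conseq (wp_fft (mu := #1) hA cs1 _ lD _ _) _.
- by case/orP: hA fr1 => /eqP-> [fr1 _]; split; rewrite fr1.
- by case/orP: hA fr1 => /eqP-> [fr1 _]; rewrite fr1.
- by rewrite /=; lia.
by move=> s2 fr2 F; exists (bank s1 A).
Qed.

Definition down_inv (X0 Y0 : nat -> nat) (l : nat) (s : state) : Prop :=
  [/\ reg s 20 = 2 ^ (k0 + l), reg s 21 = kk l, (forall j, j < l -> bank s 13 j = kk j),
      exists E P, chain k0 z E P l X0 (bank s 10) & exists E P, chain k0 z E P l Y0 (bank s 11)].

Lemma wp_down_level X0 Y0 s l : conv_ctx s -> reg s 44 = l -> l < D -> down_inv X0 Y0 l s ->
  wp down_level s (down_inv X0 Y0 l.+1).
Proof.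
move=> cs h44 lD [h20 h21 h13 [EA [PA CA]] [EB [PB CB]]].
have M_gt0 : 0 < M by lia.
have kl := level_bits_le k0 l; have kE := level_bitsE k0 l.
split; first by rewrite /= h21; lia.
set s1 := set_cell _ _ _ _.
have cs1 : conv_ctx s1.
  by case: cs => cs c14; split.
apply: wp_seq; first by apply: (@wp_set_level s1 l).
move=> s2 fr2 ls2; have cs2 := conv_ctx_frame fr2 isT isT cs1; have [r2 b2] := fr2.
have TE : 2 * 2 ^ (k0 + l) = 2 ^ (k0 + l.+1) by rewrite addnS expnS.
apply: wp_set; rewrite /= r2 //= h20 TE.
  by apply: leq_ltn_trans TV; rewrite leq_pexp2l //; lia.
set s3 := set_reg _ _ _; have cs3 : conv_ctx s3 by [].
apply: wp_seq; first by apply: (@wp_forward 10 s3 l).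
move=> s4 fr4 [g0 g0E F0]; have cs4 := conv_ctx_frame fr4 isT isT cs3; have [r4 b4] := fr4.
apply: wp_seq.
  apply: (@wp_forward 11 s4 l) => //; last by rewrite r4.
  by case: ls2 => *; split; rewrite r4.
move=> s5 fr5 [g1 g1E F1]; have [r5 b5] := fr5.
have r5k x : x \notin [:: 20; 22; 23; 24; 25; 26; 40; 41; 42; 43] -> reg s5 x = reg s x.
  move=> h; rewrite r5; last by apply: contra h; rewrite !inE; lia.
  rewrite r4; last by apply: contra h; rewrite !inE; lia.
  rewrite /s3 /= ifF; last by apply: contraNF h => /eqP->.
  by rewrite r2 //; apply: contra h; rewrite !inE; lia.
have bk A j : A \notin [:: 10; 11; 12; 13] -> bank s5 A j = bank s A j.
  move=> h; rewrite b5; last by apply: contra h; rewrite !inE; lia.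
  rewrite b4; last by apply: contra h; rewrite !inE; lia.
  rewrite /s3 /= b2 //= ifF //; apply: contraNF h; rewrite !inE; lia.
split=> /=; rewrite r5k // h21; first by lia.
split=> /=.
- by rewrite r5 //= r4.
- by rewrite divn2; lia.
- move=> j jl; rewrite b5 // b4 //= b2 //= h44.
  by case: eqP => [->|/eqP ne] //; apply: h13; lia.
- have CA3 : chain k0 z EA PA l X0 (bank s3 10).
    by apply: chain_ext CA => i; rewrite /= b2.
  have [E [P CE]] := chainS M_gt0 M0 CA3 g0E F0.
  by exists E, P; apply: chain_ext CE => i; rewrite /= b5.
- have CB4 : chain k0 z EB PB l Y0 (bank s4 11).
    by apply: chain_ext CB => i; rewrite b4 //= b2.
  have [E [P CE]] := chainS M_gt0 M0 CB4 g1E F1.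
  by exists E, P; apply: chain_ext CE.
Qed.

Definition up_inv (E F : nat -> nat -> S) (l : nat) (s : state) : Prop :=
  [/\ reg s 20 = 2 ^ (k0 + l),
      forall b, b < nb l -> el (lroot k0 z l) (2 ^ kk l) (bank s 10) b = (E l b * F l b)%R &
      forall j, j < 2 ^ (k0 + l) -> bank s 10 j < M].

Lemma wp_up_level X0 Y0 f g EA PA EB PB s l :
  chain k0 z EA PA D X0 f -> chain k0 z EB PB D Y0 g ->
  conv_ctx s -> reg s 44 = D - l.+1 -> l < D ->
  (forall j, j < D -> bank s 13 j = kk j) ->
  up_inv EA EB l.+1 s -> wp up_level s (up_inv EA EB l).
Proof.
move=> CA CB cs h44 lD h13 [h20 hE hM].
have M_gt0 : 0 < M by lia.
have kl := level_bits_le k0 l; have kE := level_bitsE k0 l.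
have h6 : reg s 6 = D by case: cs => [[]].
have e21 : bank s 13 (reg s 6 - 1 - reg s 44) = kk l by rewrite h6 h44 -h13 //; congr bank; lia.
apply: wp_set; rewrite /= e21; first by lia.
set s1 := set_reg _ _ _; have cs1 : conv_ctx s1 by [].
apply: wp_seq; first by apply: (@wp_set_level s1 l).
move=> s2 fr2 ls2; have cs2 := conv_ctx_frame fr2 isT isT cs1; have [r2 b2] := fr2.
have h5 : reg s2 5 = n.+1 by case: cs2 => [[]].
apply: wp_seq.
  apply: (@wp_fft 10 r[5] s2 l) => //; first by rewrite r2.
  by rewrite /= h5; apply: leq_ltn_trans MV; lia.
move=> s3 fr3 F3; have cs3 := conv_ctx_frame fr3 isT isT cs2; have [r3 b3] := fr3.
have TE : 2 ^ (k0 + l.+1) %/ 2 = 2 ^ (k0 + l) by rewrite addnS expnS mulKn.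
have TV' : 2 ^ (k0 + l) < V by apply: leq_ltn_trans TV; rewrite leq_pexp2l //; lia.
have TZ' : 2 ^ (k0 + l) <= Z by apply: leq_trans TZ; rewrite leq_pexp2l //; lia.
apply: wp_set; rewrite /= r3 // r2 //= h20 TE //.
set s4 := set_reg _ _ _.
apply: wp_conseq (wp_refill (T := 2 ^ (k0 + l))
  (F := fold M (2 ^ uphalf (kk l)) (2 ^ (kk l)./2) (bank s3 10)) _ _ _ _ _) _ => //.
  move=> j s5 jT xj fr5 fb5; split; last by apply: leq_ltn_trans MV; apply: ltnW; rewrite ltn_pmod.
  have e4 : reg s5 4 = M by rewrite fr5 //; case: cs3 => [[]].
  case: ls2 => _ h22 h23.
  have e22 : reg s5 22 = 2 ^ uphalf (kk l) by rewrite fr5 //= r3.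
  have e23 : reg s5 23 = 2 ^ (kk l)./2 by rewrite fr5 //= r3.
  by rewrite /e_fold /= xj e4 e22 e23 !fb5.
move=> s5 fr5 h5E.
have hf2 : (2%:R * (n.+1)%:R = 1 :> S)%R.
  have -> : (2%:R * (n.+1)%:R = M%:R + 1 :> S)%R.
    by rewrite -GRing.natrM GRing.natr1 ; congr (_%:R)%R; lia.
  by rewrite M0 GRing.add0r.
split.
- by case: fr5 => r5 _; rewrite r5.
- have h2E b : b < nb l.+1 ->
      el (lroot k0 z l.+1) (2 ^ kk l.+1) (bank s2 10) b = (EA l.+1 b * EB l.+1 b)%R.
    by move=> bn; rewrite -hE //; apply: el_ext => i; rewrite b2.
  rewrite /= h5 in F3.
  exact: (chain_backward M_gt0 M0 zN CA CB lD hf2 h2E F3 h5E).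
- by move=> j jT; rewrite h5E // ltn_pmod.
Qed.

Lemma wp_nussbaumer s : conv_ctx s -> wp nussbaumer s (fun s' =>
  (el z (2 ^ k0) (bank s' 10) 0 = el z (2 ^ k0) (bank s 10) 0 * el z (2 ^ k0) (bank s 11) 0)%R /\
  forall j, j < 2 ^ k0 -> bank s' 10 j < M).
Proof.
move=> cs; have kD : k0 <= 2 ^ D by apply: up_logP.
have M_gt0 : 0 < M by lia.
have Dk := depth_le; have [[h2 h3 h4 h5 h6] _] := cs.
have pV i : i <= D -> 2 ^ (k0 + i) < V by move=> iD; apply: leq_ltn_trans TV; rewrite leq_pexp2l //; lia.
apply: wp_set; rewrite /= h3; first by have := pV 0 (leq0n _); rewrite addn0.
apply: wp_set; rewrite /= h2; first by lia.
set s0 := set_reg _ _ _; have c0 : conv_ctx s0 by [].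
apply: (wp_seq (P := down_inv (bank s 10) (bank s 11) D)).
  apply: (wp_for (N := D) (I := down_inv (bank s 10) (bank s 11))) => //; [lia|by rewrite /iters; lia| |].
  - split=> //=; first by rewrite addn0.
    + by exists (fun _ b => el z (2 ^ k0) (bank s 10) b), (fun _ _ _ => 0%R); apply: chain0.
    + by exists (fun _ b => el z (2 ^ k0) (bank s 11) b), (fun _ _ _ => 0%R); apply: chain0.
  - move=> i s1 iD h44 fr I1; have c1 := conv_ctx_frame fr isT isT c0.
    by apply: wp_conseq (wp_down_level c1 h44 iD I1) _.
move=> s1 fr1 [h20 h21 h13 [EA [PA CA]] [EB [PB CB]]].
have c1 := conv_ctx_frame fr1 isT isT c0.
have k1 : kk D = 1 := level_bits_end k0_gt0 kD.
apply: (wp_seq (P := up_inv EA EB D)).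
  apply: wp_conseq (wp_refill (T := 2 ^ (k0 + D))
    (F := pmul M (bank s1 10) (bank s1 11)) _ _ _ _ _) _ => //.
    move=> j s5 jT xj fr5 fb5; split; last by apply: leq_ltn_trans MV; apply: ltnW; rewrite ltn_pmod.
    have e4 : reg s5 4 = M by rewrite fr5 //; case: c1 => [[]].
    by rewrite /e_pmul /= xj e4 !fb5.
  move=> s2 fr2 h2E; split.
  - by case: fr2 => r2 _; rewrite r2.
  - case: CA => _ EAl _ _; case: CB => _ EBl _ _.
    move=> b bn; rewrite -EAl // -EBl // k1 expn1; apply: (el_pmul M_gt0 M0).
      by have := @root_N k0 S z zN D; rewrite k1 expn1.
    move=> j j2; apply: h2E; have := level_size k0 D; rewrite k1 expn1 => <-; lia.
  - by move=> j jT; rewrite h2E // ltn_pmod.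
move=> s2 fr2 U2; have c2 := conv_ctx_frame fr2 isT isT c1.
have h13' j : j < D -> bank s2 13 j = kk j by case: fr2 => _ b2 jD; rewrite b2 ?h13.
apply: (wp_for (N := D) (I := fun i => up_inv EA EB (D - i))) => //; [by case: c2 => [[]]|lia|by rewrite /iters; lia| | |].
- by rewrite subn0.
- move=> i s3 iD h44 fr I3; have c3 := conv_ctx_frame fr isT isT c2.
  have E : D - i = (D - i.+1).+1 by lia.
  apply: wp_conseq (wp_up_level (l := D - i.+1) CA CB c3 _ _ _ _) _ => //.
  + by rewrite h44 -E; lia.
  + by lia.
  + by move=> j jD; case: fr => _ b3; rewrite b3 ?h13'.
  + by rewrite -E.
- move=> s3 fr3; rewrite subnn => -[_ hE hM]; split; last by move=> j; rewrite -(addn0 k0); apply: hM.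
  have := hE 0 (_ : 0 < nb 0); rewrite /lroot subnn expn0 GRing.expr1 => -> //; last by rewrite expn_gt0.
  by case: CA => -> _ _ _; case: CB => -> _ _ _.
Qed.
End FixRing.
End Convolution.

(** * The halving of a prefix and the listing of witnesses *)

(** At address 0 the quotient is 0 again, and the recursion would read a stale cell; the factor [#0
    < r[40]] removes it. *)
Definition hash_table : prog :=
  PFor true 40 41 r[0]
    (16[ r[40] ] <~ (r[40] %% r[14] + r[16] * b[16, r[40] %/ r[14]] * (#0 < r[40])) %% r[14]).

Definition class_conv : prog :=
  fill 10 r[3] ((r[40] < r[0]) * ((b[15, r[40]] < r[15]) * (b[16, b[15, r[40]]] == r[17])) *
    b[0, r[18] * r[0] + r[40]] * (r[19] * r[40] + (#1 - r[19])))%X ;;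
  fill 11 r[3] ((r[40] < r[0]) * b[1, r[18] * r[0] + r[40]])%X ;;
  nussbaumer.

Definition rows_do (body : prog) : prog := PFor false 18 48 r[1] (class_conv ;; body).

Definition out_loop (A : nat) (g : expr) : prog :=
  PFor true 40 41 r[10] (A[ r[18] * r[10] + r[40] ] <~ g).

Definition e_out (A : nat) : expr := b[A, r[18] * r[10] + r[40]].

Definition select (al u : expr) : prog := 16 <~ al ;; 17 <~ u ;; hash_table.

(* The value read off the weighted convolution is checked to be a witness: it need
   not be one when its class contains several witnesses. *)
Definition e_list : expr :=
  let v := b[10, r[40]] in
  let old := e_out 3 in
  let ok := ((v < r[0]) * b[0, r[18] * r[0] + v] * (v < r[40] + #1) * (r[40] - v < r[0]) *
     b[1, r[18] * r[0] + (r[40] - v)] * (b[15, v] < b[15, old]))%X in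
  (ok * v + (#1 - ok) * old)%X.

Definition listing : prog :=
  19 <~ #1 ;;
  PFor false 50 51 (r[14] * r[14])%X
    (select (r[50] %/ r[14])%X (r[50] %% r[14])%X ;; rows_do (out_loop 3 e_list)).

Definition clear (A : nat) : prog := PFor true 40 41 r[0] (A[ r[40] ] <~ #0).

(** With a zero hash table and u = 0 the selected class is the entire prefix, so the same
    convolution counts all witnesses in it. *)
Definition init_active : prog :=
  clear 18 ;; clear 16 ;; 17 <~ #0 ;; 19 <~ #0 ;;
  rows_do (out_loop 17 (r[12] < b[10, r[40]])%X).

Definition count_hits : prog :=
  rows_do (PFor true 40 41 r[10] (32 <~ r[32] + e_out 17 * (#0 < b[10, r[40]]))).

(** The comparison is non-strict, so that the first class is recorded even if it hits nothing and
    registers 30 and 31 always name a class that has been tried. *)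
Definition best_class : prog :=
  29 <~ #0 ;; 30 <~ #0 ;; 31 <~ #0 ;;
  PFor false 50 51 (r[14] * r[14])%X
    (select (r[50] %/ r[14])%X (r[50] %% r[14])%X ;; 32 <~ #0 ;; count_hits ;;
     PIf (r[29] < r[32] + #1)%X (29 <~ r[32] ;; 30 <~ r[16] ;; 31 <~ r[17]) PSkip).

Definition round : prog :=
  best_class ;;
  select r[30] r[31] ;;
  PFor true 40 41 r[15] (18[ r[40] ] <~ #1 - (#1 - b[18, r[40]]) * (#1 - (b[16, r[40]] == r[17]))) ;;
  rows_do (out_loop 17 (e_out 17 * (b[10, r[40]] == #0))%X).

Definition e_rank : expr :=
  let x := b[15, r[40]] in
  ((x < r[15]) * (b[18, x] * b[19, x] + (#1 - b[18, x]) * (b[19, r[15]] + (x - b[19, x]))) +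
   (#1 - (x < r[15])) * x)%X.

Definition renumber : prog :=
  PFor true 40 41 (r[15] + #1)%X
    (19[ r[40] ] <~ (#0 < r[40]) * (b[19, r[40] - #1] + b[18, r[40] - #1])) ;;
  fill 15 r[0] e_rank ;;
  28 <~ b[19, r[15]].

(** A prefix shorter than q gets no rounds, hence no marks, and its successor is empty. This is
    harmless: ranks below q hash to themselves, so all their witnesses are isolated. *)
Definition shrink : prog :=
  27 <~ (r[14] %/ #4) * (#1 - (r[15] < r[14])) ;;
  init_active ;; PFor false 52 53 r[27] round ;; renumber.

(** The listing already compares by the new ranks but still ranges over the old prefix, which
    renumbering preserves as a set; only then does register 15 shrink. *)
Definition level : prog := shrink ;; listing ;; 15 <~ r[28].

Lemma sum_truncate (F : nat -> nat) n j : (forall k, n <= k -> F k = 0) ->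
  \sum_(k < j.+1) F k = \sum_(k < n) (k <= j) * F k.
Proof.
move=> F0.
have E a : a <= maxn j.+1 n -> \sum_(k < maxn j.+1 n) (k < a) * F k = \sum_(k < a) F k.
  move=> aN; rewrite (big_ord_widen _ F aN) [RHS]big_mkcond /=.
  by apply: eq_bigr => k _; case: ltnP; rewrite ?mul1n ?mul0n.
rewrite -E ?leq_maxl // (big_ord_widen _ (fun k => (k <= j) * F k) (leq_maxr j.+1 n)) [RHS]big_mkcond /=.
apply: eq_bigr => k _; rewrite ltnS; case: ltnP => // nk.
by rewrite F0 // muln0.
Qed.

Lemma address c i j i' j' : j < c -> j' < c -> i * c + j = i' * c + j' -> i = i' /\ j = j'.
Proof.
move=> jc jc' E; have c0 : 0 < c by lia.
have := congr1 (divn^~ c) E; rewrite !divnMDl // !divn_small // !addn0 => Ei.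
by split=> //; move: E; rewrite Ei; lia.
Qed.

(** * Verification of one level *)

Section Prefix.
Variables (V Y Z : nat).
Notation wp := (wp V Y Z).

Lemma wp_if e a c s (Q : state -> Prop) : (ev s e != 0 -> wp a s Q) ->
  (ev s e = 0 -> wp c s Q) -> wp (PIf e a c) s Q.
Proof. by move=> Ha Hc; rewrite /wp -/wp; case: eqP => [/Hc|/eqP/Ha]. Qed.

Variables (n p k0 K q : nat) (ra rb : nat -> nat).
Notation M := (2 * n + 1).
Notation D := (up_log 2 k0).
Notation J := (n.*2.-1).
Definition wit (i j k : nat) : bool :=
  [&& k < n, ra (i * n + k) != 0, k <= j, j - k < n & rb (i * n + (j - k)) != 0].

Definition ctx (s : state) : Prop :=
  [/\ conv_ctx n k0 s, [/\ reg s 0 = n, reg s 1 = p, reg s 10 = J, reg s 12 = K & reg s 14 = q],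
      forall x, bank s 0 x = ra x & forall x, bank s 1 x = rb x].

Lemma ctx_frame a s s' : frame a s s' ->
  avoids [:: 0; 1; 2; 3; 4; 5; 6; 10; 12; 14] (mregs a) ->
  avoids [:: 0; 1; 14] (mbanks a) -> ctx s -> ctx s'.
Proof.
move=> fr /allP dr /allP db [cs [h0 h1 h10 h12 h14] hra hrb]; have [r bb] := fr.
split; last by move=> x; rewrite bb ?db.
- apply: conv_ctx_frame fr _ _ cs; last exact: db.
  by apply/allP => x hx; apply: dr; move: hx; rewrite !inE; lia.
- by rewrite !r ?h0 ?h1 ?h10 ?h12 ?h14 //; apply: dr.
- by move=> x; rewrite bb ?db.
Qed.

Hypotheses (n_gt0 : 0 < n) (n_k0 : 2 * n <= 2 ^ k0).
Hypotheses (MV : M < V) (TV : 2 ^ (k0 + D) < V) (TZ : 2 ^ (k0 + D) <= Z)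
  (kV : k0 + 2 < V) (kY : k0 + 2 <= Y) (pV : p * J < V) (pV' : p < V) (pY : p <= Y) (KV : K < V)
  (qqV : q * q < V) (qqY : q * q <= Y).
Hypotheses (q_prime : prime q) (ra1 : forall x, ra x <= 1) (rb1 : forall x, rb x <= 1).

Lemma k0_gt0 : 0 < k0.
Proof. by case: k0 n_k0 => //; lia. Qed.

Lemma size_V : 2 ^ k0 < V.
Proof. by apply: leq_ltn_trans TV; rewrite leq_pexp2l // leq_addr. Qed.

Lemma size_Z : 2 ^ k0 <= Z.
Proof. by apply: leq_trans TZ; rewrite leq_pexp2l // leq_addr. Qed.

Lemma wp_hash_table s : ctx s -> wp hash_table s (fun s' =>
  forall x, x < n -> bank s' 16 x = hash q (reg s 16) x).
Proof.
move=> [cs [h0 _ _ _ h14] _ _]; have nV : n < V by lia.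
have nZ : n <= Z by have := size_Z; lia.
have q1 := prime_gt1 q_prime.
apply: (wp_fill (N := n) (val := hash q (reg s 16))) => // i s' iN xi [r _] H _; split; last first.
  by apply: leq_ltn_trans (ltnW (hash_lt _ _ (ltnW q1))) _; apply: leq_ltn_trans qqV; rewrite leq_pmull //; lia.
rewrite /= xi r //= h14 r //=; case: (posnP i) => [->|i0].
  by rewrite muln0 addn0 mod0n mod0n hash0.
by rewrite hashS // H ?muln1 // ltn_Pdiv.
Qed.

Lemma wp_class_conv s i (w : bool) (cls : nat -> bool) :
  ctx s -> reg s 18 = i -> reg s 19 = w ->
  (forall k, k < n ->
     ((bank s 15 k < reg s 15) && (bank s 16 (bank s 15 k) == reg s 17)) = cls k) ->
  wp class_conv s (fun s' => forall j, j < 2 ^ k0 ->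
     bank s' 10 j = (\sum_(k < n) (cls k && wit i j k) * (if w then k : nat else 1)) %% M).
Proof.
move=> cs h18 h19 hcls; have [[[h2 h3 h4 h5 h6] h14] [h0 h1 h10 h12 hq] hra hrb] := cs.
have sV := size_V; have sZ := size_Z.
pose X k := (k < n) * cls k * ra (i * n + k) * (if w then k else 1).
pose W k := (k < n) * rb (i * n + k).
apply: (wp_seq (P := fun s1 => forall k, k < 2 ^ k0 -> bank s1 10 k = X k)).
  apply: (wp_fill (N := 2 ^ k0) (val := X)) => //.
  move=> k s' kN xi [r bb] _ _; split; last first.
    rewrite /X; have := ra1 (i * n + k); case: (ltnP k n) => kn; last by rewrite !mul0n; lia.
    by case: (cls k); case: (w); case: (ra _) => [|[|//]] _ /=; lia.
  rewrite /X /= xi !r //= h0 h18 h19 !bb //= hra.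
  case: (ltnP k n) => kn; last by rewrite !mul0n.
  by rewrite -(hcls _ kn) -mulnb; case: (w) => /=; rewrite ?mul1n ?mul0n ?addn0.
move=> s1 fr1 E1; have [r1 b1] := fr1; have c1 := ctx_frame fr1 isT isT cs.
apply: (wp_seq (P := fun s2 => forall k, k < 2 ^ k0 -> bank s2 11 k = W k)).
  apply: (wp_fill (N := 2 ^ k0) (val := W)) => //; first by rewrite /= r1.
  move=> k s' kN xi [r bb] _ _; split; last first.
    by rewrite /W; have := rb1 (i * n + k); case: (k < n); lia.
  by rewrite /W /= xi !r //= !r1 //= h0 h18 bb //= b1 //= hrb.
move=> s2 fr2 E2; have [r2 b2] := fr2; have c2 := ctx_frame fr2 isT isT c1.
have M1 : 1 < M by lia.
have [S [z [M0 zN coef]]] := negacyclic_ring k0 M1.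
have [cc2 _ _ _] := c2.
apply: wp_conseq (wp_nussbaumer n_gt0 k0_gt0 MV TV TZ kV kY M0 zN cc2) _.
move=> s3 _ [hE hM] j jk.
rewrite (coef n (bank s2 10) (bank s2 11) (bank s3 10) n_k0 n_gt0 _ _ hE hM j jk); first last.
- by move=> k /andP[nk kN]; rewrite E2 // /W ltnNge nk.
- by move=> k /andP[nk kN]; rewrite b2 // E1 // /X ltnNge nk.
congr (_ %% _).
transitivity (\sum_(k < j.+1) X k * W (j - k)).
  apply: eq_bigr => k _; have kj := ltn_ord k.
  by rewrite b2 // E1 ?E2 //; lia.
rewrite (@sum_truncate (fun k => X k * W (j - k)) n); last first.
  by move=> k nk; rewrite /X ltnNge nk.
apply: eq_bigr => k _; rewrite /X /W /wit ltn_ord /= mul1n.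
have := ra1 (i * n + k); have := rb1 (i * n + (j - k)).
by case: (cls k); case: (k <= j); case: (j - k < n); case: (rb _) => [|[|//]] _;
  case: (ra _) => [|[|//]] _; rewrite /= ?mul1n ?mul0n ?muln0 ?muln1.
Qed.

Definition cval (w : bool) (C : nat -> bool) (i j : nat) : nat :=
  (\sum_(k < n) (C k && wit i j k) * (if w then k : nat else 1)) %% M.

Definition ready (s : state) (C : nat -> bool) : Prop :=
  forall k, k < n -> ((bank s 15 k < reg s 15) && (bank s 16 (bank s 15 k) == reg s 17)) = C k.

Lemma J_le : J <= 2 ^ k0.
Proof. by apply: leq_trans n_k0; rewrite mul2n leq_pred. Qed.

(** One rule for the three output loops: listing witnesses in bank 3, and setting and clearing
    activity in bank 17. [upd] describes the new cell from the convolution value and the old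
    cell. *)
Lemma wp_rows_update A g (w : bool) C (upd : nat -> nat -> nat -> nat -> nat) s :
  (A == 3) || (A == 17) -> ctx s -> reg s 19 = w -> ready s C ->
  (forall s' i j, i < p -> j < J -> reg s' 18 = i -> reg s' 40 = j ->
     (forall x, x \notin mregs (rows_do (out_loop 3 #0)) -> reg s' x = reg s x) ->
     (forall B y, B \notin [:: 10; 11; 12; 13; A] -> bank s' B y = bank s B y) ->
     bank s' A (i * J + j) = bank s A (i * J + j) ->
     bank s' 10 j = cval w C i j ->
     ev s' g = upd i j (cval w C i j) (bank s A (i * J + j)) /\ ev s' g < V) ->
  wp (rows_do (out_loop A g)) s (fun s' => forall i j, i < p -> j < J ->
     bank s' A (i * J + j) = upd i j (cval w C i j) (bank s A (i * J + j))).
Proof.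
move=> hA cs h19 rs Hg; have JN := J_le; have sV := size_V; have sZ := size_Z.
have p1 : reg s 1 = p by case: cs => _ [].
apply: (wp_for (N := p) (I := fun i s' =>
   (forall i' j, i' < i -> j < J -> bank s' A (i' * J + j) = upd i' j (cval w C i' j) (bank s A (i' * J + j))) /\
   (forall i' j, i <= i' -> j < J -> bank s' A (i' * J + j) = bank s A (i' * J + j)))) => //.
- move=> i s1 ip h18 fr1 [I1 I2].
  have c1 : ctx s1 by case/orP: hA fr1 => /eqP-> fr1; apply: ctx_frame fr1 _ _ cs.
  have [r1 b1] := fr1.
  have rr1 x : x \notin mregs (rows_do (out_loop 3 #0)) -> reg s1 x = reg s x by move=> h; apply: r1.
  have bb1 B y : B \notin [:: 10; 11; 12; 13; A] -> bank s1 B y = bank s B y.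
    move=> h; apply: b1; apply: contra h; rewrite /= !inE; lia.
  have rs1 : ready s1 C.
    move=> k kn; rewrite -rs // !rr1 // !bb1 //; by case/orP: hA => /eqP->.
  apply: (wp_seq (P := fun s2 => forall j, j < 2 ^ k0 -> bank s2 10 j = cval w C i j)).
    by apply: (wp_class_conv (w := w)) => //; rewrite rr1.
  move=> s2 fr2 E2; have [r2 b2] := fr2; have c2 := ctx_frame fr2 isT isT c1.
  have b2A y : bank s2 A y = bank s1 A y by apply: b2; case/orP: hA => /eqP->.
  have h10 : reg s2 10 = J by case: c2 => _ [].
  have a10 B : B \notin [:: 10; 11; 12; 13; A] -> B \notin mbanks class_conv.
    by apply: contra; rewrite /= !inE; lia.
  apply: (wp_scatter (N := J) (adr := fun j => i * J + j)
    (val := fun j => upd i j (cval w C i j) (bank s A (i * J + j)))) => //.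
  + lia.
  + by rewrite /iters; lia.
  + by move=> x y _ _; apply: addnI.
  + move=> j s3 jJ xj fr3 H1 H2; have [r3 b3] := fr3.
    have [] // := Hg s3 i j ip jJ.
    * by rewrite r3 // r2.
    * move=> x h; rewrite r3; last by apply: contra h; rewrite /= !inE; lia.
      rewrite r2 ?rr1 //; apply: contra h => h.
      have h' : x \in mregs class_conv ++ [:: 40; 41] by rewrite mem_cat h.
      by apply/orP; right; apply/orP; right.
    * move=> B y h; rewrite b3; last by apply: contra h; rewrite /= !inE; lia.
      by rewrite b2 ?bb1 //; apply: a10.
    * rewrite H2 ?b2A ?I2 // => j' jj /addnI; lia.
    * rewrite b3; last by case/orP: hA => /eqP->.
      by apply: E2; lia.
    * by move=> E LV; split; rewrite -?E //= r3 //= r2 // h18 r3 // h10 xj.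
  + move=> s3 fr3 H1 H2; split=> [i' j|i' j] ii jJ /=.
      have [ii'|->] : i' < i \/ i' = i by lia.
        rewrite H2 ?b2A ?I1 // => j' jj /(address jj jJ)[]; lia.
      by rewrite H1.
    rewrite H2 ?b2A ?I2 //; first by lia.
    by move=> j' jj /(address jj jJ)[]; lia.
- by move=> s' fr [H _].
Qed.

Definition cls (pos : nat -> nat) (m al u k : nat) : bool :=
  (pos k < m) && (hash q al (pos k) == u).

Lemma wp_select al u a b s : ctx s -> (forall k, k < n -> bank s 15 k < n) ->
  ev s al = a -> a < V -> ev (set_reg s 16 a) u = b -> b < V ->
  wp (select al u) s (fun s' =>
    [/\ reg s' 16 = a, reg s' 17 = b & ready s' (cls (bank s 15) (reg s 15) a b)]).
Proof.
move=> cs posn Ea aV Eb bV; apply: wp_set; rewrite Ea //; apply: wp_set; rewrite Eb //.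
set s1 := set_reg _ _ _; have c1 : ctx s1 by [].
apply: wp_conseq (wp_hash_table c1) _ => s2 [r2 b2] H; split; [by rewrite r2|by rewrite r2|].
have b15 y : bank s2 15 y = bank s 15 y by rewrite b2.
by move=> k kn; rewrite !r2 // !b15 H ?posn.
Qed.

Definition upd_list (pos : nat -> nat) (i j v old : nat) : nat :=
  if [&& v < n, wit i j v & pos v < pos old] then v else old.

(** The value n means that no witness is known yet. Its rank is n, above all true ranks, so any
    witness replaces it. *)
Definition sound (f : nat -> nat) : Prop :=
  forall i j, i < p -> j < J -> f (i * J + j) = n \/ wit i j (f (i * J + j)).

Definition listed (pos : nat -> nat) (C : nat -> bool) (f : nat -> nat) : Prop :=
  forall i j k, i < p -> j < J -> wit i j k -> C k ->
    (forall k', wit i j k' -> C k' -> k' = k) -> pos (f (i * J + j)) <= pos k.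

Lemma wit_lt i j k : wit i j k -> k < n.
Proof. by case/andP. Qed.

(** The weighted sum has one term, the index k, and k < n is not altered by the modulus. *)
Lemma cval_unique (C : nat -> bool) i j k : wit i j k -> C k -> (forall k', wit i j k' -> C k' -> k' = k) ->
  cval true C i j = k.
Proof.
move=> wk Ck uk; have kn := wit_lt wk; rewrite /cval (bigD1 (Ordinal kn)) //= Ck wk /=.
rewrite big1 ?addn0 ?mul1n; first by rewrite modn_small //; lia.
move=> k' ne; case: andP => // -[c w]; case/eqP: ne; apply: val_inj; exact: uk.
Qed.

Lemma wp_listing s : ctx s -> (forall k, k < n -> bank s 15 k < n) -> sound (bank s 3) ->
  wp listing s (fun s' =>
    [/\ sound (bank s' 3),
        forall i j, i < p -> j < J ->
          bank s 15 (bank s' 3 (i * J + j)) <= bank s 15 (bank s 3 (i * J + j)) &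
        forall al u, al < q -> u < q -> listed (bank s 15) (cls (bank s 15) (reg s 15) al u) (bank s' 3)]).
Proof.
move=> cs posn sd; have q0 := prime_gt0 q_prime.
have nV : n < V by lia.
apply: wp_set => /=; first by lia.
set s0 := set_reg _ _ _; have c0 : ctx s0 by [].
have h14 : reg s 14 = q by case: cs => _ [].
pose pos := bank s 15.
apply: (wp_for (N := q * q) (I := fun c s' => [/\ sound (bank s' 3),
   forall i j, i < p -> j < J -> pos (bank s' 3 (i * J + j)) <= pos (bank s 3 (i * J + j)) &
   forall c', c' < c -> listed pos (cls pos (reg s 15) (c' %/ q) (c' %% q)) (bank s' 3)])) => //.
- by rewrite /= h14.
- move=> c s1 cq h50 fr1 [I1 I2 I3]; have c1 := ctx_frame fr1 isT isT c0; have [r1 b1] := fr1.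
  have cd : c %/ q < q by rewrite ltn_divLR.
  have cm : c %% q < q by rewrite ltn_pmod.
  have qV : q <= V by apply: leq_trans (ltnW qqV); rewrite leq_pmulr.
  apply: wp_seq.
    apply: (@wp_select _ _ (c %/ q) (c %% q)) => //.
    + by move=> k kn; rewrite b1 // posn.
    + by rewrite /= h50 r1 //= h14.
    + by lia.
    + by rewrite /= h50 r1 //= h14.
    + by lia.
  move=> s2 fr2 [h16 h17 rd]; have c2 := ctx_frame fr2 isT isT c1; have [r2 b2] := fr2.
  set C := cls _ _ _ _ in rd.
  have CE k : C k = cls pos (reg s 15) (c %/ q) (c %% q) k by rewrite /C /cls r1 //= !b1.
  have ansn i j : i < p -> j < J -> bank s2 3 (i * J + j) <= n.
    by move=> ip jJ; rewrite b2 //; case: (I1 i j ip jJ) => [->//|/wit_lt/ltnW].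
  apply: wp_conseq (wp_rows_update (A := 3) (w := true) (C := C) (upd := upd_list pos) _ c2 _ rd _) _ => //.
  + by rewrite r2 // r1.
  + move=> s3 i j ip jJ h18 h40 r3 b3 b33 b310.
    have vM : cval true C i j < M by rewrite ltn_pmod //; lia.
    have h0 : reg s3 0 = n by rewrite r3 //; case: c2 => _ [].
    have h10 : reg s3 10 = J by rewrite r3 //; case: c2 => _ [].
    have ha x : bank s3 0 x = ra x by rewrite b3 //; case: c2.
    have hb x : bank s3 1 x = rb x by rewrite b3 //; case: c2.
    have hp x : bank s3 15 x = pos x by rewrite b3 // b2 // b1.
    have e3 : ev s3 e_list = upd_list pos i j (cval true C i j) (bank s2 3 (i * J + j)).
      rewrite /e_list /= h18 h40 h0 h10 b310 b33 !ha !hb !hp /upd_list /wit.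
      set v := cval _ _ _ _; set old := bank s2 3 _.
      have := ra1 (i * n + v); have := rb1 (i * n + (j - v)).
      rewrite addn1 ltnS.
      case: (v < n); rewrite ?mul0n //=; case: (j - v < n); rewrite ?muln0 ?mul0n ?andbF //=;
      case: (v <= j); rewrite ?muln0 ?mul0n ?andbF //=;
      case: (rb _) => [|[|//]] _; case: (ra _) => [|[|//]] _; case: (pos v < _);
      by rewrite /= ?muln0 ?mul0n ?muln1 ?mul1n ?addn0 ?subn0 ?subnn ?mul0n ?add0n ?mul1n.
    split=> //; rewrite e3 /upd_list; case: ifP => [/andP[h _]|_]; first by lia.
    by apply: leq_ltn_trans (ansn i j ip jJ) nV.
  + move=> s3 fr3 E3.
    have new i j : i < p -> j < J -> pos (bank s3 3 (i * J + j)) <= pos (bank s1 3 (i * J + j)).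
      by move=> ip jJ; rewrite E3 // b2 // /upd_list; case: ifP => // /and3P[_ _ /ltnW].
    split=> /=.
    * move=> i j ip jJ; rewrite E3 // /upd_list; case: ifP => [/and3P[_ h _]|_]; first by right.
      by rewrite b2 //; apply: I1.
    * by move=> i j ip jJ; apply: leq_trans (new i j ip jJ) (I2 i j ip jJ).
    * move=> c'; rewrite ltnS leq_eqVlt => /orP[/eqP->|cc] i j k ip jJ wk Ck uk; last first.
        exact: leq_trans (new i j ip jJ) (I3 c' cc i j k ip jJ wk Ck uk).
      rewrite E3 // (cval_unique wk) ?CE //; last by move=> k' wk'; rewrite CE; apply: uk.
      rewrite /upd_list (wit_lt wk) wk /=; case: ifP => // h.
      by rewrite leqNgt h.
- move=> s' fr [I1 I2 I3]; split=> // al u alq uq.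
  have := I3 (al * q + u); rewrite divnMDl // modnMDl (divn_small uq) (modn_small uq) addn0; apply.
  by have : al.+1 * q <= q * q; [rewrite leq_mul2r alq orbT|rewrite mulSn; lia].
Qed.

Definition hits (f : nat -> nat) (C : nat -> bool) : nat :=
  \sum_(i < p) \sum_(j < J) f (i * J + j) * (0 < cval false C i j).

Definition binary (f : nat -> nat) : Prop :=
  forall i j, i < p -> j < J -> f (i * J + j) <= 1.

Lemma sum_le (a : nat) (F : nat -> nat) c : (forall i, i < a -> F i <= c) -> \sum_(i < a) F i <= a * c.
Proof.
move=> Fc; apply: leq_trans (_ : \sum_(i < a) c <= _); first by apply: leq_sum => i _; apply: Fc.
by rewrite sum_nat_const card_ord.
Qed.

Lemma wp_count_hits C s : ctx s -> reg s 19 = 0 -> ready s C -> binary (bank s 17) ->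
  reg s 32 = 0 -> wp count_hits s (fun s' => reg s' 32 = hits (bank s 17) C).
Proof.
move=> cs h19 rs bin h32; have JN := J_le; have sV := size_V; have sZ := size_Z.
have p1 : reg s 1 = p by case: cs => _ [].
pose h i j := bank s 17 (i * J + j) * (0 < cval false C i j).
have h1 i j : i < p -> j < J -> h i j <= 1.
  by move=> ip jJ; have := bin i j ip jJ; rewrite /h; case: (0 < _); lia.
have hi i j : i < p -> j <= J -> \sum_(j' < j) h i j' <= J.
  move=> ip jJ; apply: leq_trans (sum_le (a := j) (F := h i) (c := 1) _) _; last by lia.
  by move=> j' jj; apply: h1 => //; lia.
have hp i : i <= p -> \sum_(i' < i) \sum_(j < J) h i' j <= i * J.
  move=> ip; apply: (sum_le (a := i) (F := fun i' => \sum_(j < J) h i' j)) => i' ii.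
  by apply: hi => //; lia.
apply: (wp_for (N := p) (I := fun i s' => reg s' 32 = \sum_(i' < i) \sum_(j < J) h i' j)) => //.
- by rewrite big_ord0.
- move=> i s1 ip h18 fr1 I1; have c1 := ctx_frame fr1 isT isT cs; have [r1 b1] := fr1.
  apply: (wp_seq (P := fun s2 => forall j, j < 2 ^ k0 -> bank s2 10 j = cval false C i j)).
    apply: (wp_class_conv (w := false)) => //; first by rewrite r1.
    by move=> k kn; rewrite -rs // !r1 // !b1.
  move=> s2 fr2 E2; have c2 := ctx_frame fr2 isT isT c1; have [r2 b2] := fr2.
  have h10 : reg s2 10 = J by case: c2 => _ [].
  apply: (wp_for (N := J) (I := fun j s' => reg s' 32 = \sum_(i' < i) \sum_(j < J) h i' j + \sum_(j' < j) h i j')) => //.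
  + lia.
  + by rewrite /iters; lia.
  + by rewrite big_ord0 addn0 /= r2.
  + move=> j s3 jJ h40 fr3 I3; have [r3 b3] := fr3.
    have E : ev s3 (r[32] + e_out 17 * (#0 < b[10, r[40]]))%X =
        \sum_(i' < i) \sum_(j < J) h i' j + \sum_(j' < j.+1) h i j'.
      rewrite /= I3 h40 !b3 // E2; last by lia.
      rewrite !r3 // h10 !r2 // h18 b2 // b1 //.
      by rewrite big_ord_recr /= addnA.
    apply/wp_conseq; last by move=> s' _; apply.
    split; rewrite E //.
    have := hp i (ltnW ip); have := hi i j.+1 ip jJ.
    by have : i.+1 * J <= p * J; [rewrite leq_mul2r ip orbT|rewrite mulSn; lia].
  + by move=> s3 fr3 I3; rewrite /= I3 big_ord_recr.
Qed.

Lemma wp_best_class pos m s : ctx s -> reg s 19 = 0 -> bank s 15 =1 pos -> (forall k, k < n -> pos k < n) ->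
  reg s 15 = m -> binary (bank s 17) ->
  wp best_class s (fun s' => [/\ reg s' 30 < q, reg s' 31 < q &
    forall al u, al < q -> u < q ->
      hits (bank s 17) (cls pos m al u) <= hits (bank s 17) (cls pos m (reg s' 30) (reg s' 31))]).
Proof.
move=> cs h19 hpos posn hm bin; have q0 := prime_gt0 q_prime.
have h14 : reg s 14 = q by case: cs => _ [].
have qV : q <= V by apply: leq_trans (ltnW qqV); rewrite leq_pmulr.
apply: wp_set => /=; first by lia. apply: wp_set => /=; first by lia.
apply: wp_set => /=; first by lia.
set s0 := set_reg _ _ _; have c0 : ctx s0 by [].
pose H c := hits (bank s 17) (cls pos m (c %/ q) (c %% q)).
(* Before the first class register 29 is 0 without being the score of registers 30 and 31, hence the
   separate clauses for c = 0 and c > 0. *)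
apply: (wp_for (N := q * q) (I := fun c s' => [/\ reg s' 30 < q, reg s' 31 < q,
   (forall c', c' < c -> H c' <= reg s' 29), c = 0 -> reg s' 29 = 0 &
   0 < c -> reg s' 29 = hits (bank s 17) (cls pos m (reg s' 30) (reg s' 31))])) => //.
- by rewrite /= h14.
- move=> c s1 cq h50 fr1 [I1 I2 I3 I4 I5]; have c1 := ctx_frame fr1 isT isT c0; have [r1 b1] := fr1.
  have cd : c %/ q < q by rewrite ltn_divLR.
  have cm : c %% q < q by rewrite ltn_pmod.
  apply: wp_seq.
    apply: (@wp_select _ _ (c %/ q) (c %% q)) => //.
    + by move=> k kn; rewrite b1 //= hpos posn.
    + by rewrite /= h50 r1 //= h14.
    + by lia.
    + by rewrite /= h50 r1 //= h14.
    + by lia.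
  move=> s2 fr2 [h16 h17 rd]; have c2 := ctx_frame fr2 isT isT c1; have [r2 b2] := fr2.
  apply: wp_set => /=; first by lia.
  set s3 := set_reg _ _ _; have c3 : ctx s3 by [].
  have E17 y : bank s3 17 y = bank s 17 y by rewrite /s3 /= b2 // b1.
  apply: wp_seq.
    apply: (@wp_count_hits (cls pos m (c %/ q) (c %% q)) s3) => //.
    + by rewrite /s3 /= r2 // r1.
    + by move=> k kn; rewrite [LHS]rd // /cls r1 //= hm b1 //= hpos.
    + by move=> i j ip jJ; rewrite E17; apply: bin.
  move=> s4 fr4 h32; have [r4 b4] := fr4.
  have {}h32 : reg s4 32 = H c.
    by rewrite h32; apply: eq_bigr => i _; apply: eq_bigr => j _; rewrite E17.
  have r29 : reg s4 29 = reg s1 29 by rewrite r4 //= r2.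
  have r30 : reg s4 30 = reg s1 30 by rewrite r4 //= r2.
  have r31 : reg s4 31 = reg s1 31 by rewrite r4 //= r2.
  have r16 : reg s4 16 = c %/ q by rewrite r4.
  have r17 : reg s4 17 = c %% q by rewrite r4.
  have HV : H c < V.
    apply: leq_ltn_trans pV.
    apply: (@sum_le p (fun i => \sum_(j < J) bank s 17 (i * J + j) * (0 < cval false _ i j))) => i ip.
    rewrite -[X in _ <= X]muln1.
    apply: (@sum_le J (fun j => bank s 17 (i * J + j) * (0 < cval false _ i j))) => j jJ.
    by have := bin i j ip jJ; case: (0 < _); lia.
  have r30' : reg s4 30 < q by rewrite r30.
  have r31' : reg s4 31 < q by rewrite r31.
  apply: wp_if => /=; rewrite r29 h32 addn1 ltnS; case: (leqP (reg s1 29) (H c)) => // hc _.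
    apply: wp_set; rewrite /= ?h32 //; apply: wp_set; rewrite /= ?r16; first by lia.
    split; rewrite /= ?r17; first by lia.
    split=> //= c'; rewrite ltnS leq_eqVlt => /orP[/eqP-> //|cc].
    exact: leq_trans (I3 c' cc) hc.
  split=> //=; rewrite r29 ?r30 ?r31.
  + move=> c'; rewrite ltnS leq_eqVlt => /orP[/eqP-> |cc]; [exact: ltnW|exact: I3].
  + by move=> _; apply: I5; case: (posnP c) => // /I4; lia.
- move=> s' fr [I1 I2 I3 _ I5]; split=> // al u alq uq.
  have lt : al * q + u < q * q.
    by have : al.+1 * q <= q * q; [rewrite leq_mul2r alq orbT|rewrite mulSn; lia].
  have := I3 _ lt; rewrite /H divnMDl // modnMDl (divn_small uq) (modn_small uq) addn0.
  by rewrite I5 //; lia.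
Qed.

Section Rounds.
Variables (pos : nat -> nat) (m G : nat).
Hypotheses (pos_lt : forall k, k < n -> pos k < n)
  (pos_inj : {in [pred k | k < n] &, injective pos}).

Definition cnt (i j : nat) : nat := \sum_(k < n) ((pos k < m) && wit i j k).

Lemma cval_false (C : nat -> bool) i j : cval false C i j = \sum_(k < n) (C k && wit i j k).
Proof.
rewrite /cval modn_small; first by apply: eq_bigr => k _; rewrite muln1.
apply: leq_ltn_trans (sum_le (F := fun k => (C k && wit i j k) * 1) (c := 1) _) _; last by lia.
by move=> k _; case: (_ && _).
Qed.

Lemma cval_gt0 (C : nat -> bool) i j :
  (0 < cval false C i j) = [exists k : 'I_n, C k && wit i j k].
Proof.
rewrite cval_false lt0n sum_nat_eq0 negb_forall; apply: eq_existsb => k.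
by rewrite /= eqb0 negbK.
Qed.

Definition total (f : nat -> nat) : nat := \sum_(i < p) \sum_(j < J) f (i * J + j).

(** The averaging argument with pairs (row, index) as outputs. Ranks have at most k0 digits in base
    q, because n <= 2^k0 <= q^k0. *)
Lemma greedy_best f : binary f -> 2 * (K * k0) <= q ->
  (forall i j, i < p -> j < J -> f (i * J + j) != 0 -> K < cnt i j) ->
  exists al u, [/\ al < q, u < q & K * total f <= 2 * q * hits f (cls pos m al u)].
Proof.
move=> bin Kq fK; have q1 := prime_gt1 q_prime.
pose act (o : 'I_p * 'I_J) := f (o.1 * J + o.2) != 0.
pose W (o : 'I_p * 'I_J) := [set k : 'I_n | (pos k < m) && wit o.1 o.2 k].
have fact (o : 'I_p * 'I_J) : f (o.1 * J + o.2) = act o.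
  by rewrite /act; have := bin _ _ (ltn_ord o.1) (ltn_ord o.2); case: (f _) => [|[|]].
have rl k : k < n -> pos k < q ^ k0.
  move=> kn; apply: leq_trans (pos_lt kn) _.
  have : 2 ^ k0 <= q ^ k0 by rewrite leq_exp2r // k0_gt0.
  by lia.
have [o ao|al [u H]] := @greedy_class q k0 n pos q_prime rl pos_inj _ act W K _ Kq.
  have := fK o.1 o.2 (ltn_ord _) (ltn_ord _) ao; rewrite /cnt => /ltnW h.
  by apply: leq_trans h _; rewrite /W -sum1dep_card [X in _ <= X]big_mkcond; apply: leq_sum => k _; case: (_ && _).
exists al, u; split=> //.
have -> : total f = #|act|.
  rewrite -sum1_card [RHS]big_mkcond /total pair_big /=; apply: eq_bigr => o _.
  by rewrite fact; change (o \in act) with (act o); case: (act o).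
apply: leq_trans H _; rewrite leq_mul2l; apply/orP; right.
rewrite /hits pair_big /= [X in X <= _]big_mkcond; apply: leq_sum => o _; rewrite fact.
case: (act o) => //; rewrite mul1n cval_gt0 /hit.
case: existsP => // -[x /andP[]]; rewrite inE => /andP[xm wx] /eqP hx.
by case: existsP => // -[]; exists x; rewrite /cls xm wx hx eqxx.
Qed.

(** [f] flags the active outputs and [mk] the marked ranks. The program does not keep the earlier
    numbers of active outputs; the sequence U records them for [greedy_decay]. *)
Definition rounds_inv (t : nat) (f mk : nat -> nat) : Prop :=
  [/\ binary f,
      exists U : nat -> nat, [/\ U t = total f, U 0 <= p * J &
         forall t', t' < t -> K * U t' <= 2 * q * (U t' - U t'.+1) /\ U t'.+1 <= U t'],
      forall i j, i < p -> j < J -> f (i * J + j) != 0 -> K < cnt i j,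
      forall i j, i < p -> j < J -> K < cnt i j -> f (i * J + j) = 0 ->
        exists k, [/\ wit i j k, pos k < m & mk (pos k) != 0] &
      (forall x, x < m -> mk x <= 1) /\ \sum_(x < m) mk x <= t * (m %/ q + 1)].

Lemma rounds_start (f mk : nat -> nat) :
  (forall i j, i < p -> j < J -> f (i * J + j) = (K < cnt i j)) ->
  (forall x, x < m -> mk x = 0) -> rounds_inv 0 f mk.
Proof.
move=> fE mk0; have bin : binary f by move=> i j ip jJ; rewrite fE ?leq_b1.
split=> //.
- exists (fun _ => total f); split=> //.
  apply: (@sum_le p (fun i => \sum_(j < J) f (i * J + j))) => i ip.
  rewrite -[X in _ <= X]muln1.
  by apply: (@sum_le J (fun j => f (i * J + j))) => j jJ; apply: bin.
- by move=> i j ip jJ; rewrite fE // eqb0 negbK.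
- by move=> i j ip jJ h; rewrite fE // h.
- by split=> [x /mk0->//|]; rewrite big1 // => x _; rewrite mk0.
Qed.

Lemma rounds_step t f mk f' mk' al u : 2 * (K * k0) <= q -> al < q -> u < q ->
  rounds_inv t f mk ->
  (forall al' u', al' < q -> u' < q -> hits f (cls pos m al' u') <= hits f (cls pos m al u)) ->
  (forall i j, i < p -> j < J -> f' (i * J + j) = f (i * J + j) * (cval false (cls pos m al u) i j == 0)) ->
  (forall x, x < m -> mk' x = 1 - (1 - mk x) * (1 - (hash q al x == u))) ->
  rounds_inv t.+1 f' mk'.
Proof.
move=> Kq alq uq [bin [U [Ut U0 US]] R2 R3 [R4 R5]] best fE mE.
have E : total f = total f' + hits f (cls pos m al u).
  rewrite /total /hits -big_split; apply: eq_bigr => i _; rewrite -big_split.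
  by apply: eq_bigr => j _; rewrite fE //= -mulnDr lt0n; case: eqP; rewrite muln1.
split.
- by move=> i j ip jJ; rewrite fE //; have := bin i j ip jJ; case: eqP; lia.
- exists (fun t' => if t' <= t then U t' else total f'); split=> //; first by rewrite ltnn.
  move=> t'; rewrite ltnS => tt; rewrite tt; case: (ltnP t' t) => h; first exact: US.
  have -> : t' = t by lia.
  have [al' [u' [al'q u'q H]]] := greedy_best bin Kq R2.
  rewrite Ut {2 3}E addKn leq_addr; split=> //.
  by apply: leq_trans H _; rewrite leq_mul2l best ?orbT.
- by move=> i j ip jJ; rewrite fE // muln_eq0 negb_or => /andP[/(R2 _ _ ip jJ)].
- move=> i j ip jJ cK; rewrite fE // => /eqP; rewrite muln_eq0 => /orP[/eqP f0|].
    have [k [w km mk0]] := R3 i j ip jJ cK f0; exists k; split=> //.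
    by rewrite mE //; move: mk0 (R4 _ km); case: (mk _) => [|[|]].
  rewrite eqb0 -lt0n cval_gt0 => /existsP[k /andP[/andP[km hk] w]].
  by exists k; split=> //; rewrite mE // hk subnn muln0.
- split=> [x xm|]; first by rewrite mE //; lia.
  rewrite mulSn addnC; apply: leq_trans (leq_add R5 (hash_class_card al u m (prime_gt0 q_prime))).
  rewrite -big_split; apply: leq_sum => x _; rewrite mE //=.
  by have := R4 x (ltn_ord x); case: eqP; lia.
Qed.

Lemma rounds_end f mk : K = 16 * G -> 0 < G -> K <= q -> 64 <= q -> p * J < 2 ^ G ->
  rounds_inv (q %/ 4) f mk ->
  forall i j, i < p -> j < J -> K < cnt i j -> exists k, [/\ wit i j k, pos k < m & mk (pos k) != 0].
Proof.
move=> KG G0 Kq q64 pJ [bin [U [Ut U0 US]] R2 R3 _] i j ip jJ cK; apply: R3 => //.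
have : U (q %/ 4) = 0.
  apply: (greedy_decay (G := G)) => //; [by rewrite -KG| |exact: leq_ltn_trans U0 pJ].
  by move=> t tq; rewrite -KG; apply: US.
rewrite Ut /total => /eqP; rewrite sum_nat_eq0 => /forallP/(_ (Ordinal ip)) /=.
by rewrite sum_nat_eq0 => /forallP/(_ (Ordinal jJ)) /= /eqP.
Qed.

End Rounds.

Section Shrink.
Variables (pos : nat -> nat) (m G : nat).
Hypotheses (pos_lt : forall k, k < n -> pos k < n)
  (pos_inj : {in [pred k | k < n] &, injective pos}) (m_n : m <= n).
Hypotheses (KG : K = 16 * G) (G_gt0 : 0 < G) (Kq : 2 * (K * k0) <= q) (q64 : 64 <= q)
  (pJG : p * J < 2 ^ G).

Definition shrink_ctx (s : state) : Prop :=
  [/\ ctx s, reg s 15 = m & bank s 15 =1 pos].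

Lemma shrink_ctx_frame a s s' : frame a s s' ->
  avoids [:: 0; 1; 2; 3; 4; 5; 6; 10; 12; 14; 15] (mregs a) ->
  avoids [:: 0; 1; 14; 15] (mbanks a) -> shrink_ctx s -> shrink_ctx s'.
Proof.
move=> fr /allP dr /allP db [cs hm hp]; have [r bb] := fr; split.
- apply: ctx_frame fr _ _ cs; apply/allP => x hx; [apply: dr|apply: db];
  by move: hx; rewrite !inE; lia.
- by rewrite r // dr.
- by move=> x; rewrite bb // db.
Qed.

Lemma wp_clear A s (Q : state -> Prop) : ctx s ->
  (forall s', frame (clear A) s s' -> (forall x, x < n -> bank s' A x = 0) -> Q s') ->
  wp (clear A) s Q.
Proof.
move=> [_ [h0 _ _ _ _] _ _] H; have sZ := size_Z.
apply: (wp_fill (N := n) (val := fun _ => 0)) => //; [lia|by rewrite /iters; lia| |].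
  by move=> i s' _ _ _ _ _; split=> //; lia.
by move=> s' fr E _; apply: H.
Qed.

Lemma wp_init_active s : shrink_ctx s -> wp init_active s (fun s' =>
  [/\ reg s' 19 = 0, forall x, x < n -> bank s' 18 x = 0 &
      forall i j, i < p -> j < J -> bank s' 17 (i * J + j) = (K < cnt pos m i j)]).
Proof.
move=> cs; have [c0 _ _] := cs.
apply: wp_seq (wp_clear c0 (fun s' _ H => H)) _ => s1 fr1 E1.
have cs1 := shrink_ctx_frame fr1 isT isT cs; have [c1 _ _] := cs1.
apply: wp_seq (wp_clear c1 (fun s' _ H => H)) _ => s2 fr2 E2.
have cs2 := shrink_ctx_frame fr2 isT isT cs1; have [_ b2] := fr2.
apply: wp_set => /=; first by lia. apply: wp_set => /=; first by lia.
set s3 := set_reg _ _ _; have cs3 : shrink_ctx s3 by [].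
have [c3 hm hp] := cs3.
have h12 : reg s3 12 = K by case: c3 => _ [].
apply: wp_conseq (wp_rows_update (A := 17) (w := false) (C := fun k => pos k < m)
  (upd := fun i j v _ => (K < v) : nat) _ c3 _ _ _) _ => //.
- by move=> k kn; rewrite hm !hp /= E2 ?pos_lt // andbT.
- move=> s4 i j ip jJ h18 h40 r4 b4 _ h10; rewrite /= h40 h10 r4 // h12.
  by split=> //; case: (K < _); lia.
- move=> s4 fr4 E4; have [r4 b4] := fr4; split.
  + by rewrite r4.
  + by move=> x xn; rewrite b4 //= b2 // E1.
  + by move=> i j ip jJ; rewrite E4 // cval_false.
Qed.

Lemma wp_round t s : shrink_ctx s -> reg s 19 = 0 -> rounds_inv pos m t (bank s 17) (bank s 18) ->
  wp round s (fun s' => reg s' 19 = 0 /\ rounds_inv pos m t.+1 (bank s' 17) (bank s' 18)).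
Proof.
move=> cs h19 I; have [c0 hm hp] := cs; have [bin _ _ _ [mk1 _]] := I.
have qV : q <= V by apply: leq_trans (ltnW qqV); rewrite leq_pmulr // prime_gt0.
have sZ := size_Z; have q0 := prime_gt0 q_prime.
apply: wp_seq (wp_best_class c0 h19 hp pos_lt hm bin) _ => s1 fr1 [alq uq best].
have cs1 := shrink_ctx_frame fr1 isT isT cs; have [c1 hm1 hp1] := cs1; have [r1 b1] := fr1.
set al := reg s1 30 in alq best; set u := reg s1 31 in uq best.
apply: (wp_seq (P := fun s2 => [/\ reg s2 17 = u, ready s2 (cls pos m al u) &
    forall x, x < n -> bank s2 16 x = hash q al x])).
  apply: wp_set; first by rewrite /=; lia. apply: wp_set; first by rewrite /=; lia.
  set s1' := set_reg _ _ _; have c1' : ctx s1' by [].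
  apply: wp_conseq (wp_hash_table c1') _ => s2 [r2 b2] H; split; [by rewrite r2| |by []].
  move=> k kn; have b15 y : bank s2 15 y = pos y by rewrite b2 ?hp1.
  by rewrite !r2 // !b15 H ?pos_lt //= hm1.
move=> s2 fr2 [h17 rd H2]; have cs2 := shrink_ctx_frame fr2 isT isT cs1.
have [c2 hm2 hp2] := cs2; have [r2 b2] := fr2.
pose mk' x := 1 - (1 - bank s 18 x) * (1 - (hash q al x == u)).
apply: (wp_seq (P := fun s3 => forall x, x < m -> bank s3 18 x = mk' x)).
  apply: (wp_fill (N := m) (val := mk')) => //; [lia|by rewrite /iters; lia|].
  move=> x s3 xm h40 fr3 _ H; have [r3 b3] := fr3; split; last by rewrite /mk'; lia.
  have e16 : bank s3 16 x = hash q al x by rewrite b3 // H2 //; lia.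
  by rewrite /= h40 r3 // h17 e16 H // b2 // b1.
move=> s3 fr3 H3; have cs3 := shrink_ctx_frame fr3 isT isT cs2.
have [c3 hm3 hp3] := cs3; have [r3 b3] := fr3.
have E17 y : bank s3 17 y = bank s 17 y by rewrite b3 // b2 // b1.
apply: wp_conseq (wp_rows_update (A := 17) (w := false) (C := cls pos m al u)
  (upd := fun i j v old => old * (v == 0)) _ c3 _ _ _) _ => //.
- by rewrite r3 // r2 // r1.
- move=> k kn; rewrite -rd // !r3 // !b3 //.
- move=> s4 i j ip jJ h18 h40 r4 b4 h17' h10.
  have hJ : reg s4 10 = J by rewrite r4 //; case: c3 => _ [].
  rewrite /= h18 h40 hJ h17' h10; split=> //.
  by have := bin i j ip jJ; rewrite E17; case: (_ == 0); lia.
- move=> s4 fr4 E4; have [r4 b4] := fr4; split; first by rewrite r4 // r3 // r2 // r1.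
  apply: (rounds_step (al := al) (u := u) pos_lt pos_inj Kq alq uq I best).
  + by move=> i j ip jJ; rewrite E4 // E17.
  + by move=> x xm; rewrite b4 // H3.
Qed.

Lemma wp_renumber mk s : shrink_ctx s -> bank s 18 =1 mk -> (forall x, x < m -> mk x <= 1) ->
  wp renumber s (fun s' => [/\ forall k, k < n -> bank s' 15 k = new_rank mk m (pos k),
    bank s' 15 n = pos n & reg s' 28 = marked mk m]).
Proof.
move=> cs hmk mk1; have [c0 hm hp] := cs; have [_ [h0 _ _ _ _] _ _] := c0.
have sZ := size_Z; have sV := size_V.
have le x : x <= m -> marked mk x <= x by apply: marked_le.
apply: (wp_seq (P := fun s1 => forall x, x <= m -> bank s1 19 x = marked mk x)).
  apply: (wp_fill (N := m.+1) (val := marked mk)) => //; [by rewrite /= hm addn1|lia|by rewrite /iters; lia|].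
  move=> x s1 xm h40 [r1 b1] H _; split; last by have := le x xm; lia.
  have e18 y : bank s1 18 y = mk y by rewrite b1 // hmk.
  rewrite /= h40 e18; case: x xm {h40} H => [|x] xm H; first by rewrite /marked big_ord0.
  by rewrite subn1 H // mul1n markedS.
move=> s1 fr1 E1; have cs1 := shrink_ctx_frame fr1 isT isT cs.
have [c1 hm1 hp1] := cs1; have [r1 b1] := fr1.
apply: (wp_seq (P := fun s2 => (forall k, k < n -> bank s2 15 k = new_rank mk m (pos k)) /\
    bank s2 15 n = pos n)).
  apply: (wp_fill (N := n) (val := fun k => new_rank mk m (pos k))) => //; last first.
  - by move=> s2 _ H1 H2; split=> //; rewrite H2.
  - move=> k s2 kn h40 fr2 H1 H2; have [r2 b2] := fr2; split; last first.
    have := new_rank_lt mk1 (pos k); rewrite /new_rank; case: (ltnP (pos k) m) => h.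
      by move=> h'; apply: leq_ltn_trans (ltnW h') _; lia.
    by move=> _; have := pos_lt kn; lia.
  have e18 y : bank s2 18 y = mk y by rewrite b2 // b1 // hmk.
  have e19 y : y <= m -> bank s2 19 y = marked mk y by move=> ym; rewrite b2 // E1.
  rewrite /= h40 r2 // H2 // hp1 hm1 e18.
  rewrite /new_rank; case: (ltnP (pos k) m) => h; last by rewrite mul0n add0n mul1n.
  rewrite mul1n subnn mul0n addn0 !e19 ?(ltnW h) //.
  by have := mk1 _ h; case: (mk _) => [|[|//]] _ /=; rewrite ?mul0n ?mul1n ?add0n ?addn0.
  - by rewrite /iters; lia.
  - by lia.
  - by rewrite /= r1.
move=> s2 fr2 [E2 E2n]; have [r2 b2] := fr2.
have E : ev s2 b[19, r[15]] = marked mk m by rewrite /= r2 // hm1 b2 // E1.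
split; rewrite E; first by have := le m (leqnn _); lia.
by split.
Qed.

Lemma wp_shrink s : shrink_ctx s -> wp shrink s (fun s' => exists mk,
  [/\ forall x, x < m -> mk x <= 1,
      [/\ forall k, k < n -> bank s' 15 k = new_rank mk m (pos k), bank s' 15 n = pos n &
          reg s' 28 = marked mk m],
      2 * marked mk m <= m &
      q <= m -> forall i j, i < p -> j < J -> K < cnt pos m i j ->
        exists k, [/\ wit i j k, pos k < m & mk (pos k) != 0]]).
Proof.
move=> cs; have [c0 hm hp] := cs; have q0 := prime_gt0 q_prime.
have h14 : reg s 14 = q by case: c0 => _ [].
pose R := q %/ 4 * (1 - (m < q)).
have Rq : R <= q.
  by rewrite /R; have := leq_div q 4; case: (m < q); rewrite ?muln0 ?muln1.
have qV : q <= q * q by rewrite leq_pmulr.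
apply: wp_set; rewrite /= h14 hm -/R; first by lia.
set s0 := set_reg _ _ _; have cs0 : shrink_ctx s0 by [].
apply: wp_seq (wp_init_active cs0) _ => s1 fr1 [h19 E18 E17].
have cs1 := shrink_ctx_frame fr1 isT isT cs0; have [r1 b1] := fr1.
have h27 : reg s1 27 = R by rewrite r1.
apply: (wp_seq (P := fun s2 => reg s2 19 = 0 /\ rounds_inv pos m R (bank s2 17) (bank s2 18))).
  apply: (wp_for (N := R) (I := fun t s2 => reg s2 19 = 0 /\ rounds_inv pos m t (bank s2 17) (bank s2 18))) => //.
  - by lia.
  - by rewrite /iters; lia.
  - split; first exact: h19.
    apply: rounds_start; [exact: E17|move=> x xm; apply: E18; lia].
  - move=> t s2 tR h52 fr2 [h19' I2]; have cs2 := shrink_ctx_frame fr2 isT isT cs1.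
    exact: wp_conseq (wp_round cs2 h19' I2) _.
move=> s2 fr2 [_ I2]; have cs2 := shrink_ctx_frame fr2 isT isT cs1.
have [_ _ _ _ [mk1 mkS]] := I2.
apply: wp_conseq (wp_renumber (mk := bank s2 18) cs2 _ mk1) _ => //.
move=> s3 _ H1; exists (bank s2 18); split=> //.
  (* For q <= m, the q / 4 rounds mark at most (q / 4) (m / q + 1) <= m / 4 + m / 4 ranks. *)
  move: mkS; rewrite -/(marked _ _) /R; case: (ltnP m q) => mq /=; first by rewrite subnn muln0; lia.
  rewrite subn0 muln1; have := leq_trunc_div m q; have := leq_trunc_div q 4.
  move: (q %/ 4) (m %/ q) => a c h1 h2 h3; apply: leq_trans (leq_mul (leqnn 2) h3) _.
  have : a * 4 * c <= q * c by rewrite leq_mul2r h1 orbT.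
  by rewrite mulnDr muln1; lia.
move=> qm; move: I2; rewrite /R ltnNge qm muln1 => I2.
by apply: (rounds_end KG G_gt0 _ q64 pJG I2); have := k0_gt0; nia.
Qed.

End Shrink.

Section Level.
Variable G : nat.
Hypotheses (KG : K = 16 * G) (G_gt0 : 0 < G) (Kq : 2 * (K * k0) <= q) (q64 : 64 <= q)
  (pJG : p * J < 2 ^ G).

(** Later levels only permute ranks below m, so an output without witnesses there is final. At m = 0
    every output is. *)
Definition settled (pos : nat -> nat) (m : nat) (f : nat -> nat) : Prop :=
  forall i j k, i < p -> j < J -> wit i j k -> (forall k', wit i j k' -> m <= pos k') ->
    pos (f (i * J + j)) <= pos k.

Definition level_inv (l : nat) (s : state) : Prop :=
  [/\ reg s 15 * 2 ^ l <= n,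
      [/\ forall k, k < n -> bank s 15 k < n, {in [pred k | k < n] &, injective (bank s 15)} &
          bank s 15 n = n],
      sound (bank s 3) & settled (bank s 15) (reg s 15) (bank s 3)].

Lemma hash_small al x : x < q -> hash q al x = x.
Proof.
move=> xq; have q1 := prime_gt1 q_prime.
by rewrite (@hashE q al x 1) ?expn1 // big_ord1 expn0 divn1 muln1 !modn_small.
Qed.

(** When q <= m the output has at most K witnesses in the prefix, few enough for the union bound.
    When m < q the hash is the identity on the prefix, and [al = 0] serves. *)
Lemma wit_isolated (pos : nat -> nat) m i j k :
  (forall k, k < n -> pos k < n) -> {in [pred k | k < n] &, injective pos} ->
  (q <= m -> cnt pos m i j <= K) -> wit i j k -> pos k < m ->
  exists al u, [/\ al < q, u < q, cls pos m al u k &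
    forall k', wit i j k' -> cls pos m al u k' -> k' = k].
Proof.
move=> pos_lt pos_inj cK wk km; have q0 := prime_gt0 q_prime; have q1 := prime_gt1 q_prime.
suff [al alq H] : exists2 al, al < q & forall k', wit i j k' -> pos k' < m ->
    hash q al (pos k') = hash q al (pos k) -> k' = k.
  exists al, (hash q al (pos k)); split=> //; first exact: hash_lt.
    by rewrite /cls km eqxx.
  by move=> k' wk' /andP[km' /eqP]; apply: H.
have kn := wit_lt wk; case: (leqP q m) => [qm|mq]; last first.
  exists 0 => // k' wk' km'; rewrite !hash_small //; try lia.
  by apply: pos_inj; rewrite inE ?kn ?(wit_lt wk').
pose W := [set k : 'I_n | (pos k < m) && wit i j k].
have WK : #|W| <= K.
  apply: leq_trans (cK qm); rewrite /W -sum1dep_card big_mkcond; apply: leq_sum => x _.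
  by case: (_ && _).
have Wq : 2 * (#|W| * k0) <= q by apply: leq_trans Kq; rewrite !leq_mul2l leq_mul2r WK orbT.
have rl x : x < n -> pos x < q ^ k0.
  move=> xn; apply: leq_trans (pos_lt _ xn) _.
  have : 2 ^ k0 <= q ^ k0 by rewrite leq_exp2r // k0_gt0.
  by lia.
have := isolated_many q_prime rl pos_inj (Ordinal kn) Wq; set A := [set al | _] => qA.
have /card_gt0P[al] : 0 < #|A| by lia.
rewrite inE => /forallP iso; exists al => // k' wk' km' E.
have := iso (Ordinal (wit_lt wk')); rewrite inE km' wk' /= E eqxx /= => /eqP.
by move/(congr1 val).
Qed.

Lemma wp_level l s : ctx s -> level_inv l s -> wp level s (level_inv l.+1).
Proof.
move=> c0 [ml [pos_lt pos_inj posn] sd st].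
set m := reg s 15 in ml st *; set pos := bank s 15 in pos_lt pos_inj posn st.
have mn : m <= n by apply: leq_trans ml; rewrite leq_pmulr // expn_gt0.
apply: wp_seq.
  by apply: (@wp_shrink pos m G) => //; split.
move=> s1 fr1 [mk [mk1 [E15 En h28] mm hit]]; have c1 := ctx_frame fr1 isT isT c0.
have [r1 b1] := fr1.
have hm : reg s1 15 = m by rewrite r1.
have p1n k : k < n -> bank s1 15 k < n.
  move=> kn; rewrite E15 // /new_rank; have := new_rank_lt mk1 (pos k); rewrite /new_rank.
  by case: (ltnP (pos k) m) => h h'; [lia|apply: pos_lt].
have p1i : {in [pred k | k < n] &, injective (bank s1 15)}.
  move=> x y xn yn; rewrite !E15 // => /(new_rank_inj mk1); exact: pos_inj.
have sd1 : sound (bank s1 3) by move=> i j ip jJ; rewrite b1 //; apply: sd.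
apply: wp_seq (wp_listing c1 p1n sd1) _ => s2 fr2 [sd2 mono lst].
have [r2 b2] := fr2.
have E : ev s2 r[28] = marked mk m by rewrite /= r2.
have mkm : marked mk m <= m by lia.
split; rewrite E; first by lia.
have B15 k : bank (set_reg s2 15 (marked mk m)) 15 k = bank s1 15 k by rewrite /= b2.
have B3 k : bank (set_reg s2 15 (marked mk m)) 3 k = bank s2 3 k by [].
split.
- rewrite /= expnS mulnA [_ * 2]mulnC; apply: leq_trans ml; exact: leq_mul.
- split=> [k kn|x y xn yn|]; rewrite !B15 ?p1n //; [exact: p1i|by rewrite En].
- exact: sd2.
move=> i j k ip jJ wk far; rewrite !B15 B3.
have lt1 k' : k' < n -> (bank s1 15 k' < m) = (pos k' < m).
  by move=> kn; rewrite E15 // new_rank_lt.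
(* No witness lies in the new prefix. If some lie in the old one, they are at most K when q <= m,
   since the greedy cover would otherwise have hit the output; the listing has met all of them in
   isolation, and witnesses outside the old prefix come later. *)
have [|none] := boolP [exists k' : 'I_n, wit i j k' && (pos k' < m)].
  case/existsP=> k0' /andP[wk0 km0].
  have cK : q <= m -> cnt (bank s1 15) m i j <= K.
    move=> qm; rewrite leqNgt; apply/negP => h.
    have h' : K < cnt pos m i j.
      move: h; rewrite /cnt; under eq_bigr => x _ do rewrite lt1 //.
      by [].
    have [k1 [wk1 km1 mk1']] := hit qm i j ip jJ h'.
    have := far k1 wk1; rewrite B15 /= E15 ?(wit_lt wk1) //.
    by rewrite leqNgt new_rank_marked // km1 mk1'.
  have near k1 : wit i j k1 -> pos k1 < m -> bank s1 15 (bank s2 3 (i * J + j)) <= bank s1 15 k1.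
    move=> wk1 km1; have km1' : bank s1 15 k1 < m by rewrite lt1 // (wit_lt wk1).
    have [al [u [alq uq c1' uniq]]] := wit_isolated p1n p1i cK wk1 km1'.
    by apply: (lst al u alq uq i j k1 ip jJ wk1); rewrite hm.
  case: (ltnP (pos k) m) => km; first exact: near.
  apply: leq_trans (near _ wk0 km0) _.
  have a : bank s1 15 k0' < m by rewrite lt1.
  apply: leq_trans (ltnW a) _; rewrite leqNgt lt1 ?(wit_lt wk) // -leqNgt.
  exact: km.
(* Without witnesses in the old prefix the output was settled before: their ranks have not moved,
   and the listing never worsens an entry. *)
have far' k' : wit i j k' -> m <= pos k'.
  move=> wk'; rewrite leqNgt; apply/negP => km; case/existsP: none.
  by exists (Ordinal (wit_lt wk')); rewrite /= wk'.
have same k' : wit i j k' -> bank s1 15 k' = pos k'.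
  by move=> wk'; rewrite E15 ?(wit_lt wk') // /new_rank ltnNge far'.
apply: leq_trans (mono i j ip jJ) _; rewrite (b1 3) // [X in _ <= X]same //.
have stk := st i j k ip jJ wk far'.
case: (sd i j ip jJ) => [e|w]; last by rewrite same.
by rewrite e En -e.
Qed.

End Level.

End Prefix.

(** * Initialisation and main loop *)

(** Loops are counted, so this one runs for all of its argument and merely stops doubling once the
    power is large enough; linear time is affordable here. *)
Definition log_loop (e : expr) : prog :=
  33 <~ e ;; 34 <~ #0 ;; 35 <~ #1 ;;
  PFor true 40 41 r[33] (PIf (r[35] < r[33])%X (35 <~ #2 * r[35] ;; 34 <~ r[34] + #1) PSkip).

Definition parameters : prog :=
  log_loop (#2 * r[0])%X ;; 2 <~ r[34] ;; 3 <~ r[35] ;;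
  log_loop r[2] ;; 6 <~ r[34] ;;
  log_loop r[1] ;;
  4 <~ #2 * r[0] + #1 ;; 5 <~ r[0] + #1 ;; 10 <~ #2 * r[0] - #1 ;;
  12 <~ #16 * (r[2] + r[34]) ;; 13 <~ #2 * (r[12] * r[2]) + #64 ;;
  15 <~ r[0].

Definition powers : prog :=
  PFor true 40 41 (r[2] + #1)%X
    (14[ r[40] ] <~ (r[40] == #0) + (#0 < r[40]) * (#2 * b[14, r[40] - #1])).

(** Trial division of every candidate in the Chebyshev range, at a cost polynomial in [prime_lo] and
    so polylogarithmic. The last prime found is kept. *)
Definition find_prime : prog :=
  14 <~ #0 ;;
  PFor false 54 55 (#2 * (r[13] * r[13]))%X
    (33 <~ r[13] + r[54] + #1 ;; 34 <~ #1 ;;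
     PFor false 50 51 r[33] (34 <~ r[34] * (#1 - (#1 < r[50]) * (r[33] %% r[50] == #0))) ;;
     14 <~ r[34] * r[33] + (#1 - r[34]) * r[14]).

Definition init_tables : prog :=
  PFor true 40 41 (r[0] + #1)%X (15[ r[40] ] <~ r[40]) ;;
  PFor false 18 48 r[1] (out_loop 3 r[0]).

Definition main : prog :=
  parameters ;; powers ;; find_prime ;; init_tables ;;
  PFor false 54 55 r[2] level ;;
  PFor true 40 41 r[0] (2[ b[15, r[40]] ] <~ r[40]).

(** The second factor is G, as 2^G >= 2n p exceeds the number p (2n - 1) of outputs when p > 0. The
    summand 64 in [prime_lo] secures [64 <= q], its other part the bound [2 * (K * k0) <= q] for
    isolation. *)
Definition threshold (n p : nat) : nat := 16 * (up_log 2 (2 * n) + up_log 2 p).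
Definition prime_lo (n p : nat) : nat := 2 * (threshold n p * up_log 2 (2 * n)) + 64.
Definition prime_hi (n p : nat) : nat := 2 * prime_lo n p ^ 2 + prime_lo n p.

Section Main.
Variables (V Y Z : nat).
Notation wp := (wp V Y Z).

Lemma wp_log_loop e s N : ev s e = N -> 1 < V -> N < V -> 2 ^ up_log 2 N < V -> N <= Z ->
  wp (log_loop e) s (fun s' => reg s' 34 = up_log 2 N /\ reg s' 35 = 2 ^ up_log 2 N).
Proof.
move=> eN V1 NV PV NZ.
apply: wp_set; rewrite eN //; apply: wp_set; first by rewrite /=; lia.
apply: wp_set; first by rewrite /=; lia.
have N2 : N <= 2 ^ up_log 2 N by apply: up_logP.
(* Either the power has reached N or each of the i iterations has doubled it; after N iterations the
   second case implies the first, as N < 2^N. *)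
apply: (wp_for (N := N) (I := fun i s' => [/\ reg s' 35 = 2 ^ reg s' 34, reg s' 34 <= up_log 2 N &
   (N <= reg s' 35) || (i <= reg s' 34)])) => //.
- by split=> //=; rewrite orbT.
- move=> i s' iN h40 [r _] [I1 I2 I3].
  have h33 : reg s' 33 = N by rewrite r.
  apply: wp_if => /=; rewrite h33.
    rewrite eqb0 negbK => lt.
    have ul : reg s' 34 < up_log 2 N.
      rewrite ltnNge; apply/negP => h; have := leq_trans N2 (leq_pexp2l (isT : 0 < 2) h).
      by rewrite -I1 leqNgt lt.
    have le : 2 * reg s' 35 <= 2 ^ up_log 2 N by rewrite I1 -expnS leq_pexp2l.
    apply: wp_set; first by rewrite /=; lia.
    split => /=; first by have := ltn_expl (up_log 2 N) (isT : 1 < 2); lia.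
    rewrite /= addn1; split=> //; first by rewrite I1 expnS.
    by move: I3; rewrite leqNgt lt /= => h; apply/orP; right.
  move=> /eqP; rewrite eqb0 -leqNgt => h; split=> //=.
  by rewrite h.
- move=> s' _ [I1 I2 I3].
  have NE : N <= 2 ^ reg s' 34.
    case/orP: I3 => [|h]; first by rewrite I1.
    by apply: leq_trans h (ltnW (ltn_expl _ _)).
  have E : reg s' 34 = up_log 2 N.
    by apply/eqP; rewrite eqn_leq I2 /= up_log_min.
  by rewrite I1 E.
Qed.

Variables (n p : nat) (ra rb : nat -> nat).
Notation k0 := (up_log 2 (2 * n)).
Notation kp := (up_log 2 p).
Notation D := (up_log 2 k0).
Notation J := (n.*2.-1).
Notation G := (k0 + kp).
Notation K := (threshold n p).
Notation X := (prime_lo n p).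
Notation Q := (prime_hi n p).
Hypotheses (n_gt0 : 0 < n) (TV : 2 ^ (k0 + D) < V) (TZ : 2 ^ (k0 + D) <= Z) (MV : 2 * n + 1 < V)
  (pV : (p + 1) * (2 * n) < V) (kpV : 2 ^ kp < V) (pY : p <= Y) (pZ : p <= Z) (QV : Q * Q < V) (QY : Q * Q <= Y).
Hypotheses (ra1 : forall x, ra x <= 1) (rb1 : forall x, rb x <= 1).

Lemma n_k0 : 2 * n <= 2 ^ k0. Proof. exact: up_logP. Qed.

Lemma k0_pos : 0 < k0. Proof. by rewrite up_log_gt0 /=; lia. Qed.

Lemma Q_bounds : [/\ k0 <= K, K <= X, 64 <= X, X <= Q & Q < V].
Proof.
have k1 := k0_pos.
have kK : k0 <= K by rewrite /threshold; lia.
have KX : K <= X.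
  have : K <= K * k0 by rewrite leq_pmulr.
  by rewrite /prime_lo; move: (K * k0) => a; lia.
have X64 : 64 <= X by rewrite leq_addl.
have XQ : X <= Q by rewrite leq_addl.
by split=> //; apply: leq_ltn_trans QV; rewrite leq_pmulr //; lia.
Qed.

Lemma wp_parameters s : reg s 0 = n -> reg s 1 = p -> wp parameters s (fun s' =>
  [/\ [/\ reg s' 2 = k0, reg s' 3 = 2 ^ k0, reg s' 4 = 2 * n + 1, reg s' 5 = n.+1 & reg s' 6 = D],
      [/\ reg s' 0 = n, reg s' 1 = p, reg s' 10 = J & reg s' 12 = K], reg s' 13 = X & reg s' 15 = n]).
Proof.
move=> h0 h1; have V1 : 1 < V by lia.
have [kK KX X64 XQ QV'] := Q_bounds; have k1 := k0_pos; have nk := n_k0.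
have P0 : 2 ^ k0 < V by apply: leq_ltn_trans TV; rewrite leq_pexp2l // leq_addr.
have PD : 2 ^ D < V by apply: leq_ltn_trans TV; rewrite leq_pexp2l // leq_addl.
have PZ : 2 ^ k0 <= Z by apply: leq_trans TZ; rewrite leq_pexp2l // leq_addr.
have kk : k0 < 2 ^ k0 by apply: ltn_expl.
have pV' : p < V by nia.
apply: wp_seq (wp_log_loop (N := 2 * n) _ V1 _ P0 _) _; [by rewrite /= h0|lia|lia|].
move=> s1 [r1 _] [h34 h35]; apply: wp_set; rewrite /= ?h34; first by lia.
apply: wp_set; rewrite /= ?h35 //.
apply: wp_seq (wp_log_loop (N := k0) _ V1 _ PD _) _; [by []|lia|lia|].
move=> s2 [r2 _] [h34' h35']; apply: wp_set; rewrite /= ?h34'; first by have := ltn_expl D (isT : 1 < 2); lia.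
apply: wp_seq (wp_log_loop (N := p) _ V1 _ kpV pZ) _; [by rewrite /= r2 //= r1|lia|].
move=> s3 [r3 _] [h34'' h35''].
have e0 : reg s3 0 = n by rewrite r3 //= r2 //= r1.
have e1 : reg s3 1 = p by rewrite r3 //= r2 //= r1.
have e2 : reg s3 2 = k0 by rewrite r3 //= r2.
have e3 : reg s3 3 = 2 ^ k0 by rewrite r3 //= r2.
have e6 : reg s3 6 = D by rewrite r3.
do 3! (apply: wp_set; first by rewrite /= ?e0; lia).
apply: wp_set; rewrite /= e2 h34'' -[16 * G]/K; first by lia.
apply: wp_set; rewrite /= e2 -[2 * (K * k0) + 64]/X; first by lia.
split; rewrite /= e0; first by lia.
by split=> //; split=> //=; rewrite ?e0; lia.
Qed.

Lemma wp_powers s : reg s 2 = k0 -> wp powers s (fun s' => forall i, i <= k0 -> bank s' 14 i = 2 ^ i).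
Proof.
move=> h2; have kk : k0 < 2 ^ k0 by apply: ltn_expl.
have P0 : 2 ^ k0 < V by apply: leq_ltn_trans TV; rewrite leq_pexp2l // leq_addr.
have PZ : 2 ^ k0 <= Z by apply: leq_trans TZ; rewrite leq_pexp2l // leq_addr.
apply: (wp_fill (N := k0.+1) (val := expn 2)) => //; [by rewrite /= h2 addn1|lia|by rewrite /iters; lia|].
move=> i s' ik h40 _ H _; split; last by apply: leq_ltn_trans P0; rewrite leq_pexp2l.
by rewrite /= h40; case: i ik H {h40} => [|i] ik H //; rewrite subn1 H // expnS mul1n.
Qed.

Lemma wp_find_prime s : reg s 13 = X -> wp find_prime s (fun s' =>
  prime (reg s' 14) /\ X < reg s' 14 <= Q).
Proof.
move=> h13; have [kK KX X64 XQ QV'] := Q_bounds.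
have XX : X ^ 2 = X * X by rewrite expnS expn1.
have QE : Q = 2 * X ^ 2 + X by [].
have QQ : Q <= Q * Q by rewrite leq_pmulr //; lia.
apply: wp_set; first by rewrite /=; lia.
apply: (wp_for (N := 2 * X ^ 2) (I := fun i s' => reg s' 14 < V /\ (
   (prime (reg s' 14) /\ X < reg s' 14 <= Q) \/ forall x, prime x -> X < x -> X + i < x))).
- by rewrite /= h13 XX.
- lia.
- rewrite /iters; lia.
- by split; [rewrite /=; lia|right => x; rewrite addn0].
- move=> i s1 iX h54 [r1 _] [h14 I].
  pose c := X + i + 1.
  have cQ : c <= Q by rewrite /c; lia.
  have e33 : ev s1 (r[13] + r[54] + #1)%X = c by rewrite /= r1 //= h13 h54.
  apply: wp_set; rewrite e33; first by lia.
  apply: wp_set; first by rewrite /=; lia.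
  set s2 := set_reg _ _ _.
  apply: (wp_seq (P := fun s3 => reg s3 34 = prime c)).
    apply: (wp_for (N := c) (I := fun d s3 => reg s3 34 = all (fun x => ~~ ((1 < x) && (x %| c))) (iota 0 d))) => //.
    + lia.
    + rewrite /iters; lia.
    + move=> d s3 dc h50 [r3 _] I3.
      have e : reg s3 33 = c by rewrite r3.
      have E : ev s3 (r[34] * (#1 - (#1 < r[50]) * (r[33] %% r[50] == #0)))%X =
          all (fun x => ~~ ((1 < x) && (x %| c))) (iota 0 d.+1).
        rewrite -[iota 0 d.+1]cats0 -(addn1 d) iotaD cats0 all_cat /= I3 h50 e andbT /dvdn add0n.
        by case: (all _ _); case: (1 < d); case: (c %% d == 0).
      by split; rewrite E //; case: (all _ _) => /=; lia.
    + move=> s3 _ ->; congr nat_of_bool; apply/allP/primeP => [H|[c1 H] x].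
        split; first by rewrite /c; lia.
        move=> d dc; have c0 : 0 < c by rewrite /c; lia.
        have := dvdn_leq c0 dc; rewrite leq_eqVlt => /orP[->|dl]; first by rewrite orbT.
        have := H d; rewrite mem_iota /= add0n dl dc andbT => /(_ isT); rewrite -leqNgt.
        have := dvdn_gt0 c0 dc; case: d {dc dl} => [|[|d]] //.
      rewrite mem_iota add0n /= => xc; apply/negP => /andP[x1 /H /orP[]/eqP]; lia.
  move=> s3 [r3 _] h34.
  have E : ev s3 (r[34] * r[33] + (#1 - r[34]) * r[14])%X = if prime c then c else reg s1 14.
    by rewrite /= h34 !r3 //=; case: (prime c); rewrite ?mul1n ?mul0n ?subnn ?subn0 ?mul0n ?mul1n ?addn0 ?add0n.
  have r14 : ev s3 (r[34] * r[33] + (#1 - r[34]) * r[14])%X < V by rewrite E; case: ifP => _; lia.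
  split; [by []|split; [by []|]]; rewrite /= in E; rewrite /= E; case: ifP => [pc|npc].
    by left; split=> //; rewrite cQ andbT /c; lia.
  case: I => [I|I]; [by left|right => x px Xx].
  have := I x px Xx; rewrite leq_eqVlt => /orP[/eqP xe|]; last by lia.
  by move: px; rewrite -xe -[(X + i).+1]addn1 -/c npc.
- move=> s' _ [_ [//|H]].
  have [x px /andP[xX xQ]] := prime_between (leq_trans (isT : 7 <= 64) X64).
  by have := H x px xX; lia.
Qed.


Lemma wp_init_tables s : reg s 0 = n -> reg s 1 = p -> reg s 10 = J ->
  wp init_tables s (fun s' => (forall k, k <= n -> bank s' 15 k = k) /\
    forall i j, i < p -> j < J -> bank s' 3 (i * J + j) = n).
Proof.
move=> h0 h1 h10; have nk := n_k0.
have P0 : 2 ^ k0 < V by apply: leq_ltn_trans TV; rewrite leq_pexp2l // leq_addr.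
have PZ : 2 ^ k0 <= Z by apply: leq_trans TZ; rewrite leq_pexp2l // leq_addr.
have pV' : p < V by nia.
apply: (wp_seq (P := fun s1 => forall k, k <= n -> bank s1 15 k = k)).
  apply: (wp_fill (N := n.+1) (val := id)) => //; [by rewrite /= h0 addn1|lia|by rewrite /iters; lia|].
  by move=> i s1 iN h40 _ _ _; split; [|lia].
move=> s1 [r1 _] H1.
apply: (wp_for (N := p) (I := fun i s2 => forall i' j, i' < i -> j < J -> bank s2 3 (i' * J + j) = n)) => //.
- by rewrite /= r1.
- move=> i s2 ip h18 [r2 b2] I2.
  apply: (wp_scatter (N := J) (adr := fun j => i * J + j) (val := fun _ => n)) => //.
  + by rewrite /= r2 //= r1.
  + by lia.
  + by rewrite /iters; lia.
  + by move=> x y _ _; apply: addnI.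
  + move=> j s3 jJ h40 [r3 _] _ _.
    have e18 : reg s3 18 = i by rewrite r3.
    have e10 : reg s3 10 = J by rewrite r3 // r2 //= r1.
    have e0 : reg s3 0 = n by rewrite r3 // r2 //= r1.
    by rewrite /= e18 e10 e0 h40; split=> //; lia.
  + move=> s3 _ E F i' j ii jJ /=; have [ii'|->] : i' < i \/ i' = i by lia.
      rewrite F ?I2 // => j' jj /(address jj jJ)[]; lia.
    exact: E.
- by move=> s2 [_ b2] I2; split=> // k kn; rewrite b2 // H1.
Qed.

Lemma wp_main s : reg s 0 = n -> reg s 1 = p -> bank s 0 =1 ra -> bank s 1 =1 rb ->
  wp main s (fun s' => exists pos : nat -> nat,
    [/\ forall k, k < n -> pos k < n, {in [pred k | k < n] &, injective pos},
        forall k, k < n -> bank s' 2 (pos k) = k &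
        forall i j k, i < p -> j < J -> wit n ra rb i j k ->
          wit n ra rb i j (bank s' 3 (i * J + j)) /\ pos (bank s' 3 (i * J + j)) <= pos k]).
Proof.
move=> h0 h1 hra hrb; have [kK KX X64 XQ QV'] := Q_bounds.
have nk := n_k0; have k1 := k0_pos; have KK : K = 16 * G by [].
have P0 : 2 ^ k0 < V by apply: leq_ltn_trans TV; rewrite leq_pexp2l // leq_addr.
have PZ : 2 ^ k0 <= Z by apply: leq_trans TZ; rewrite leq_pexp2l // leq_addr.
have kk : k0 < 2 ^ k0 by apply: ltn_expl.
apply: wp_seq (wp_parameters h0 h1) _ => s1 [r1 b1] [[e2 e3 e4 e5 e6] [e0 e1 e10 e12] e13 e15].
apply: wp_seq (wp_powers e2) _ => s2 fr2 E14; have [r2 b2] := fr2.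
apply: wp_seq (wp_find_prime (s := s2) _) _; first by rewrite r2.
move=> s3 fr3 [q_prime /andP[qX qQ]]; have [r3 b3] := fr3; set q := reg s3 14 in q_prime qX qQ.
apply: wp_seq (wp_init_tables (s := s3) _ _ _) _; [by rewrite r3 // r2|by rewrite r3 // r2|by rewrite r3 // r2|].
move=> s4 fr4 [E15 E3]; have [r4 b4] := fr4.
have c4 : ctx n p k0 K q ra rb s4.
  split; last by move=> x; rewrite b4 // b3 // b2 // b1.
  - split; first by split; rewrite r4 // r3 // r2.
    by move=> i ik; rewrite b4 // b3 // E14.
  - by split; rewrite r4 // r3 // r2.
  - by move=> x; rewrite b4 // b3 // b2 // b1.
have qqQ : q * q <= Q * Q by apply: leq_mul.
have pJV : p * J < V by apply: leq_ltn_trans pV; apply: leq_mul; lia.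
have pV' : p < V by apply: leq_trans pV; rewrite addn1; nia.
have kY : k0 + 2 <= Y by have : Q <= Q * Q by [rewrite leq_pmulr //; lia]; lia.
apply: (wp_seq (P := level_inv n p ra rb k0)).
  apply: (wp_for (N := k0) (I := level_inv n p ra rb)) => //.
  - by rewrite /= r4 // r3 // r2.
  - by lia.
  - by rewrite /iters; lia.
  - split=> /=.
    + by rewrite r4 // r3 // r2 // e15 muln1.
    + split=> [k kn|x y xn yn|]; rewrite ?E15 //; [exact: ltnW|exact: ltnW|exact: ltnW].
    + by move=> i j ip jJ; left; apply: E3.
    + move=> i j k ip jJ w; rewrite r4 // r3 // r2 // e15 => /(_ k w).
      by rewrite E15 ?(ltnW (wit_lt w)) //; have := wit_lt w; lia.
  - move=> l s5 lk h54 fr5 I5; have c5 := ctx_frame fr5 isT isT c4.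
    have Kq : 2 * (K * k0) <= q by move: qX; rewrite /prime_lo; lia.
    have pJ : p * J < 2 ^ G.
      rewrite expnD mulnC; apply: (@leq_ltn_trans (J * 2 ^ kp)); first by rewrite leq_mul2l up_logP ?orbT.
      by rewrite ltn_mul2r expn_gt0 /=; lia.
    apply: wp_conseq (wp_level (G := G) _ _ _ TV TZ _ _ _ _ _ _ _ _ _ ra1 rb1 KK _ Kq _ pJ c5 I5) _ => //; lia.
move=> s5 fr5 [m0 [pos_lt pos_inj posn] sd st]; have [r5 b5] := fr5.
(* The prefix has been halved k0 times and n < 2^k0, so it is empty and all outputs are settled. *)
have {}m0 : reg s5 15 = 0.
  case: (reg s5 15) m0 => // m; rewrite mulSn => h; have := leq_trans (leq_addr _ _) h; lia.
apply: (wp_scatter (N := n) (adr := bank s5 15) (val := id)) => //.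
- by rewrite /= r5 // r4 // r3 // r2.
- by lia.
- by rewrite /iters; lia.
- by move=> k s6 kn h40 [r6 b6] _ _; rewrite /= h40 b6; split=> //; lia.
- move=> s6 [r6 b6] E6 _; exists (bank s5 15); split=> //.
  move=> i j k ip jJ wk; rewrite !b6 //.
  have le := st i j k ip jJ wk; rewrite m0 in le; have {}le := le (fun _ _ => leq0n _).
  split=> //; case: (sd i j ip jJ) => // E; move: le; rewrite E posn.
  by have := pos_lt k (wit_lt wk); lia.
Qed.

End Main.

(** * Polylogarithmic bounds and the theorem *)

Lemma lt_exp_log2 n : n < 2 ^ log2 n.
Proof. exact: trunc_log_ltn. Qed.

Lemma up_log2_le m : 2 ^ up_log 2 m <= 2 * m + 1.
Proof.
have [m1|m1] := leqP m 1.
  have /eqP-> : up_log 2 m == 0 by rewrite up_log_eq0 m1.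
  by rewrite expn0; lia.
have := up_log_gtn (isT : 1 < 2) m1; have : 0 < up_log 2 m by rewrite up_log_gt0.
by case: (up_log 2 m) => // k _ /= h; rewrite expnS; lia.
Qed.

Lemma polylog_le A d : exists c, forall n p, 0 < n -> p <= A * log2 n ^ d ->
  let L := log2 n in
  [/\ 2 ^ (up_log 2 (2 * n) + up_log 2 (up_log 2 (2 * n))) <= 32 * n * L,
      prime_hi n p <= c * L ^ (2 * d + 4) & 2 ^ up_log 2 p <= 2 * p + 1].
Proof.
(* With G <= (A + 2) L^(d+1) and k0 <= 2L, the term 2 * 16 * G * k0 is at most 64 (A + 2) L^(d+2),
   and the added 64 gives A + 3. Then 2 X^2 + X <= 3 X^2 explains the factor 3. *)
pose c := 64 * (A + 3).
exists (3 * c ^ 2) => n p n0 pA L; have L1 : 0 < L by [].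
have nL := lt_exp_log2 n; rewrite -/L in nL pA.
have k0L : up_log 2 (2 * n) <= 2 * L.
  by apply: leq_trans (_ : L.+1 <= _); [apply: up_log_min => //; rewrite expnS|]; lia.
have k00 : 0 < up_log 2 (2 * n) by rewrite up_log_gt0 /=; lia.
split; last exact: up_log2_le.
- rewrite expnD; apply: leq_trans (leq_mul (up_log2_le _) (up_log2_le _)) _.
  apply: leq_trans (_ : (5 * n) * (5 * L) <= _); first by apply: leq_mul; lia.
  by rewrite mulnACA -(mulnA 32) leq_mul2r orbT.
have ld i j : i <= j -> L ^ i <= L ^ j by move=> ij; rewrite leq_pexp2l.
have kp : up_log 2 p <= p by apply: up_log_min => //; apply: ltnW; apply: ltn_expl.
have G : up_log 2 (2 * n) + up_log 2 p <= (A + 2) * L ^ (d + 1).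
  rewrite mulnDl addnC leq_add //.
    by apply: leq_trans kp (leq_trans pA _); rewrite leq_mul2l ld ?orbT ?leq_addr.
  by apply: leq_trans k0L _; rewrite leq_mul2l -{1}(expn1 L) ld ?leq_addl.
have X : prime_lo n p <= c * L ^ (d + 2).
  rewrite /prime_lo /threshold.
  have : (up_log 2 (2 * n) + up_log 2 p) * up_log 2 (2 * n) <= (A + 2) * 2 * L ^ (d + 2).
    apply: leq_trans (leq_mul G k0L) _.
    by rewrite mulnACA (_ : d + 2 = (d + 1).+1) ?expnSr //; lia.
  have : 0 < L ^ (d + 2) by rewrite expn_gt0 L1.
  rewrite -(mulnA 16) /c.
  move: ((_ + _) * up_log 2 (2 * n)) (L ^ (d + 2)) => x y; lia.
rewrite /prime_hi; have E : L ^ (2 * d + 4) = (L ^ (d + 2)) ^ 2 by rewrite -expnM; congr (_ ^ _); lia.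
rewrite E -mulnA -expnMn; have : prime_lo n p <= prime_lo n p ^ 2.
  by rewrite expnS expn1 leq_pmulr // /prime_lo addn_gt0 orbT.
have : prime_lo n p ^ 2 <= (c * L ^ (d + 2)) ^ 2 by rewrite leq_exp2r.
by move: (_ ^ 2) (_ ^ 2) => x y; lia.
Qed.

Lemma leq_expW m n k : m <= n -> m ^ k <= n ^ k.
Proof. by case: k => // k mn; rewrite leq_exp2r. Qed.

(** Every near-linear quantity fits into O(log n) bits: c, n and L^k take at most c L, L and k L of
    them. *)
Lemma lt_exp_word c k n L : 0 < n -> n < 2 ^ L -> c * (n * L ^ k) < 2 ^ ((c + 1 + k) * L).
Proof.
move=> n0 nL; have L1 : 0 < L by case: L nL => //; lia.
have LL : L < 2 ^ L by apply: ltn_expl.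
rewrite !mulnDl mul1n !expnD -mulnA.
have a1 : c <= 2 ^ (c * L).
  by apply: leq_trans (ltnW (ltn_expl _ (isT : 1 < 2))) _; rewrite leq_pexp2l // leq_pmulr.
have a2 : L ^ k <= 2 ^ (k * L).
  by rewrite mulnC expnM; case: k => // k; rewrite leq_exp2r // ltnW.
apply: (@leq_ltn_trans (2 ^ (c * L) * (n * 2 ^ (k * L)))); first by rewrite !leq_mul.
by rewrite ltn_pmul2l ?expn_gt0 // ltn_pmul2r ?expn_gt0.
Qed.

Lemma resource_bounds cQ A d n L p Q T h : 0 < n -> n < 2 ^ L -> p <= A * L ^ d ->
  Q <= cQ * L ^ (2 * d + 4) -> T <= 32 * n * L -> h <= 2 * p + 1 ->
  let e := (2 * d + 4) + (2 * d + 4) in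
  [/\ Q * Q + T + (p + 1) * (2 * n) + h + 2 * n + 66 < 2 ^ ((cQ ^ 2 + 4 * A + 200 + 1 + e) * L),
      T + p <= (32 + A) * (n * L ^ (d + 1)) &
      Q * Q + p + 1 <= (cQ ^ 2 + A + 1) * L ^ e].
Proof.
move=> n0 nL pA hQ hT hh e; have L1 : 0 < L by case: L nL {pA hQ hT} => //; lia.
have Lp i j : i <= j -> L ^ i <= L ^ j by move=> ij; rewrite leq_pexp2l.
have Le i : 0 < L ^ i by rewrite expn_gt0 L1.
have QQ : Q * Q <= cQ ^ 2 * L ^ e.
  by apply: leq_trans (leq_mul hQ hQ) _; rewrite (expnD L (2 * d + 4)) (expnS cQ) expn1 mulnACA leqnn.
have de : d + 1 <= e by rewrite /e; lia.
have pL : p <= A * L ^ e.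
  apply: leq_trans pA _; rewrite leq_mul2l Lp ?orbT //.
  by apply: leq_trans de; rewrite leq_addr.
have nLe i : L ^ i <= n * L ^ i by rewrite leq_pmull.
have TL : T <= 32 * (n * L ^ (d + 1)).
  apply: leq_trans hT _; rewrite -mulnA !leq_mul2l -{1}(expn1 L) Lp ?orbT //; exact: leq_addl.
have pL' : p <= A * (n * L ^ (d + 1)).
  apply: leq_trans pA _; rewrite leq_mul2l; apply/orP; right.
  by apply: leq_trans (nLe _) _; rewrite leq_mul2l Lp ?orbT //; exact: leq_addr.
split; last 2 first.
- by rewrite mulnDl leq_add.
- by rewrite !mulnDl mul1n !leq_add // Le.
apply: leq_ltn_trans (lt_exp_word _ _ n0 nL).
have h1 : Q * Q <= cQ ^ 2 * (n * L ^ e) by apply: leq_trans QQ _; rewrite leq_mul2l nLe orbT.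
have h2 : T <= 32 * (n * L ^ e).
  by apply: leq_trans TL _; rewrite !leq_mul2l Lp ?orbT.
have h3 : p * n <= A * (n * L ^ e) by rewrite mulnCA mulnC leq_mul2l pL orbT.
have h4 : n <= n * L ^ e by rewrite leq_pmulr.
have h5 : p <= A * (n * L ^ e) by apply: leq_trans pL _; rewrite leq_mul2l nLe orbT.
have -> : (p + 1) * (2 * n) = 2 * (p * n) + 2 * n by rewrite mulnDl mul1n mulnCA.
rewrite 2!mulnDl -(mulnA 4); move: h1 h2 h3 h4 h5; set N := n * L ^ e.
move: (cQ ^ 2 * N) (A * N) (p * n) (Q * Q) => x1 x2 x3 x4; clear -n0 hh; lia.
Qed.

Lemma rows_entry p n (a : 'I_p -> n.-tuple bool) (i : 'I_p) k : k < n ->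
  rows a (i * n + k) = nth false (a i) k.
Proof.
move=> kn; rewrite /rows divnMDl; last by lia.
by rewrite divn_small // addn0 modnMDl modn_small // valK.
Qed.

Lemma rows_le1 p n (a : 'I_p -> n.-tuple bool) x : rows a x <= 1.
Proof. by rewrite /rows; case: insub => // i; apply: leq_b1. Qed.

Lemma bounded_input V p n (a b : 'I_p -> n.-tuple bool) :
  1 < V -> n < V -> p < V -> bounded V (input a b).
Proof.
move=> V1 nV pV; split=> [[|[|x]]|[|[|B]] x] //=; rewrite ?nth_nil; try exact: ltnW.
  exact: leq_ltn_trans (rows_le1 a x) V1.
exact: leq_ltn_trans (rows_le1 b x) V1.
Qed.

Lemma wit_witness p n (a b : 'I_p -> n.-tuple bool) (i : 'I_p) j (k : 'I_n) :
  wit n (rows a) (rows b) i j k = witness (a i) (b i) j k.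
Proof.
rewrite /wit /witness ltn_ord /= rows_entry // (tnth_nth false) eqb0 negbK; congr (_ && _).
case: (k <= j) => //=; case: ltnP => h /=; first by rewrite rows_entry // eqb0 negbK.
by rewrite nth_default // size_tuple.
Qed.

Lemma conv_witness n (a b : n.-tuple bool) j : conv a b j -> exists k, witness a b j k.
Proof.
case/existsP=> k /existsP[l /andP[/eqP <- /andP[ak bl]]]; exists k.
by rewrite /witness ak leq_addr addKn -tnth_nth.
Qed.

(** The program works with ranks, which give the inverse of the permutation, whereas bank 2 lists
    the permutation itself. *)
Lemma output_of_ranks p n (a b : 'I_p -> n.-tuple bool) (st : state) (pos : nat -> nat) :
  (forall k, k < n -> pos k < n) -> {in [pred k | k < n] &, injective pos} ->
  (forall k, k < n -> bank st 2 (pos k) = k) ->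
  (forall i j k, i < p -> j < n.*2.-1 -> wit n (rows a) (rows b) i j k ->
     wit n (rows a) (rows b) i j (bank st 3 (i * n.*2.-1 + j)) /\
     pos (bank st 3 (i * n.*2.-1 + j)) <= pos k) ->
  exists s : {perm 'I_n}, output a b st s.
Proof.
move=> pos_lt pos_inj b2 b3.
pose f (k : 'I_n) := Ordinal (pos_lt k (ltn_ord k)).
have f_inj : injective f.
  move=> x y /(congr1 val) /= E; apply: val_inj; apply: pos_inj E; rewrite inE; exact: ltn_ord.
exists ((perm f_inj)^-1)%g; split.
  move=> m; have E : pos ((perm f_inj)^-1 m)%g = m.
    by have := permKV (perm f_inj) m; rewrite permE => /(congr1 val).
  by rewrite -{1}E b2.
move=> i j /conv_witness[k]; rewrite -wit_witness => w.
have [w' _] := b3 i j k (ltn_ord i) (ltn_ord j) w.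
pose k' := Ordinal (wit_lt w'); exists k' => //; split; first by rewrite -wit_witness.
move=> k1; rewrite -wit_witness => w1; rewrite invgK !permE /=.
by have [] := b3 i j k1 (ltn_ord i) (ltn_ord j) w1.
Qed.

Lemma main_checks : [/\ wf main, long_depth main = 1 & prog_lit main = 64].
Proof. by []. Qed.

Theorem theorem21 :
  exists prog : cmd,
  forall A d : nat, exists C e c : nat,
  forall (n p : nat) (a b : 'I_p -> n.-tuple bool),
    0 < n -> p <= A * log2 n ^ d ->
    exists (t : nat) (st : state),
      [/\ exec (c * log2 n) prog (input a b) t st,
          t <= C * n * log2 n ^ e
        & exists s : {perm 'I_n}, output a b st s].
Proof.
exists (compile main) => A d; have [C0 tC] := time_poly main.
have [wfm ldm plm] := main_checks; rewrite ldm in tC.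
have [cQ bounds] := polylog_le A d.
pose e := (2 * d + 4) + (2 * d + 4).
exists (C0 * (32 + A) * (cQ ^ 2 + A + 1) ^ short_depth main), (d + 1 + e * short_depth main),
  ((cQ ^ 2 + 4 * A + 200 + 1 + e) * max_cost main).
move=> n p a b n0 pA; have [hT hQ hkp] := bounds n p n0 pA.
have [WV ZL YL] := resource_bounds n0 (lt_exp_log2 n) pA hQ hT hkp.
have wpm V Y Z := @wp_main V Y Z n p (rows a) (rows b) n0.
have wpx V Y Z w := @wp_exec V Y Z w main (input a b).
rewrite -/e in WV YL; clearbody e.
(* The measures of the program are made opaque numerals here, so that arithmetic never unfolds
   [main]. *)
move: (max_cost main) (short_depth main) (prime_hi n p) (log2 n) wpm wpx tC WV ZL YL {hT hQ bounds pA hkp}.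
move=> mc sd Q L wpm wpx tC WV ZL YL.
pose w := (cQ ^ 2 + 4 * A + 200 + 1 + e) * mc * L.
set T := 2 ^ _ in wpm WV ZL; set h := 2 ^ up_log 2 p in wpm WV.
have [V WV' VW] : exists2 V,
    Q * Q + T + (p + 1) * (2 * n) + h + 2 * n + 66 < V & V ^ mc <= 2 ^ w.
  (* V bounds all stored values, and the word length is [mc] times its number of bits, which makes
     room for every intermediate value of an expression. *)
  exists (2 ^ ((cQ ^ 2 + 4 * A + 200 + 1 + e) * L)); first exact: WV.
  by rewrite -expnM /w mulnAC leqnn.
rewrite -/w; move: w VW => w VW {WV}.
have [V1 nV pV V64] : [/\ 1 < V, n < V, p < V & prog_lit main < V].
  by rewrite plm; split; apply: leq_ltn_trans WV'; clear -n0; nia.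
pose Y := Q * Q + p + 1; pose Z := T + p.
have bnd := bounded_input a b V1 nV pV.
have [TV MV pnV hV QV] : [/\ T < V, 2 * n + 1 < V, (p + 1) * (2 * n) < V, h < V & Q * Q < V].
  by split; apply: leq_ltn_trans WV'; clear; lia.
have TZ : T <= Z by apply: leq_addr.
have pZ : p <= Z by apply: leq_addl.
have pY : p <= Y by rewrite /Y addnAC; apply: leq_addl.
have QY : Q * Q <= Y by rewrite /Y -addnA; apply: leq_addr.
have Y1 : 0 < Y by rewrite /Y addn1.
have Z1 : 0 < Z by rewrite /Z addn_gt0 expn_gt0.
have [t [st [X tT _ [pos [h1 h2 h3 h4]]]]] := wpx V Y Z w _ V1 wfm V64 VW bnd
  (wpm V Y Z TV TZ MV pnV hV pY pZ QV QY (rows_le1 a) (rows_le1 b) (input a b)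
     erefl erefl (fun _ => erefl) (fun _ => erefl)).
exists t, st; split; [exact: X| |exact: output_of_ranks h1 h2 h3 h4].
apply: leq_trans tT (leq_trans (tC Y Z Y1 Z1) _); rewrite expn1.
have YLs : Y ^ sd <= (cQ ^ 2 + A + 1) ^ sd * L ^ (e * sd).
  rewrite expnM -expnMn; exact: leq_expW YL.
apply: leq_trans (leq_mul (leq_mul (leqnn C0) ZL) YLs) _.
move: (_ ^ sd) => x; rewrite (expnD L (d + 1)); move: (L ^ _) (L ^ _) (32 + A) => y z u; clear; lia.
Qed.
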